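(* Let $\omega_s,\omega_a\in(0,2]$ satisfy $\omega_s\mathcal{L}_1\ge\max(0,\omega_s-1)$ and, for every $\ell\in\{1,\dots,W\}$, $$\omega_a\max_{u\in[-u_\infty,u_\infty]}\Bigl|\sum_{k=1}^d\mathcal{N}_{2\ell,k}\varphi_k'(u)\Bigr|\le\omega_s\mathcal{L}_{2\ell}+\tfrac12\min\bigl(2-\omega_s-\omega_a,\ 0,\ \omega_a-\omega_s\bigr).$$ Let $(\Delta x_p)_{p\in\mathbb{N}}$ be a sequence of positive space-steps such that $\lim_{p\to+\infty}\Delta x_p=0$, and let $f_{\Delta_p}$, $u_{\Delta_p}$ denote the reconstructed numerical solutions for the space-step $\Delta x_p$. Then there exist a subsequence, still denoted $(\Delta x_p)_{p\in\mathbb{N}}$, and a function $\bar f:[0,+\infty)\times\mathbb{R}^d\to\mathbb{R}^q$ such that, for $t\ge 0$, $\bar f(t,\cdot)\in L^1(\mathbb{R}^d)$ and $\bar f(t,x)\in K$ for a.e. $x$, and such that, for every $T>0$, $$\lim_{p\to+\infty}\|f_{\Delta_p}-\bar f\|_{L^\infty_t([0,T])L^1_x}=0.$$ Moreover, setting $\bar u:=\sum_{i=1}^q\bar f_i$, one has $\bar u(t,x)\in[-u_\infty,u_\infty]$ for a.e. $x$, and $\lim_{p\to+\infty}\|u_{\Delta_p}-\bar u\|_{L^\infty_t([0,T])L^1_x}=0$. Furthermore, the limit is at equilibrium: $\bar f(t,x)=f^{\rm eq}(\bar u(t,x))$ for a.e. $x$. Finally, $\bar u$ is a weak solution of $$\partial_t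 u+\sum_{k=1}^d\partial_{x_k}\varphi_k(u)=0\ \ (t>0,\ x\in\mathbb{R}^d),\qquad u(0,x)=u^\circ(x)\ \ (x\in\mathbb{R}^d).$$
   Context: Setting. Let $d,W\ge 1$ be integers, $q=1+2W$, $\lambda>0$ (fixed, independent of the space-step, as are all velocities, coefficients and relaxation parameters). Discrete velocities: $c_1=0$ and $c_{2\ell}=-c_{2\ell+1}\in\lambda\mathbb{Z}^d$ for $\ell=1,\dots,W$; $c_{i,k}$ is the $k$-th component of $c_i$. Fluxes $\varphi_k\in C^1(\mathbb{R})$, $k=1,\dots,d$, are non-constant with $\varphi_k(0)=0$. The initial datum is $u^\circ\in L^1(\mathbb{R}^d)\cap L^\infty(\mathbb{R}^d)\cap BV(\mathbb{R}^d)$ and $u_\infty:=\|u^\circ\|_{L^\infty}$. Equilibria: $f_i^{\rm eq}(u)=\mathcal{L}_i u+\sum_{k=1}^d\mathcal{N}_{i,k}\varphi_k(u)$, $i=1,\dots,q$, and $f^{\rm eq}=(f_1^{\rm eq},\dots,f_q^{\rm eq})$, with real coefficients satisfying $\mathcal{L}_{2\ell}=\mathcal{L}_{2\ell+1}$, $\mathcal{N}_{2\ell,k}=-\mathcal{N}_{2\ell+1,k}\ge 0$, $\mathcal{L}_1+2\sum_{\ell=1}^W\mathcal{L}_{2\ell}=1$, $\mathcal{N}_{1,k}=0$, and $2\sum_{\ell=1}^W c_{2\ell,k}\mathcal{N}_{2\ell,p}=\delta_{k,p}$ for all $k,p\in\{1,\dots,d\}$. Compact set: $K:=\prod_{i=1}^q[f_i^{\rm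 eq}(-u_\infty),f_i^{\rm eq}(u_\infty)]$. Relaxation operator $\mathcal{R}=(\mathcal{R}_1,\dots,\mathcal{R}_q):\mathbb{R}^q\to\mathbb{R}^q$: for $f\in\mathbb{R}^q$ set $u=\sum_{i=1}^q f_i$ and $\mathcal{R}_1(f)=(1-\omega_s)f_1+\omega_s f_1^{\rm eq}(u)$, $\mathcal{R}_{2\ell}(f)=\bigl(1-\tfrac12(\omega_s+\omega_a)\bigr)f_{2\ell}+\tfrac12(\omega_s+\omega_a)f_{2\ell}^{\rm eq}(u)-\tfrac12(\omega_s-\omega_a)\bigl(f_{2\ell+1}-f_{2\ell+1}^{\rm eq}(u)\bigr)$, $\mathcal{R}_{2\ell+1}(f)=\bigl(1-\tfrac12(\omega_s+\omega_a)\bigr)f_{2\ell+1}+\tfrac12(\omega_s+\omega_a)f_{2\ell+1}^{\rm eq}(u)-\tfrac12(\omega_s-\omega_a)\bigl(f_{2\ell}-f_{2\ell}^{\rm eq}(u)\bigr)$. Scheme with space-step $\Delta x>0$. Let $\Delta t=\Delta x/\lambda$, $t^n=n\Delta t$, and for $j\in\mathbb{Z}^d$ let $C_j=\prod_{k=1}^d\bigl((j_k-\tfrac12)\Delta x,(j_k+\tfrac12)\Delta x\bigr)$. Initialization: $f_{i,j}^0=f_i^{\rm eq}\bigl(\frac{1}{|C_j|}\int_{C_j}u^\circ(x)\,\mathrm{d}x\bigr)$. Evolution: $f_{i,j}^{n+1}=\mathcal{R}_i\bigl(f_{1,j-c_i/\lambda}^n,\dots,f_{q,j-c_i/\lambda}^n\bigr)$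 for $n\in\mathbb{N}$, $j\in\mathbb{Z}^d$, $i\in\{1,\dots,q\}$; $u_j^n=\sum_{i=1}^q f_{i,j}^n$. Reconstructions (defined a.e. in $x$): $f_\Delta(t,x)=(f_{1,j}^n,\dots,f_{q,j}^n)$ and $u_\Delta(t,x)=u_j^n$ for $t\in[t^n,t^{n+1})$, $x\in C_j$. Norms: $\mathbb{R}^q$ is endowed with the $\ell^1$-norm, and $\|g\|_{L^\infty_t([0,T])L^1_x}=\sup_{t\in[0,T]}\|g(t,\cdot)\|_{L^1(\mathbb{R}^d)}$. Weak solution: $\bar u$ is a weak solution of the Cauchy problem if for all $\psi\in C_c^1([0,+\infty)\times\mathbb{R}^d)$, $\int_0^{+\infty}\int_{\mathbb{R}^d}\bigl(\bar u\,\partial_t\psi+\sum_{k=1}^d\varphi_k(\bar u)\,\partial_{x_k}\psi\bigr)\mathrm{d}x\,\mathrm{d}t+\int_{\mathbb{R}^d}u^\circ(x)\psi(0,x)\,\mathrm{d}x=0$. *)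

(* Defs.v *)
From HB Require Import structures.
From mathcomp Require Import all_boot all_order all_algebra.
From mathcomp Require Import all_classical all_reals all_analysis.

Set Implicit Arguments.
Unset Strict Implicit.
Unset Printing Implicit Defensive.

Import Order.TTheory GRing.Theory Num.Theory.
Import numFieldNormedType.Exports.

Local Open Scope classical_set_scope.
Local Open Scope ring_scope.

Definition rV_display : measure_display.
Proof. exact: default_measure_display. Qed.

(* R^n is equipped with the sigma-algebra generated by the coordinates, as the
   library does for [n.-tuple T]; it is the Borel sigma-algebra. *)
Section measurable_rV.
Context {R : realType} (n : nat).

Definition rV_coord (i : 'I_n) (x : 'rV[R]_n) : measurableTypeR R := x ord0 i.

Let rV_set0 : g_sigma_preimage rV_coord set0.
Proof. exact: sigma_algebra0. Qed.

Let rV_setC A : g_sigma_preimage rV_coord A -> g_sigma_preimage rV_coord (~` A).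
Proof. exact: sigma_algebraC. Qed.

Let rV_bigcup (F : _^nat) : (forall i, g_sigma_preimage rV_coord (F i)) ->
  g_sigma_preimage rV_coord (\bigcup_i (F i)).
Proof. exact: sigma_algebra_bigcup. Qed.

HB.instance Definition _ := @isMeasurable.Build rV_display
  'rV[R]_n (g_sigma_preimage rV_coord) rV_set0 rV_setC rV_bigcup.

Lemma measurable_rV_coord (i : 'I_n) : measurable_fun setT (rV_coord i).
Proof.
move=> _ Y mY; rewrite setTI; apply: sub_sigma_algebra => /=.
rewrite -bigcup_seq/=; exists i => /=; first by rewrite mem_index_enum.
by exists Y => //; rewrite setTI.
Qed.

End measurable_rV.

Lemma measurable_fun_rV (R : realType) n d (T : measurableType d)
    (f : T -> 'rV[R]_n) :
  (forall i, measurable_fun setT (rV_coord i \o f)) -> measurable_fun setT f.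
Proof.
move=> mf.
suff : g_sigma_preimage (fun i => rV_coord i \o f) `<=` measurable.
  by rewrite g_sigma_preimage_comp => prefS _ A mA; apply: prefS; exists A.
apply: smallest_sub; first exact: sigma_algebra_measurable.
case: n f mf => [|n] f mf; first by rewrite big_ord0.
rewrite -bigcup_mkord_ord; apply: bigcup_sub => i Ii.
by move=> A [B mB <-]; exact: mf.
Qed.

Section rV_cons.
Context {R : realType} (n : nat).

Definition rV_cons (p : measurableTypeR R * 'rV[R]_n) : 'rV[R]_n.+1 :=
  \row_i (if unlift ord0 i is Some j then p.2 ord0 j else p.1).

Definition rV_uncons (x : 'rV[R]_n.+1) : measurableTypeR R * 'rV[R]_n :=
  (x ord0 ord0, \row_j x ord0 (lift ord0 j)).

Lemma rV_consK : cancel rV_cons rV_uncons.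
Proof.
case=> a y; rewrite /rV_uncons /= mxE unlift_none; congr pair.
by apply/rowP => j; rewrite !mxE liftK.
Qed.

Lemma rV_unconsK : cancel rV_uncons rV_cons.
Proof.
move=> x; apply/rowP => i; rewrite mxE /=.
by case: unliftP => [j ->|->] //; rewrite mxE.
Qed.

Lemma measurable_rV_cons : measurable_fun setT rV_cons.
Proof.
apply: measurable_fun_rV => i.
have [j ->|->] := unliftP ord0 i.
- rewrite (_ : _ \o _ = rV_coord j \o snd); last first.
    by apply/funext => p; rewrite /= /rV_coord mxE liftK.
  by apply: measurableT_comp => //; exact: measurable_rV_coord.
- rewrite (_ : _ \o _ = fst)//.
  by apply/funext => p; rewrite /= /rV_coord mxE unlift_none.
Qed.

Lemma measurable_rV_uncons : measurable_fun setT rV_uncons.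
Proof.
apply/measurable_fun_pairP; split => /=.
  exact: (measurable_rV_coord ord0).
apply: measurable_fun_rV => j.
rewrite (_ : _ \o _ = rV_coord (lift ord0 j)).
  exact: measurable_rV_coord.
by apply/funext => x; rewrite /= /rV_coord mxE.
Qed.

End rV_cons.

(* Lebesgue measure on R^n, by recursion on n: point mass on R^0, and image of
   (Lebesgue on R) x (Lebesgue on R^n) under the identification of R x R^n
   with R^(n+1). *)
Section lebesgue_rV_step.
Context {R : realType} (n : nat).
Variable m : {sigma_finite_measure set 'rV[R]_n -> \bar R}.

Definition lebesgue_rV_step (A : set 'rV[R]_n.+1) : \bar R :=
  pushforward (lebesgue_measure \x m)%E (@rV_cons R n) A.

Let lebesgue_rV_step0 : lebesgue_rV_step set0 = 0%E.
Proof. by rewrite /lebesgue_rV_step /pushforward preimage_set0 measure0. Qed.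

Let lebesgue_rV_step_ge0 A : (0 <= lebesgue_rV_step A)%E.
Proof. exact: (measure_ge0 (lebesgue_measure \x m)%E). Qed.

Let lebesgue_rV_step_sigma_additive : semi_sigma_additive lebesgue_rV_step.
Proof.
move=> F mF tF mUF; rewrite /lebesgue_rV_step /pushforward preimage_bigcup.
apply: measure_semi_sigma_additive.
- by move=> i; rewrite -[X in measurable X]setTI; exact: measurable_rV_cons.
- apply/trivIsetP => /= i j _ _ ij; rewrite -preimage_setI.
  by move/trivIsetP : tF => /(_ _ _ _ _ ij) ->//; rewrite preimage_set0.
- rewrite -preimage_bigcup -[X in measurable X]setTI.
  exact: measurable_rV_cons.
Qed.

HB.instance Definition _ := isMeasure.Build _ _ _ lebesgue_rV_step
  lebesgue_rV_step0 lebesgue_rV_step_ge0 lebesgue_rV_step_sigma_additive.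

Let lebesgue_rV_step_sigma_finite : sigma_finite setT lebesgue_rV_step.
Proof.
have /sigma_finiteP[F [TF ndF Foo]] := sigma_finiteT (@lebesgue_measure R).
have /sigma_finiteP[G [TG ndG Goo]] := sigma_finiteT m.
exists (fun k => @rV_uncons R n @^-1` (F k `*` G k)).
  apply/esym/seteqP; split => // x _.
  have [i _ Fi] : (\bigcup_k F k) (rV_uncons x).1 by rewrite -TF.
  have [j _ Gj] : (\bigcup_k G k) (rV_uncons x).2 by rewrite -TG.
  exists (maxn i j) => //; split.
    by move: Fi; exact/subsetPset/ndF/leq_maxl.
  by move: Gj; exact/subsetPset/ndG/leq_maxr.
move=> k; have [mF Fk] := Foo k; have [mG Gk] := Goo k; split.
  rewrite -[X in measurable X]setTI; apply: measurable_rV_uncons => //.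
  exact: measurableX.
rewrite /lebesgue_rV_step /pushforward -comp_preimage.
rewrite (_ : _ \o _ = id); last by apply/funext; exact: rV_consK.
by rewrite preimage_id product_measure1E// lte_mul_pinfty// ge0_fin_numE.
Qed.

HB.instance Definition _ := Measure_isSigmaFinite.Build _ _ _ lebesgue_rV_step
  lebesgue_rV_step_sigma_finite.

End lebesgue_rV_step.

Fixpoint lebesgue_rV (R : realType) (n : nat) :
    {sigma_finite_measure set 'rV[R]_n -> \bar R} :=
  match n with
  | 0 => \d_(0 : 'rV[R]_0)
  | n.+1 => lebesgue_rV_step (lebesgue_rV R n)
  end.

Lemma lebesgue_rV_box (R : realType) n (A : 'I_n -> set R) :
  (forall i, measurable (A i)) ->
  lebesgue_rV R n [set x | forall i, A i (x ord0 i)] =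
  (\prod_(i < n) lebesgue_measure (A i))%E.
Proof.
elim: n A => [|n IH] A mA.
  by rewrite big_ord0 /= diracE mem_set// => -[].
pose B : set 'rV[R]_n := [set y | forall j, A (lift ord0 j) (y ord0 j)].
have consB : @rV_cons R n @^-1` [set x | forall i, A i (x ord0 i)] =
    A ord0 `*` B.
  apply/seteqP; split => -[a y] /=.
    move=> h; split; first by have := h ord0; rewrite mxE unlift_none.
    by move=> j; have := h (lift ord0 j); rewrite mxE liftK.
  by move=> [Aa Ay] i; rewrite mxE; case: unliftP => [j ->|->].
have mB : measurable B.
  rewrite (_ : B = \bigcap_(j in [set: 'I_n])
      (rV_coord j @^-1` A (lift ord0 j))); last first.
    by apply/seteqP; split => [y h j _|y h j]; exact: h.
  apply: fin_bigcap_measurable => //.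
  move=> j _; rewrite -[X in measurable X]setTI.
  by apply: (measurable_rV_coord j) => //; exact: mA.
rewrite big_ord_recl -IH//= /lebesgue_rV_step /pushforward consB.
by apply: product_measure1E => //; exact: mA.
Qed.

Section function_spaces.
Context {R : realType}.

(* For finite-dimensional V; differentiability together with continuity of the
   directional derivatives is the usual C^1. *)
Definition C1 (V : normedModType R) (g : V -> R) : Prop :=
  (forall x, differentiable g x) /\ (forall v, continuous (fun x => 'D_v g x)).

Definition C1c (V : normedModType R) (g : V -> R) : Prop :=
  C1 g /\ compact (closure [set x | g x != 0]).

Context {d : nat}.
Local Notation mu := (lebesgue_rV R d).

Definition divergence (Phi : 'I_d -> 'rV[R]_d -> R) (x : 'rV[R]_d) : R :=
  \sum_(k < d) 'D_(delta_mx ord0 k) (Phi k) x.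

(* The pointwise bound on the test fields is for the Euclidean norm. *)
Definition total_variation_rV (u : 'rV[R]_d -> R) : \bar R :=
  ereal_sup [set (\int[mu]_x (u x * divergence Phi x))%:E | Phi in
    [set Phi : 'I_d -> 'rV[R]_d -> R |
      (forall k, C1c (Phi k)) /\ (forall x, \sum_(k < d) Phi k x ^+ 2 <= 1)]].

Definition BV_rV (u : 'rV[R]_d -> R) : Prop :=
  u \in Lfun mu 1%E /\ (total_variation_rV u < +oo)%E.

Definition Linfty_norm (u : 'rV[R]_d -> R) : R :=
  fine ('N[mu]_+oo[EFin \o u])%E.

Definition LinftyL1_norm (T : R) (g : R -> 'rV[R]_d -> R) : \bar R :=
  ereal_sup [set ('N[mu]_1[EFin \o g t])%E | t in `[0, T]%classic].

Definition l1_norm (q : nat) (v : 'I_q -> R) : R := \sum_(i < q) `|v i|.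

(* A function of C_c^1([0,+oo[ x R^d) is the restriction of a function psi of
   C_c^1(R x R^d). The integrability conditions say that the two Lebesgue
   integrals of the weak formulation make sense. *)
Definition weak_solution (phi : 'I_d -> R -> R) (u0 : 'rV[R]_d -> R)
    (u : R -> 'rV[R]_d -> R) : Prop :=
  forall psi : R * 'rV[R]_d -> R, C1c psi ->
  let F := fun (t : R) (x : 'rV[R]_d) =>
    u t x * 'D_(1, 0) psi (t, x)
    + \sum_(k < d) phi k (u t x) * 'D_(0, delta_mx ord0 k) psi (t, x) in
  [/\ (lebesgue_measure \x mu)%E.-integrable
        (`[0, +oo[%classic `*` setT) (fun p => (F p.1 p.2)%:E),
      mu.-integrable setT (fun x => (u0 x * psi (0, x))%:E) &
      \int[lebesgue_measure]_(t in `[0, +oo[%classic) (\int[mu]_x F t x)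
        + \int[mu]_x (u0 x * psi (0, x)) = 0].

End function_spaces.

(* The populations are indexed from 0: the index 1 is [ord0], and, for l : 'I_W
   standing for l.+1 in {1, ..., W}, [even_idx l] and [odd_idx l] are the
   indices written 2l and 2l+1. *)
Section indices.
Context {W : nat}.

Definition even_idx (l : 'I_W) : 'I_W.*2.+1 := inord l.*2.+1.

Definition odd_idx (l : 'I_W) : 'I_W.*2.+1 := inord l.*2.+2.

(* Exchanges [even_idx l] and [odd_idx l], and fixes [ord0]. *)
Definition opp_idx (i : 'I_W.*2.+1) : 'I_W.*2.+1 :=
  if i == ord0 then ord0 else if odd i then inord i.+1 else inord i.-1.

Lemma opp_even_idx l : opp_idx (even_idx l) = odd_idx l.
Proof.
have lt2 : (l.*2.+2 < W.*2.+1)%N by rewrite ltnS -doubleS leq_double.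
have E : even_idx l = l.*2.+1 :> nat by rewrite inordK// ltnW.
rewrite /opp_idx -val_eqE /= E /= odd_double /=.
by apply/val_inj; rewrite /= !inordK.
Qed.

Lemma opp_odd_idx l : opp_idx (odd_idx l) = even_idx l.
Proof.
have lt2 : (l.*2.+2 < W.*2.+1)%N by rewrite ltnS -doubleS leq_double.
have E : odd_idx l = l.*2.+2 :> nat by rewrite inordK.
by rewrite /opp_idx -val_eqE /= E /= odd_double.
Qed.

End indices.

Section scheme.
Context {R : realType} {d W : nat}.
Local Notation q := (W.*2.+1).
Local Notation mu := (lebesgue_rV R d).

Definition equilibrium (L : 'I_q -> R) (N : 'I_q -> 'I_d -> R)
    (phi : 'I_d -> R -> R) (u : R) (i : 'I_q) : R :=
  L i * u + \sum_(k < d) N i k * phi k u.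

Definition compact_box (feq : R -> 'I_q -> R) (uinf : R) : set ('I_q -> R) :=
  [set f | forall i, feq (- uinf) i <= f i <= feq uinf i].

Definition relaxation (ws wa : R) (feq : R -> 'I_q -> R) (f : 'I_q -> R)
    (i : 'I_q) : R :=
  let u := \sum_(m < q) f m in
  if i == ord0 then (1 - ws) * f i + ws * feq u i
  else (1 - 2^-1 * (ws + wa)) * f i + 2^-1 * (ws + wa) * feq u i
       - 2^-1 * (ws - wa) * (f (opp_idx i) - feq u (opp_idx i)).

Definition cell (dx : R) (j : 'rV[int]_d) : set 'rV[R]_d :=
  [set x | forall k, ((j ord0 k)%:~R - 2^-1) * dx < x ord0 k
                     < ((j ord0 k)%:~R + 2^-1) * dx].

Definition cell_average (dx : R) (u0 : 'rV[R]_d -> R) (j : 'rV[int]_d) : R :=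
  (fine (mu (cell dx j)))^-1 * \int[mu]_(x in cell dx j) u0 x.

(* [e i] is the integer vector c_i / lambda. *)
Fixpoint populations (ws wa : R) (feq : R -> 'I_q -> R)
    (e : 'I_q -> 'rV[int]_d) (u0 : 'rV[R]_d -> R) (dx : R)
    (n : nat) (j : 'rV[int]_d) (i : 'I_q) : R :=
  match n with
  | 0 => feq (cell_average dx u0 j) i
  | n'.+1 =>
      relaxation ws wa feq (populations ws wa feq e u0 dx n' (j - e i)) i
  end.

Definition time_index (dt t : R) : nat := Num.truncn (t / dt).

(* The index of the half-open cell containing x; the half-open cells extend the
   open ones to all of R^d, which only matters on a null set. *)
Definition cell_index (dx : R) (x : 'rV[R]_d) : 'rV[int]_d :=
  \row_k Num.floor (x ord0 k / dx + 2^-1).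

Lemma time_indexE (dt t : R) (n : nat) : 0 < dt ->
  n%:R * dt <= t < n.+1%:R * dt -> time_index dt t = n.
Proof.
move=> dt0 /andP[nt tn]; apply/truncn_def.
by rewrite ler_pdivlMr// nt ltr_pdivrMr.
Qed.

Lemma cell_indexE (dx : R) (j : 'rV[int]_d) x : 0 < dx ->
  cell dx j x -> cell_index dx x = j.
Proof.
move=> dx0 xj; apply/rowP => k; rewrite mxE; apply: floor_def.
have /andP[jx xj'] := xj k.
rewrite -lerBlDr ler_pdivlMr// ltW//= -ltrBrDr intrD ltr_pdivrMr//.
apply: lt_le_trans xj' _; rewrite ler_pM2r// -addrA lerD2l.
by rewrite [leRHS](_ : _ = 2^-1)// {1}(splitr 1) !div1r addrK.
Qed.

Definition f_Delta (lam ws wa : R) (feq : R -> 'I_q -> R)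
    (e : 'I_q -> 'rV[int]_d) (u0 : 'rV[R]_d -> R) (dx t : R) (x : 'rV[R]_d) :
    'I_q -> R :=
  populations ws wa feq e u0 dx (time_index (dx / lam) t) (cell_index dx x).

Definition u_Delta (lam ws wa : R) (feq : R -> 'I_q -> R)
    (e : 'I_q -> 'rV[int]_d) (u0 : 'rV[R]_d -> R) (dx t : R) (x : 'rV[R]_d) :
    R :=
  \sum_(i < q) f_Delta lam ws wa feq e u0 dx t x i.

End scheme.

(* Main.v *)
(* The relaxation operator is conservative and, under the stated conditions on the relaxation
   parameters, monotone on the box K; by Crandall and Tartar it is therefore an l^1 contraction,
   and the lattice scheme is stable under perturbation of the data and under translation.
   Approximating the datum in L^1 by a compactly supported Lipschitz function, the translates in
   space and time of the numerical solution are controlled uniformly in the space-step, and its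
   support stays bounded. Solutions are then close to step functions on a fixed coarse grid with
   quantized values, so that finitely many colours suffice to classify them up to any precision;
   the pigeonhole principle and a diagonal argument give a subsequence which is Cauchy in L^1,
   uniformly for t in bounded intervals, with geometric rate. One relaxation step moves the
   solution by a quantity which tends to 0, so the limit is fixed by the relaxation operator and
   hence is an equilibrium. Finally, summation by parts of the conserved sum against a test
   function psi yields difference quotients of psi in the directions (1, c_i), and at equilibrium
   the zeroth and first moments of the f_i^eq are u and phi_k(u), which gives the weak form. *)

Require Import Defs.
From HB Require Import structures.
From mathcomp Require Import all_boot all_order all_algebra.
From mathcomp Require Import all_classical all_reals all_analysis.
From mathcomp Require Import ring lra zify.
From mathcomp Require Import measurable_realfun ess_sup_inf.
Import Order.TTheory GRing.Theory Num.Theory.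
Import numFieldNormedType.Exports.
Set Implicit Arguments.
Unset Strict Implicit.
Unset Printing Implicit Defensive.
Local Open Scope classical_set_scope.
Local Open Scope ring_scope.

(** * The relaxation operator *)

(** The three entries of the minimum in the condition on the parameters are what monotonicity of a
    paired component asks with respect to the population itself, to any population outside the pair,
    and to the opposite one. Only increments are compared, so a Lipschitz constant of the flux
    combination replaces its derivative.

    The uniform estimates are proved for equilibrium data sampled from a Lipschitz function:
    translation moduli and the displacement in one step are then O(h) initially, and contraction
    carries both to all later times. The true datum is only within eps of such a sample, an error
    that contraction keeps constant; hence eps is fixed first and the space-step afterwards.

    Solutions for different space-steps live on different lattices, which is why they are compared
    through a fixed coarse grid. Time regularity reduces [0, T] to finitely many times, and this
    makes the extraction uniform in t.

    Relaxation precedes transport, so the discrete weak form pairs the difference quotients with the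
    relaxed state and not with the state itself. The estimate of the relaxation defect therefore
    serves twice: for the equilibrium of the limit and for the weak form. *)

Section populations_algebra.
Context {R : realType} {d W : nat}.
Local Notation q := (W.*2.+1).

Lemma even_idxE (l : 'I_W) : even_idx l = l.*2.+1 :> nat.
Proof. by rewrite inordK// ltnS ltn_double. Qed.

Lemma odd_idxE (l : 'I_W) : odd_idx l = l.*2.+2 :> nat.
Proof. by rewrite inordK// ltnS -doubleS leq_double. Qed.

Variant idx_spec : 'I_q -> Type :=
  | IdxZero : idx_spec ord0
  | IdxEven l : idx_spec (even_idx l)
  | IdxOdd l : idx_spec (odd_idx l).

Lemma idxP (i : 'I_q) : idx_spec i.
Proof.
have [i0|i0] := posnP i.
  by rewrite (_ : i = ord0); [constructor|exact/val_inj].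
have lW : (i.-1./2 < W)%N.
  by rewrite ltn_half_double; case: (i : nat) i0 (ltn_ord i).
have := odd_double_half i.-1; case: (odd i.-1) => /= E.
- rewrite (_ : i = odd_idx (Ordinal lW)); first by constructor.
  apply/val_inj => /=; rewrite odd_idxE /=; move: E; rewrite add1n => ->.
  by rewrite prednK.
- rewrite (_ : i = even_idx (Ordinal lW)); first by constructor.
  apply/val_inj => /=; rewrite even_idxE /=; move: E; rewrite add0n => ->.
  by rewrite prednK.
Qed.

Lemma sum_idx (V : zmodType) (F : 'I_q -> V) :
  \sum_(i < q) F i =
  F ord0 + \sum_(l < W) (F (even_idx l) + F (odd_idx l)).
Proof.
rewrite big_ord_recl; congr (_ + _).
transitivity (\sum_(i < W.*2) F (inord i.+1)).
  apply: eq_bigr => i _; congr F; apply/val_inj.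
  by rewrite /= inordK// ltnS.
(* Functions on [nat] let the induction on the number of pairs run without changing an ordinal
   type. *)
suff H n (G : nat -> V) : \sum_(i < n.*2) G i = \sum_(l < n) (G l.*2 + G l.*2.+1).
  by rewrite (H W (fun n => F (inord n.+1))).
elim: n => [|n IH]; first by rewrite double0 !big_ord0.
by rewrite doubleS !big_ord_recr /= IH addrA.
Qed.

Lemma even_idx_neq0 (l : 'I_W) : (even_idx l == ord0) = false.
Proof. by apply/negP => /eqP/(congr1 val) /=; rewrite even_idxE. Qed.

Lemma odd_idx_neq0 (l : 'I_W) : (odd_idx l == ord0) = false.
Proof. by apply/negP => /eqP/(congr1 val) /=; rewrite odd_idxE. Qed.

End populations_algebra.

Section relaxation_operator.
Context {R : realType} {d W : nat}.
Local Notation q := (W.*2.+1).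
Variables (L : 'I_q -> R) (N : 'I_q -> 'I_d -> R) (phi : 'I_d -> R -> R).
Hypothesis L_sym : forall l : 'I_W, L (even_idx l) = L (odd_idx l).
Hypothesis N_antisym : forall (l : 'I_W) k, N (even_idx l) k = - N (odd_idx l) k.
Hypothesis L_sum : L ord0 + 2 * \sum_(l < W) L (even_idx l) = 1.
Hypothesis N1 : forall k, N ord0 k = 0.
Hypothesis phi0 : forall k, phi k 0 = 0.
Variables (ws wa U : R) (M : 'I_W -> R).
Hypothesis ws_bounds : 0 < ws <= 2.
Hypothesis wa_bounds : 0 < wa <= 2.
Hypothesis ws_L1 : Num.max 0 (ws - 1) <= ws * L ord0.
Hypothesis U0 : 0 <= U.

Local Notation feq := (equilibrium L N phi).
Let G (l : 'I_W) (u : R) := \sum_(k < d) N (even_idx l) k * phi k u.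

(** The flux combination enters only through a Lipschitz constant [M l] on [-U, U]; [flux_lipschitz]
    shows that the supremum in the theorem is one. *)
Hypothesis M0 : forall l, 0 <= M l.
Hypothesis G_lip : forall l (u v : R), - U <= u <= U -> - U <= v <= U ->
  `|G l u - G l v| <= M l * `|u - v|.
Hypothesis M_bound : forall l,
  wa * M l <= ws * L (even_idx l)
       + 2^-1 * Num.min (Num.min (2 - ws - wa) 0) (wa - ws).

Local Notation K := (compact_box feq U).
Local Notation Rlx := (relaxation ws wa feq).

Lemma feq_ord0 u : feq u ord0 = L ord0 * u.
Proof. by rewrite /equilibrium big1 ?addr0// => k _; rewrite N1 mul0r. Qed.

Lemma feq_even l u : feq u (even_idx l) = L (even_idx l) * u + G l u.
Proof. by []. Qed.

Lemma feq_odd l u : feq u (odd_idx l) = L (even_idx l) * u - G l u.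
Proof.
rewrite /equilibrium L_sym; congr (_ + _).
by rewrite -sumrN; apply: eq_bigr => k _; rewrite N_antisym mulNr opprK.
Qed.

Lemma sum_feq u : \sum_(i < q) feq u i = u.
Proof.
rewrite sum_idx feq_ord0.
under eq_bigr => l _ do rewrite feq_even feq_odd addrACA subrr addr0.
rewrite big_split /= -!mulr_suml -!mulrDl.
by rewrite -[X in (_ + X) * u](_ : 2 * \sum_(l < W) L (even_idx l) = _) ?L_sum ?mul1r// mulr_natl mulr2n.
Qed.

Lemma feq0 i : feq 0 i = 0.
Proof.
by rewrite /equilibrium mulr0 big1 ?addr0// => k _; rewrite phi0 mulr0.
Qed.

(** Within a pair the terms in wa cancel, and the sum relaxes with the single rate ws, as does the
    rest population. The total thus moves by ws times the difference between the sum of the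
    equilibria and u, which is zero. *)
Lemma sum_relaxation f : \sum_(i < q) Rlx f i = \sum_(i < q) f i.
Proof.
set u := \sum_(i < q) f i.
suff -> : \sum_(i < q) Rlx f i =
    \sum_(i < q) f i + ws * (\sum_(i < q) feq u i - \sum_(i < q) f i).
  by rewrite sum_feq subrr mulr0 addr0.
rewrite !sum_idx {1}/relaxation eqxx -/u.
rewrite [X in _ = _ + _ * (X - _)]addrC.
set A := \sum_(l < W) (f _ + _); set B := \sum_(l < W) (feq _ _ + _).
suff -> : \sum_(l < W) (Rlx f (even_idx l) + Rlx f (odd_idx l)) = A + ws * (B - A).
  by ring.
rewrite mulrBr !mulr_sumr -sumrB -big_split /=; apply: eq_bigr => l _.
rewrite /relaxation even_idx_neq0 odd_idx_neq0 opp_even_idx opp_odd_idx -/u.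
set X := feq u (even_idx l); set Y := feq u (odd_idx l).
set x := f _; set y := f _.
have [h hE] : exists h : R, 2^-1 = h by exists 2^-1.
have h2 : 2 * h = 1 by rewrite -hE mulfV.
rewrite hE.
transitivity (x + y + (2 * h) * ws * ((X + Y) - (x + y))); first by ring.
by rewrite h2; ring.
Qed.

Lemma relaxation_feq a i : Rlx (feq a) i = feq a i.
Proof.
rewrite /relaxation sum_feq; case: ifP => _; last by ring.
by ring.
Qed.

(** In a pair, the sum and the difference of the two deviations from equilibrium decouple, with the
    nonzero factors ws and wa; so both deviations vanish. *)
Lemma relaxation_fixpoint f : (forall i, Rlx f i = f i) ->
  forall i, f i = feq (\sum_(i < q) f i) i.
Proof.
move=> Rf; set u := \sum_(i < q) f i.
have ws0 : ws != 0 by move: ws_bounds => /andP[/gt_eqF ->].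
have wa0 : wa != 0 by move: wa_bounds => /andP[/gt_eqF ->].
have pair l : f (even_idx l) = feq u (even_idx l) /\ f (odd_idx l) = feq u (odd_idx l).
  move: (Rf (even_idx l)) (Rf (odd_idx l)).
  rewrite /relaxation even_idx_neq0 odd_idx_neq0 opp_even_idx opp_odd_idx -/u.
  set X := feq u (even_idx l); set Y := feq u (odd_idx l).
  set x := f _; set y := f _ => H1 H2.
  have S : ws * ((X - x) + (Y - y)) = 0 by lra.
  have D : wa * ((X - x) - (Y - y)) = 0 by lra.
  move/eqP : S; rewrite mulf_eq0 (negbTE ws0) /= => /eqP S.
  move/eqP : D; rewrite mulf_eq0 (negbTE wa0) /= => /eqP D.
  by split; lra.
move=> i; case/idxP: i => [|l|l].
- have := Rf ord0; rewrite /relaxation eqxx -/u => H.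
  have : ws * (feq u ord0 - f ord0) = 0 by lra.
  by move/eqP; rewrite mulf_eq0 (negbTE ws0) /= subr_eq0 => /eqP.
- by case: (pair l).
- by case: (pair l).
Qed.

Let L_ge0 l : 0 <= L (even_idx l).
Proof.
have /andP[w0 _] := ws_bounds; have /andP[a0 _] := wa_bounds.
rewrite -(pmulr_rge0 _ w0).
have := M_bound l; have : 0 <= wa * M l by rewrite mulr_ge0// ltW.
have : Num.min (Num.min (2 - ws - wa) 0) (wa - ws) <= 0.
  by rewrite ge_min ge_min lexx !orbT.
by lra.
Qed.

Let L_le_half l : 2 * L (even_idx l) <= 1.
Proof.
have /andP[w0 _] := ws_bounds.
have L0 : 0 <= L ord0.
  by rewrite -(pmulr_rge0 _ w0); apply: le_trans ws_L1; rewrite le_max lexx.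
have : L (even_idx l) <= \sum_(l < W) L (even_idx l).
  by rewrite (bigD1 l)//= lerDl sumr_ge0.
by move: L_sum; lra.
Qed.

(** This makes every paired equilibrium nondecreasing. The bound on wa M is at most wa L in both
    cases: if ws <= wa because the minimum is at most 0, otherwise because it is at most wa - ws and
    L <= 1/2. *)
Let U_sub l (u v : R) : - U <= u <= U -> - U <= v <= U -> u <= v ->
  `|G l v - G l u| <= L (even_idx l) * (v - u).
Proof.
move=> Hu Hv uv.
have /andP[w0 _] := ws_bounds; have /andP[a0 _] := wa_bounds.
rewrite -(ler_pM2l a0).
have s0 : 0 <= v - u by rewrite subr_ge0.
have := G_lip l Hv Hu; rewrite (ger0_norm s0) => /(ler_wpM2l (ltW a0)) H.
apply: (le_trans H).
rewrite !mulrA ler_wpM2r//; apply: (le_trans (M_bound l)).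
have m0 : Num.min (Num.min (2 - ws - wa) 0) (wa - ws) <= 0.
  by rewrite ge_min ge_min lexx !orbT.
have m1 : Num.min (Num.min (2 - ws - wa) 0) (wa - ws) <= wa - ws.
  by rewrite ge_min lexx !orbT.
have := L_ge0 l; have := L_le_half l; move: m0 m1; set m := Num.min _ _.
by case: (leP ws wa) => ?; nra.
Qed.

Lemma feq_homo (u v : R) i : - U <= u <= U -> - U <= v <= U -> u <= v ->
  feq u i <= feq v i.
Proof.
move=> Hu Hv uv; case/idxP: i => [|l|l].
- rewrite !feq_ord0 ler_wpM2l//.
  have /andP[w0 _] := ws_bounds.
  by rewrite -(pmulr_rge0 _ w0); apply: le_trans ws_L1; rewrite le_max lexx.
- by rewrite !feq_even; have := U_sub l Hu Hv uv; rewrite ler_norml; lra.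
- by rewrite !feq_odd; have := U_sub l Hu Hv uv; rewrite ler_norml; lra.
Qed.

Lemma feq_box (u : R) : - U <= u <= U -> K (feq u).
Proof.
move=> Hu i; have /andP[u1 u2] := Hu.
have NU : - U <= U by rewrite (le_trans u1).
by rewrite !feq_homo// ?lexx ?NU.
Qed.

Lemma box_sum f : K f -> - U <= \sum_(i < q) f i <= U.
Proof.
move=> Kf; rewrite -[leLHS](sum_feq (- U)) -[Y in _ && (_ <= Y)](sum_feq U).
by apply/andP; split; apply: ler_sum => i _; case/andP: (Kf i).
Qed.

(** All components move in the same direction and add up to the identity, so the equilibrium map is
    an isometry into l^1, and distances between equilibrium data are scalar distances. *)
Lemma sum_dist_feq (u v : R) : - U <= u <= U -> - U <= v <= U ->
  \sum_(i < q) `|feq u i - feq v i| = `|u - v|.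
Proof.
wlog uv : u v / u <= v => [H|] Hu Hv.
  have [uv|/ltW vu] := leP u v; first exact: H.
  rewrite distrC -(H v u)//; apply: eq_bigr => i _; exact: distrC.
rewrite distrC ger0_norm ?subr_ge0// -[in RHS](sum_feq u) -[in RHS](sum_feq v).
rewrite -sumrB; apply: eq_bigr => i _.
by rewrite distrC ger0_norm// subr_ge0 feq_homo.
Qed.

Lemma relaxation_homo f g : K f -> K g -> (forall i, f i <= g i) ->
  forall i, Rlx f i <= Rlx g i.
Proof.
move=> Kf Kg fg.
have Hu := box_sum Kf; have Hv := box_sum Kg.
have a0 i : 0 <= g i - f i by rewrite subr_ge0.
have s_sum : \sum_i g i - \sum_i f i = \sum_i (g i - f i) by rewrite sumrB.
have pair l : (g (even_idx l) - f (even_idx l)) + (g (odd_idx l) - f (odd_idx l))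
    <= \sum_i g i - \sum_i f i.
  rewrite s_sum sum_idx (bigD1 l)//=.
  have := a0 ord0.
  have : 0 <= \sum_(i < W | i != l)
     (g (even_idx i) - f (even_idx i) + (g (odd_idx i) - f (odd_idx i))).
    by apply: sumr_ge0 => i _; rewrite addr_ge0.
  by lra.
have zero : g ord0 - f ord0 <= \sum_i g i - \sum_i f i.
  rewrite s_sum (bigD1 ord0)//= lerDl sumr_ge0//.
set u := \sum_i f i in Hu *; set v := \sum_i g i in Hv *.
have uv : u <= v by apply: ler_sum.
have s0 : 0 <= v - u by rewrite subr_ge0.
have /andP[w0 _] := ws_bounds; have /andP[wa0 _] := wa_bounds.
have flux l : wa * `|G l v - G l u| <= (ws * L (even_idx l)
       + 2^-1 * Num.min (Num.min (2 - ws - wa) 0) (wa - ws)) * (v - u).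
  have := G_lip l Hv Hu; rewrite (ger0_norm s0) => /(ler_wpM2l (ltW wa0)) H.
  apply: (le_trans H); by rewrite mulrA ler_wpM2r.
have m0 : Num.min (Num.min (2 - ws - wa) 0) (wa - ws) <= 0.
  by rewrite ge_min ge_min lexx !orbT.
have m1 : Num.min (Num.min (2 - ws - wa) 0) (wa - ws) <= wa - ws.
  by rewrite ge_min lexx !orbT.
have m2 : Num.min (Num.min (2 - ws - wa) 0) (wa - ws) <= 2 - ws - wa.
  by rewrite ge_min ge_min lexx.
(* Here a and b are the increments of a population and of its opposite, and e is the sign of its
   flux part. With m the minimum, the flux costs at most (ws L + m/2)(v - u), which leaves half of
   (2 - ws - wa - m) a + (wa - ws - m) b - m (v - u - a - b), a sum of nonnegative terms. *)
have key l (a b e : R) : 0 <= a -> 0 <= b -> a + b <= v - u ->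
    e = 1 \/ e = - 1 ->
    0 <= (1 - 2^-1 * (ws + wa)) * a - 2^-1 * (ws - wa) * b
         + ws * (L (even_idx l) * (v - u)) + wa * (e * (G l v - G l u)).
  move=> a0' b0 ab He.
  have : - (wa * `|G l v - G l u|) <= wa * (e * (G l v - G l u)).
    rewrite -mulrN ler_pM2l// lerNl.
    case: He => ->; rewrite ?mulN1r ?mul1r ?opprK; last exact: ler_norm.
    by rewrite -normrN; exact: ler_norm.
  have := flux l; move: m0 m1 m2; set m := Num.min _ _ => m0 m1 m2 F1 F2.
  have : 0 <= - (2^-1 * m) * (v - u - (a + b)).
    by apply: mulr_ge0; [lra|rewrite subr_ge0].
  have : 0 <= (2 - ws - wa - m) * a by apply: mulr_ge0 => //; lra.
  have : 0 <= (wa - ws - m) * b by apply: mulr_ge0 => //; lra.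
  by lra.
move=> i; rewrite -subr_ge0; case/idxP: i => [|l|l].
- rewrite /relaxation eqxx !feq_ord0 -/u -/v.
  have : 0 <= (1 - ws) * (g ord0 - f ord0) + (ws * L ord0) * (v - u); last by lra.
  have : Num.max 0 (ws - 1) * (v - u) <= (ws * L ord0) * (v - u) by rewrite ler_wpM2r.
  (* When ws > 1 the coefficient 1 - ws is negative; [ws_L1] compensates it, since the rest
     population moves by at most v - u. *)
  have [ws1|ws1] := leP (ws - 1) 0.
    rewrite mul0r => H; rewrite addr_ge0// mulr_ge0//; lra.
  have : 0 <= (ws - 1) * (v - u - (g ord0 - f ord0)).
    by apply: mulr_ge0; [exact: ltW|rewrite subr_ge0].
  by lra.
- rewrite /relaxation even_idx_neq0 opp_even_idx !feq_even !feq_odd -/u -/v.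
  by have := key l _ _ 1 (a0 (even_idx l)) (a0 (odd_idx l)) (pair l) (or_introl erefl); lra.
- rewrite /relaxation odd_idx_neq0 opp_odd_idx !feq_even !feq_odd -/u -/v.
  have := key l _ _ (-1) (a0 (odd_idx l)) (a0 (even_idx l)) _ (or_intror erefl).
  by rewrite addrC => /(_ (pair l)); lra.
Qed.

(** The extreme corners of K are the equilibria at -U and U, which relaxation fixes; monotonicity
    keeps everything between them. *)
Lemma relaxation_box f : K f -> K (Rlx f).
Proof.
move=> Kf i.
have NU : - U <= U by rewrite (le_trans _ U0)// oppr_le0.
have HU : - U <= U <= U by rewrite NU lexx.
have HN : - U <= - U <= U by rewrite NU lexx.
apply/andP; split.
  rewrite -[leLHS]relaxation_feq; apply: relaxation_homo => //; first exact: feq_box.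
  by move=> j; case/andP: (Kf j).
rewrite -[leRHS]relaxation_feq; apply: relaxation_homo => //; first exact: feq_box.
by move=> j; case/andP: (Kf j).
Qed.

(* Crandall--Tartar: a monotone conservative map is an l^1 contraction. *)
Lemma relaxation_contraction f g : K f -> K g ->
  \sum_(i < q) `|Rlx f i - Rlx g i| <= \sum_(i < q) `|f i - g i|.
Proof.
move=> Kf Kg.
pose hi i := Num.max (f i) (g i); pose lo i := Num.min (f i) (g i).
have Khi : K hi.
  move=> i; have /andP[f1 f2] := Kf i; have /andP[g1 g2] := Kg i.
  by rewrite /hi le_max f1 /= ge_max f2 g2.
have Klo : K lo.
  move=> i; have /andP[f1 f2] := Kf i; have /andP[g1 g2] := Kg i.
  by rewrite /lo le_min f1 g1 /= ge_min f2.
have le h h' : K h -> K h' -> (forall i, h i <= h' i) -> forall i, Rlx h i <= Rlx h' i.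
  exact: relaxation_homo.
have E i : `|f i - g i| = hi i - lo i.
  rewrite /hi /lo; have [fg|gf] := leP (f i) (g i).
    by rewrite distrC ger0_norm// subr_ge0.
  by rewrite ger0_norm// subr_ge0 ltW.
under [leRHS]eq_bigr do rewrite E.
rewrite sumrB -(sum_relaxation hi) -(sum_relaxation lo) -sumrB.
apply: ler_sum => i _.
have f_hi := le f hi Kf Khi; have g_hi := le g hi Kg Khi.
have lo_f := le lo f Klo Kf; have lo_g := le lo g Klo Kg.
have {}f_hi : Rlx f i <= Rlx hi i by apply: f_hi => j; rewrite le_max lexx.
have {}g_hi : Rlx g i <= Rlx hi i by apply: g_hi => j; rewrite le_max lexx orbT.
have {}lo_f : Rlx lo i <= Rlx f i by apply: lo_f => j; rewrite ge_min lexx.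
have {}lo_g : Rlx lo i <= Rlx g i by apply: lo_g => j; rewrite ge_min lexx orbT.
by rewrite ler_norml; lra.
Qed.

(** Opposite velocities cancel the symmetric part L u, so only the antisymmetric fluxes contribute
    to the first moment. *)
Lemma momentum_feq (c : 'I_q -> 'rV[R]_d) u :
  c ord0 = 0 -> (forall l : 'I_W, c (even_idx l) = - c (odd_idx l)) ->
  (forall k p : 'I_d,
    2 * \sum_(l < W) c (even_idx l) ord0 k * N (even_idx l) p = (k == p)%:R) ->
  forall k, \sum_(i < q) c i ord0 k * feq u i = phi k u.
Proof.
move=> c1 c_opp cN k; rewrite sum_idx c1 mxE mul0r add0r.
transitivity (\sum_(l < W) 2 * c (even_idx l) ord0 k * G l u).
  apply: eq_bigr => l _; rewrite feq_even feq_odd.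
  have -> : c (odd_idx l) = - c (even_idx l) by rewrite c_opp opprK.
  by rewrite mxE; ring.
under eq_bigr do rewrite mulr_sumr.
rewrite exchange_big /=.
rewrite -[RHS](_ : \sum_p (k == p)%:R * phi p u = _); last first.
  rewrite (bigD1 k)//= eqxx mul1r big1 ?addr0// => p pk.
  by rewrite eq_sym (negbTE pk) mul0r.
apply: eq_bigr => p _; rewrite -cN mulr_sumr mulr_suml; apply: eq_bigr => l _.
by rewrite !mulrA.
Qed.

End relaxation_operator.

(** * Cells and lattice sums *)

(** Grid functions factor through a countable index, so their measurability reduces to that of the
    fibres. *)
Lemma measurable_countable_comp d d' (T : measurableType d)
    (U : measurableType d') (C : countType) (i : T -> C) (g : C -> U) :
  (forall c, measurable (i @^-1` [set c])) -> measurable_fun setT (g \o i).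
Proof.
move=> mi _ Y mY; rewrite setTI.
rewrite (_ : _ @^-1` Y = \bigcup_(c : C)
    (if `[< Y (g c) >] then i @^-1` [set c] else set0)).
  apply: countable_bigcupT_measurable; first exact: countableP.
  by move=> c; case: ifPn.
apply/seteqP; split => [x Yx|x [c _]].
  by exists (i x) => //; rewrite asboolT.
by case: asboolP => // Yc; rewrite /= => ->.
Qed.

Section cells.
Context {R : realType} {d : nat}.
Local Notation mu := (lebesgue_rV R d).
Local Notation Zd := 'rV[int]_d.
Implicit Types (h : R) (j : Zd).

Lemma measurable_rV_box (A : 'I_d -> set R) : (forall i, measurable (A i)) ->
  measurable [set x : 'rV[R]_d | forall i, A i (x ord0 i)].
Proof.
move=> mA; rewrite (_ : [set _ | _] = \bigcap_(j in [set: 'I_d])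
    (rV_coord j @^-1` A j)); last first.
  by apply/seteqP; split => [y H j _|y H j]; exact: H.
apply: fin_bigcap_measurable => // j _.
by rewrite -[X in measurable X]setTI; apply: (measurable_rV_coord j) => //; exact: mA.
Qed.

(** The fibres of [cell_index]: half-open, hence an exact partition of the space, and equal to the
    open [cell] up to a null set. *)
Definition hcell h j : set 'rV[R]_d :=
  [set x | forall k, `[((j ord0 k)%:~R - 2^-1) * h,
                       ((j ord0 k)%:~R + 2^-1) * h[%classic (x ord0 k)].

Lemma cell_index_preimage h j : 0 < h ->
  cell_index h @^-1` [set j] = hcell h j.
Proof.
move=> h0; apply/seteqP; split => x /=.
  move=> <- k; rewrite /= in_itv /= !mxE.
  have /andP[H1 H2] := floor_itv (x ord0 k / h + 2^-1).
  rewrite -ler_pdivlMr// -ltr_pdivrMr// lerBlDr H1 /=.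
  by move: H2; rewrite intrD; lra.
move=> H; apply/rowP => k; rewrite mxE; apply: floor_def.
have := H k; rewrite /= in_itv /= => /andP[H1 H2].
rewrite -ler_pdivlMr// in H1; rewrite -ltr_pdivrMr// in H2.
by rewrite intrD; apply/andP; split; lra.
Qed.

Lemma measurable_hcell h j : measurable (hcell h j).
Proof. 
by apply: (measurable_rV_box (A := fun k => `[((j ord0 k)%:~R - 2^-1) * h,
  ((j ord0 k)%:~R + 2^-1) * h[%classic)) => i; exact: measurable_itv.
Qed.

Lemma mu_hcell h j : 0 < h -> mu (hcell h j) = (h ^+ d)%:E.
Proof.
move=> h0; 
rewrite /hcell (lebesgue_rV_box (A := fun k => `[((j ord0 k)%:~R - 2^-1) * h,
  ((j ord0 k)%:~R + 2^-1) * h[%classic)); last by move=> i; exact: measurable_itv.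
rewrite (eq_bigr (fun=> h%:E)).
  by rewrite (@prodEFin _ _ _ _ (fun=> h)) prodr_const card_ord.
move=> k _; rewrite lebesgue_measure_itv /= lte_fin ltr_pM2r// ltrD2l.
have -> : - 2^-1 < 2^-1 :> R by lra.
by rewrite -EFinB -mulrBl; congr (_%:E); rewrite addrAC opprB addrCA subrr addr0 -[RHS]mul1r; congr (_ * h); lra.
Qed.

Lemma mu_cell h j : 0 < h -> mu (cell h j) = (h ^+ d)%:E.
Proof.
move=> h0; rewrite (_ : cell h j = [set x | forall k, `](((j ord0 k)%:~R - 2^-1) * h)%R,
                       (((j ord0 k)%:~R + 2^-1) * h)%R[%classic (x ord0 k)]).
  rewrite (lebesgue_rV_box (A := fun k => `]((j ord0 k)%:~R - 2^-1) * h,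
  ((j ord0 k)%:~R + 2^-1) * h[%classic)); last by move=> i; exact: measurable_itv.
  rewrite (eq_bigr (fun=> h%:E)).
    by rewrite (@prodEFin _ _ _ _ (fun=> h)) prodr_const card_ord.
  move=> k _; rewrite lebesgue_measure_itv /= lte_fin ltr_pM2r// ltrD2l.
  have -> : - 2^-1 < 2^-1 :> R by lra.
  by rewrite -EFinB -mulrBl; congr (_%:E); rewrite addrAC opprB addrCA subrr addr0 -[RHS]mul1r; congr (_ * h); lra.
by apply/seteqP; split => x H k; have := H k; rewrite /= in_itv.
Qed.

Lemma measurable_cell h j : measurable (cell h j).
Proof.
rewrite (_ : cell h j = [set x | forall k, `](((j ord0 k)%:~R - 2^-1) * h)%R,
                       (((j ord0 k)%:~R + 2^-1) * h)%R[%classic (x ord0 k)]).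
  by apply: (measurable_rV_box (A := fun k => `]((j ord0 k)%:~R - 2^-1) * h,
    ((j ord0 k)%:~R + 2^-1) * h[%classic)) => i; exact: measurable_itv.
by apply/seteqP; split => x H k; have := H k; rewrite /= in_itv.
Qed.

Lemma measurable_cell_index d' (U : measurableType d') h (G : Zd -> U) :
  0 < h -> measurable_fun setT (G \o cell_index h).
Proof.
move=> h0; apply: measurable_countable_comp => j.
by rewrite cell_index_preimage//; exact: measurable_hcell.
Qed.

Lemma measurable_time_index (dt : R) (n : nat) :
  0 < dt -> measurable (time_index dt @^-1` [set n]).
Proof.
move=> dt0.
case: n => [|n].
  rewrite (_ : _ @^-1` _ = `]-oo, dt[%classic); first exact: measurable_itv.
  apply/seteqP; split => t /=; rewrite in_itv /= /time_index.
    by move=> /truncn0Pn; rewrite -ltNge ltr_pdivrMr// mul1r.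
  by move=> tdt; apply/truncn0Pn; rewrite -ltNge ltr_pdivrMr// mul1r.
rewrite (_ : _ @^-1` _ = `[n.+1%:R * dt, n.+2%:R * dt[%classic); first exact: measurable_itv.
apply/seteqP; split => t /=; rewrite in_itv /=.
  rewrite /time_index => E.
  have t0 : 0 <= t / dt.
    have : (0 < Num.truncn (t / dt))%N by rewrite E.
    by rewrite truncn_gt0; apply: le_trans.
  by have := truncn_itv t0; rewrite E ler_pdivlMr// ltr_pdivrMr.
exact: time_indexE.
Qed.

Lemma measurable_grid d' (U : measurableType d') (dt h : R) (G : nat -> Zd -> U) :
  0 < dt -> 0 < h ->
  measurable_fun setT (fun p : measurableTypeR R * 'rV[R]_d =>
    G (time_index dt p.1) (cell_index h p.2)).
Proof.
move=> dt0 h0.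
rewrite (_ : (fun p => _) = (fun c : nat * Zd => G c.1 c.2) \o
  (fun p : measurableTypeR R * 'rV[R]_d => (time_index dt p.1, cell_index h p.2)))//.
apply: measurable_countable_comp => -[n j].
rewrite (_ : _ @^-1` _ = (time_index dt @^-1` [set n]) `*` (cell_index h @^-1` [set j])).
  apply: measurableX; first exact: measurable_time_index.
  by rewrite cell_index_preimage//; exact: measurable_hcell.
by apply/seteqP; split => -[t x] /=; case => -> ->.
Qed.

Lemma integral_hcells h (F : 'rV[R]_d -> \bar R) : 0 < h ->
  measurable_fun setT F -> (forall x, 0 <= F x)%E ->
  (\int[mu]_x F x = \esum_(j in [set: Zd]) \int[mu]_(x in hcell h j) F x)%E.
Proof.
move=> h0 mF F0.
pose C k : set 'rV[R]_d := if @pickle_inv Zd k is Some j then hcell h j else set0.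
have UC : \bigcup_k C k = setT.
  apply/seteqP; split => // x _; exists (pickle (cell_index h x)) => //.
  by rewrite /C pickleK_inv -cell_index_preimage.
rewrite -UC ge0_integral_bigcup//; last 3 first.
- by move=> k; rewrite /C; case: pickle_inv => // j; exact: measurable_hcell.
- by rewrite UC.
- apply/trivIsetP => k k' _ _ kk'; rewrite /C.
  have K1 := @pickle_invK Zd k; have K2 := @pickle_invK Zd k'.
  move: K1 K2; case: pickle_inv => [j|]; case: pickle_inv => [j'|] /=;
    rewrite ?set0I ?setI0// => jk jk'.
  rewrite -!cell_index_preimage//; apply/seteqP; split => // x [/= E1 E2].
  by move: kk'; rewrite -jk -jk' -E1 -E2 eqxx.
pose P k := isSome (@pickle_inv Zd k).
pose e k := odflt 0 (@pickle_inv Zd k).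
have PT : e @` P = [set: Zd].
  apply/seteqP; split => // j _; exists (pickle j); rewrite /P /e ?pickleK_inv//.
rewrite -PT esum_pred_image; last 2 first.
- by move=> n _; exact: integral_ge0.
- move=> k k' /set_mem/= + /set_mem/=; rewrite /P /e.
  have K1 := @pickle_invK Zd k; have K2 := @pickle_invK Zd k'.
  move: K1 K2; case: pickle_inv => [j|]; case: pickle_inv => [j'|] //=.
  by move=> <- <- _ _ /= ->.
rewrite [RHS]eseries_mkcond; apply: eq_eseriesr => k _.
by rewrite /P /C /e; case: pickle_inv => [j|] //=; rewrite integral_set0.
Qed.

Lemma integral_cell h (G : Zd -> \bar R) : 0 < h -> (forall j, 0 <= G j)%E ->
  (\int[mu]_x G (cell_index h x) = \esum_(j in [set: Zd]) ((h ^+ d)%:E * G j))%E.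
Proof.
move=> h0 G0; rewrite (integral_hcells h0)//; last exact: (measurable_cell_index G h0).
apply: eq_esum => j _; rewrite (eq_integral (fun=> G j)).
  transitivity (G j * mu (hcell h j))%E.
    by apply: integral_cst; exact: measurable_hcell.
  by rewrite mu_hcell// muleC.
by move=> x; rewrite inE -cell_index_preimage// => /= ->.
Qed.

(** For nonnegative G this is h^d times its sum over Z^d; as an integral over R^d it can be compared
    with functions that live on other lattices or on the whole space. *)
Definition lsum h (G : Zd -> R) : \bar R := (\int[mu]_x (G (cell_index h x))%:E)%E.

Lemma measurable_lattice h (G : Zd -> R) : 0 < h ->
  measurable_fun [set: 'rV[R]_d] (fun x : 'rV[R]_d => (G (cell_index h x))%:E).
Proof.
by move=> h0; apply/measurable_EFinP; exact: (measurable_cell_index (U := measurableTypeR R) G h0).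
Qed.

Lemma lsum_le_integral h (G : Zd -> R) (F : 'rV[R]_d -> \bar R) : 0 < h ->
  (forall j, 0 <= G j) -> measurable_fun setT F -> (forall x, 0 <= F x)%E ->
  (forall j, (h ^+ d * G j)%:E <= \int[mu]_(x in hcell h j) F x)%E ->
  (lsum h G <= \int[mu]_x F x)%E.
Proof.
move=> h0 G0 mF F0 GF; rewrite /lsum (@integral_cell h (EFin \o G))//.
rewrite (integral_hcells h0 mF F0); apply: le_esum => j _.
by rewrite -EFinM.
Qed.

Lemma le_lsum h (G G' : Zd -> R) : 0 < h -> (forall j, 0 <= G j) -> (forall j, G j <= G' j) ->
  (lsum h G <= lsum h G')%E.
Proof.
move=> h0 G0 GG'; apply: ge0_le_integral => //.
- by move=> x _; rewrite lee_fin.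
- exact: measurable_lattice.
- exact: measurable_lattice.
- by move=> x _; rewrite lee_fin.
Qed.

Lemma lsumD h (G G' : Zd -> R) : 0 < h -> (forall j, 0 <= G j) -> (forall j, 0 <= G' j) ->
  lsum h (fun j => G j + G' j) = (lsum h G + lsum h G')%E.
Proof.
move=> h0 G0 G'0; rewrite /lsum; under eq_integral do rewrite EFinD.
by rewrite ge0_integralD// => [x _||x _|]; rewrite ?lee_fin//; exact: measurable_lattice.
Qed.

Lemma lsumZ h (c : R) (G : Zd -> R) : 0 < h -> 0 <= c -> (forall j, 0 <= G j) ->
  lsum h (fun j => c * G j) = (c%:E * lsum h G)%E.
Proof.
move=> h0 c0 G0; rewrite /lsum; under eq_integral do rewrite EFinM.
by rewrite ge0_integralZl// => [|x _]; rewrite ?lee_fin//; exact: measurable_lattice.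
Qed.

Lemma lsum_sum h (I : finType) (G : I -> Zd -> R) : 0 < h ->
  (forall i j, 0 <= G i j) ->
  lsum h (fun j => \sum_i G i j) = (\sum_i lsum h (G i))%E.
Proof.
move=> h0 G0; rewrite /lsum; under eq_integral do rewrite -sumEFin.
by rewrite ge0_integral_sum// => i; [exact: measurable_lattice|by move=> x _; rewrite lee_fin].
Qed.

Lemma esum_shift (G : Zd -> \bar R) (m : Zd) :
  (\esum_(j in [set: Zd]) G (j + m)%R = \esum_(j in [set: Zd]) G j)%E.
Proof.
rewrite [RHS](reindex_esum [set: Zd] _ (fun j => j + m))//; split => //.
- by move=> i j _ _ /addIr.
- by move=> j _; exists (j - m) => //; rewrite subrK.
Qed.

(** A lattice shift only reindexes the sum over the cells, which avoids a change of variables for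
    Lebesgue measure; a signed function is split into its positive and negative parts. *)
Lemma integral_shift h (G : Zd -> \bar R) (m : Zd) : 0 < h ->
  (\int[mu]_x G (cell_index h x + m)%R = \int[mu]_x G (cell_index h x))%E.
Proof.
move=> h0.
have ge0 (H : Zd -> \bar R) : (forall j, 0 <= H j)%E ->
    (\int[mu]_x H (cell_index h x + m)%R = \int[mu]_x H (cell_index h x))%E.
  move=> H0; rewrite (integral_cell h0 H0) -(esum_shift _ m).
  by rewrite (@integral_cell h (fun j => H (j + m)))//.
rewrite integralE [RHS]integralE; congr (_ - _)%E.
- rewrite funepos.unlock; have := ge0 (fun j => maxe (G j) 0)%E.
  by apply => j; rewrite le_max lexx orbT.
- rewrite funeneg.unlock; have := ge0 (fun j => maxe (- G j) 0)%E.
  by apply => j; rewrite le_max lexx orbT.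
Qed.

Lemma lsum_shift h (G : Zd -> R) (m : Zd) : 0 < h ->
  lsum h (fun j => G (j + m)) = lsum h G.
Proof. by move=> h0; exact: (@integral_shift h (EFin \o G)). Qed.

End cells.

(** * Stability of the lattice evolution *)

Section evolution.
Context {R : realType} {d q : nat}.
Local Notation Zd := 'rV[int]_d.
Variables (Rx : ('I_q -> R) -> 'I_q -> R) (e : 'I_q -> Zd).
Implicit Types (h : R) (g : Zd -> 'I_q -> R) (j m : Zd).

Definition step g : Zd -> 'I_q -> R := fun j i => Rx (g (j - e i)) i.

Definition evolve n g := iter n step g.

Definition translate m g : Zd -> 'I_q -> R := fun j => g (j + m).

Definition ldist h g g' : \bar R := lsum h (fun j => \sum_(i < q) `|g j i - g' j i|).

Lemma ldistC h g g' : ldist h g g' = ldist h g' g.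
Proof.
by congr lsum; apply/funext => j; apply: eq_bigr => i _; exact: distrC.
Qed.

Lemma ldistxx h g : ldist h g g = 0%E.
Proof.
rewrite /ldist (_ : (fun _ => _) = fun=> 0); last first.
  by apply/funext => j; rewrite big1// => i _; rewrite subrr normr0.
by rewrite /lsum integral0.
Qed.

Lemma ldist_triangle h g2 g1 g3 : 0 < h ->
  (ldist h g1 g3 <= ldist h g1 g2 + ldist h g2 g3)%E.
Proof.
move=> h0; rewrite -lsumD//; do ?by move=> j; apply: sumr_ge0.
apply: le_lsum => // j; first by apply: sumr_ge0.
by rewrite -big_split /=; apply: ler_sum => i _; exact: ler_distD.
Qed.

Lemma ldist_shift h m g g' : 0 < h -> ldist h (translate m g) (translate m g') = ldist h g g'.
Proof. by move=> h0; exact: (lsum_shift (fun j => \sum_(i < q) `|g j i - g' j i|)). Qed.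

Lemma evolve_shift n m g : evolve n (translate m g) = translate m (evolve n g).
Proof.
elim: n => //= n ->; apply/funext => j; apply/funext => i.
by rewrite /step /translate addrAC.
Qed.

Variable K : set ('I_q -> R).
Hypothesis K_step : forall g, (forall j, K (g j)) -> forall j, K (step g j).
Hypothesis Rx_contraction : forall f f', K f -> K f' ->
  \sum_(i < q) `|Rx f i - Rx f' i| <= \sum_(i < q) `|f i - f' i|.

Lemma evolve_box n g : (forall j, K (g j)) -> forall j, K (evolve n g j).
Proof. by move=> Kg; elim: n => //= n IH; exact: K_step. Qed.

(** Transport shifts component i by [e i], which leaves the lattice sum of that component unchanged;
    what remains is the pointwise contraction. *)
Lemma ldist_step h g g' : 0 < h -> (forall j, K (g j)) -> (forall j, K (g' j)) ->
  (ldist h (step g) (step g') <= ldist h g g')%E.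
Proof.
move=> h0 Kg Kg'.
rewrite /ldist lsum_sum//.
rewrite (eq_bigr (fun i => lsum h (fun j => `|Rx (g j) i - Rx (g' j) i|))).
  rewrite -lsum_sum//; apply: le_lsum => // j; first exact: sumr_ge0.
  exact: Rx_contraction.
move=> i _; exact: (lsum_shift (fun j => `|Rx (g j) i - Rx (g' j) i|) (- e i)).
Qed.

Lemma ldist_evolve h n g g' : 0 < h -> (forall j, K (g j)) -> (forall j, K (g' j)) ->
  (ldist h (evolve n g) (evolve n g') <= ldist h g g')%E.
Proof.
move=> h0 Kg Kg'; elim: n => //= n IH; apply: le_trans IH.
by apply: ldist_step => //; exact: evolve_box.
Qed.

(** The scheme commutes with lattice translations, so contraction applied to g and its translate
    propagates the initial modulus. *)
Lemma ldist_evolve_shift h n m g : 0 < h -> (forall j, K (g j)) ->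
  (ldist h (translate m (evolve n g)) (evolve n g) <= ldist h (translate m g) g)%E.
Proof.
move=> h0 Kg; rewrite -evolve_shift; apply: ldist_evolve => // j.
exact: Kg.
Qed.

(** Contraction between g and [step g]: no later step displaces the solution more than the first
    one. *)
Lemma ldist_evolveS h n g : 0 < h -> (forall j, K (g j)) ->
  (ldist h (evolve n.+1 g) (evolve n g) <= ldist h (step g) g)%E.
Proof.
move=> h0 Kg; rewrite /evolve iterSr; apply: ldist_evolve => //.
exact: K_step.
Qed.

Lemma ldist_evolve_time h n k g : 0 < h -> (forall j, K (g j)) ->
  (ldist h (evolve (n + k) g) (evolve n g) <= k%:R%:E * ldist h (step g) g)%E.
Proof.
move=> h0 Kg; elim: k => [|k IH]; first by rewrite addn0 ldistxx mul0e.
apply: (le_trans (ldist_triangle (evolve (n + k) g) _ _ h0)).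
rewrite -natr1 addrC EFinD ge0_muleDl// mul1e leeD//.
by rewrite addnS; exact: ldist_evolveS.
Qed.

(** For component i, [step] evaluates the relaxation at [j - e i] instead of [j]. Contraction bounds
    this discrepancy by a translation modulus, and the rest is one step in time; both go back to the
    initial data. *)
Lemma ldist_relaxed h n g : 0 < h -> (forall j, K (g j)) ->
  (ldist h (fun j => Rx (evolve n g j)) (evolve n g) <=
   \sum_(i < q) ldist h (translate (- e i) g) g + ldist h (step g) g)%E.
Proof.
move=> h0 Kg; set F := evolve n g.
have KF j : K (F j) by exact: evolve_box.
apply: (le_trans (ldist_triangle (step F) _ _ h0)).
apply: leeD; last exact: ldist_evolveS.
rewrite /ldist lsum_sum//; apply: lee_sum => i _.
apply: le_trans (ldist_evolve_shift n (- e i) h0 Kg); apply: le_lsum => // j.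
rewrite -/F distrC /translate; apply: le_trans (Rx_contraction (KF _) (KF _)).
by rewrite (bigD1 i)//= lerDl; apply: sumr_ge0.
Qed.

(** Relaxation preserves the zero state, and transport moves a population by at most E cells per
    step in each coordinate. *)
Lemma evolve_support (E : R) h X n g : 0 < h ->
  Rx (fun=> 0) = (fun=> 0) ->
  (forall i k, `|(e i ord0 k)%:~R| <= E) ->
  (forall j k, X < `|(j ord0 k)%:~R * h| -> g j = fun=> 0) ->
  forall j k, X + n%:R * E * h < `|(j ord0 k)%:~R * h| -> evolve n g j = fun=> 0.
Proof.
move=> h0 Rx0 eE g0; elim: n => [|n IH] j k.
  by rewrite mul0r mul0r addr0; exact: g0.
move=> jX; apply/funext => i /=; rewrite /step (IH (j - e i) k) ?Rx0//.
rewrite !mxE intrD mulrDl.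
apply: lt_le_trans (lerB_normD _ _).
rewrite -natr1 in jX; rewrite ltrBrDr; apply: le_lt_trans jX.
rewrite mulrDl mul1r mulrDl addrA lerD2l normrM (gtr0_norm h0) ler_pM2r//.
by rewrite mulrNz normrN.
Qed.

End evolution.

(** * Compactly supported Lipschitz functions, their nodal values, and cell averages *)

Section lipschitz_functions.
Context {R : realType} {d : nat}.
Local Notation mu := (lebesgue_rV R d).
Local Notation Zd := 'rV[int]_d.
Implicit Types (h X Lam : R) (x y : 'rV[R]_d) (j m : Zd) (v : 'rV[R]_d -> R).

Definition inbox X x := [forall k, `|x ord0 k| <= X].

Definition node h j : 'rV[R]_d := \row_k ((j ord0 k)%:~R * h).

Definition lipc v Lam X :=
  (forall x y, `|v x - v y| <= Lam * \sum_k `|x ord0 k - y ord0 k|) /\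
  (forall x, ~~ inbox X x -> v x = 0).

Lemma node_cell_index h x k : 0 < h ->
  `|x ord0 k - node h (cell_index h x) ord0 k| <= h.
Proof.
move=> h0; rewrite !mxE.
have /andP[H1 H2] := floor_itv (x ord0 k / h + 2^-1).
move: H2; rewrite intrD; set z := (Num.floor _)%:~R in H1 * => H2.
have xE : x ord0 k = x ord0 k / h * h by rewrite divfK// gt_eqF.
rewrite {1}xE -mulrBl normrM (gtr0_norm h0) -[leRHS]mul1r ler_pM2r//.
by rewrite ler_norml; lra.
Qed.

Lemma inbox_node h X x : 0 < h -> inbox X (node h (cell_index h x)) -> inbox (X + h) x.
Proof.
move=> h0 /forallP xX; apply/forallP => k.
have := node_cell_index x k h0; have := xX k.
by rewrite !ler_norml; lra.
Qed.

Lemma inbox_node' h X x : 0 < h -> inbox X x -> inbox (X + h) (node h (cell_index h x)).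
Proof.
move=> h0 /forallP xX; apply/forallP => k.
have := node_cell_index x k h0; have := xX k.
by rewrite !ler_norml; lra.
Qed.

Lemma inbox_le X Y x : X <= Y -> inbox X x -> inbox Y x.
Proof. by move=> XY /forallP xX; apply/forallP => k; exact: le_trans XY. Qed.

Lemma inboxE X : [set x | inbox X x] = [set x | forall k, `[- X, X]%classic (x ord0 k)].
Proof.
apply/seteqP; split => x /=.
  by move=> /forallP xX k; rewrite /= in_itv /= -ler_norml.
by move=> xX; apply/forallP => k; have := xX k; rewrite /= in_itv /= -ler_norml.
Qed.

Lemma measurable_inbox X : measurable [set x | inbox X x].
Proof.
rewrite inboxE; apply: (measurable_rV_box (A := fun=> `[- X, X]%classic)) => i.
exact: measurable_itv.
Qed.

Lemma mu_inbox X : 0 <= X -> mu [set x | inbox X x] = ((2 * X) ^+ d)%:E.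
Proof.
move=> X0; rewrite inboxE (lebesgue_rV_box (A := fun=> `[- X, X]%classic)); last first.
  by move=> i; exact: measurable_itv.
rewrite (eq_bigr (fun=> (2 * X)%:E)).
  by rewrite (@prodEFin _ _ _ _ (fun=> 2 * X)) prodr_const card_ord.
move=> k _; rewrite lebesgue_measure_itv /= lte_fin.
move: X0; rewrite le_eqVlt => /predU1P[<-|X0].
  by rewrite oppr0 ltxx mulr0.
by rewrite ifT ?EFinN; [rewrite -EFinN -EFinB opprK mulr_natl mulr2n|lra].
Qed.

Lemma mu_inbox_fin X : (mu [set x | inbox X x] < +oo)%E.
Proof.
apply: (@le_lt_trans _ _ (mu [set x | inbox `|X| x])).
  apply: le_measure; rewrite ?inE; do ?exact: measurable_inbox.
  by move=> x /=; apply: inbox_le; exact: ler_norm.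
by rewrite mu_inbox// ltry.
Qed.

Lemma integral_inbox X (c : R) : 0 <= X ->
  (\int[mu]_x (c * (inbox X x)%:R)%:E)%E = (c * (2 * X) ^+ d)%:E.
Proof.
move=> X0.
transitivity (\int[mu]_(x in [set x | inbox X x]) c%:E)%E.
  rewrite [RHS]integral_mkcond; apply: eq_integral => x _; rewrite /patch.
  case: (boolP (inbox X x)) => xX; first by rewrite mem_set// mulr1.
  by rewrite memNset ?mulr0//; exact/negP.
transitivity (c%:E * mu [set x | inbox X x])%E.
  by apply: integral_cst; exact: measurable_inbox.
by rewrite mu_inbox.
Qed.

Lemma measurable_inboxR X (c : R) :
  measurable_fun [set: 'rV[R]_d] (fun x => (c * (inbox X x)%:R)%:E).
Proof.
apply/measurable_EFinP; apply: measurable_funM => //.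
rewrite (_ : (fun _ => _) = \1_[set x | inbox X x]).
  exact: measurable_indic (measurable_inbox X).
by apply/funext => x; rewrite indicE; congr (_%:R); congr nat_of_bool; apply/idP/idP; rewrite inE.
Qed.

Lemma lsum_inbox h X : 0 < h -> 0 <= X ->
  (lsum h (fun j => (inbox X (node h j))%:R) <= ((2 * (X + h)) ^+ d)%:E)%E.
Proof.
move=> h0 X0.
have Xh : 0 <= X + h by rewrite addr_ge0// ltW.
have := integral_inbox 1 Xh; rewrite mul1r => <-.
apply: ge0_le_integral => //.
- exact: (measurable_lattice (fun j => (inbox X (node h j))%:R)).
- exact: measurable_inboxR.
- move=> x _; rewrite lee_fin mul1r ler_nat.
  by case H : (inbox X _) => //; rewrite (inbox_node h0 H).
Qed.

Lemma lipc_node_shift v Lam X h m : 0 < h -> 0 <= Lam -> 0 <= X -> lipc v Lam X ->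
  (lsum h (fun j => `|v (node h (j + m)%R) - v (node h j)|%R) <=
   (2 * Lam * (2 * (X + h)) ^+ d * (h * \sum_k `|(m ord0 k)%:~R|))%:E)%E.
Proof.
move=> h0 L0 X0 [vlip vsupp].
pose c := Lam * (h * \sum_k `|(m ord0 k)%:~R : R|).
have c0 : 0 <= c by rewrite !mulr_ge0 ?sumr_ge0// ltW.
(* The difference vanishes unless one of the two nodes lies in the support box; the two
   possibilities produce the factor 2. *)
pose B j : R := (inbox X (node h j))%:R.
have B0 j : 0 <= B j by rewrite ler0n.
apply: (@le_trans _ _ (lsum h (fun j => c * B (j + m) + c * B j))).
  apply: le_lsum => // j.
  have vd : `|v (node h (j + m)) - v (node h j)| <= c.
    apply: (le_trans (vlip _ _)); rewrite ler_wpM2l// mulr_sumr; apply: ler_sum => k _.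
    by rewrite !mxE intrD mulrDl addrAC subrr add0r normrM (gtr0_norm h0) mulrC.
  rewrite /B; case: (boolP (inbox X (node h (j + m)))) => H1.
    by rewrite mulr1 (le_trans vd)// lerDl mulr_ge0.
  case: (boolP (inbox X (node h j))) => H2; first by rewrite mulr1 (le_trans vd)// lerDr mulr_ge0.
  by rewrite !vsupp// subrr normr0 !mulr0 addr0.
rewrite lsumD//; do ?by move=> j; rewrite mulr_ge0.
rewrite (lsum_shift (fun j => c * B j) m h0) lsumZ//.
apply: (@le_trans _ _ (c%:E * ((2 * (X + h)) ^+ d)%:E + c%:E * ((2 * (X + h)) ^+ d)%:E)%E).
  by apply: leeD; apply: lee_wpmul2l; rewrite ?lee_fin//; exact: lsum_inbox.
by rewrite -!EFinM -EFinD lee_fin /c le_eqVlt; apply/orP; left; apply/eqP; ring.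
Qed.

Lemma lipc_sub_node v Lam X h x : 0 < h -> 0 <= Lam -> lipc v Lam X ->
  `|v x - v (node h (cell_index h x))| <= Lam * (d%:R * h) * (inbox (X + h) x)%:R.
Proof.
move=> h0 L0 [vlip vsupp].
have [xX|xX] := boolP (inbox (X + h) x).
  rewrite mulr1; apply: (le_trans (vlip _ _)); rewrite ler_wpM2l//.
  apply: (@le_trans _ _ (\sum_(k < d) h)).
    by apply: ler_sum => k _; exact: node_cell_index.
  by rewrite sumr_const card_ord mulr_natl.
rewrite vsupp; last first.
  by apply: contra xX; apply: inbox_le; rewrite lerDl ltW.
rewrite vsupp ?subrr ?normr0 ?mulr0//.
by apply: contra xX; exact: inbox_node.
Qed.

(** Measurability refers to the sigma-algebra generated by the coordinates; v is the pointwise limit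
    of its samplings at the nodes of finer and finer grids, which are step functions. *)
Lemma lipc_measurable v Lam X : 0 <= Lam -> lipc v Lam X -> measurable_fun setT v.
Proof.
move=> L0 vl.
apply: (@measurable_fun_cvg _ _ _ _ (fun n x => v (node (n.+1%:R^-1) (cell_index (n.+1%:R^-1) x)))).
  by move=> n; apply: (measurable_cell_index (fun j => v (node _ j))).
move=> x _.
apply/cvgrPdist_le => e e0.
have : Lam * (d%:R * n.+1%:R^-1) @[n --> \oo] --> (0 : R).
  rewrite -[X in _ --> X](mulr0 Lam); apply: cvgMl_tmp.
  rewrite -[X in _ --> X](mulr0 (d%:R)); apply: cvgMl_tmp; exact: cvg_harmonic.
move=> /cvgrPdist_le/(_ e e0); apply: filterS => n.
rewrite sub0r normrN => H; apply: (le_trans (lipc_sub_node x _ L0 vl)) => //.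
apply: le_trans H; rewrite -[leRHS]mulr1 ger0_norm; last by rewrite !mulr_ge0.
by rewrite ler_wpM2l ?mulr_ge0//; case: inbox.
Qed.

Lemma cell_average_sub (u : 'rV[R]_d -> R) h j (w : R) : 0 < h ->
  mu.-integrable setT (EFin \o u) ->
  ((h ^+ d * `|cell_average h u j - w|)%:E <=
   \int[mu]_(x in hcell h j) `|u x - w|%:E)%E.
Proof.
move=> h0 iu.
have hd0 : 0 < h ^+ d by rewrite exprn_gt0.
have mC := measurable_cell h j.
have Cfin : (mu (cell h j) < +oo)%E by rewrite mu_cell// ltry.
have iuC : mu.-integrable (cell h j) (EFin \o u) by exact: integrableS iu.
have iwC : mu.-integrable (cell h j) (EFin \o cst w).
  apply: measurable_bounded_integrable => //.
  by exists `|w|; split; [exact: num_real|move=> y wy x _ /=; exact: ltW].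
have mu_ : measurable_fun setT u.
  by apply/measurable_EFinP; exact: measurable_int iu.
rewrite -[X in X * _](ger0_norm (ltW hd0)) -normrM mulrBr.
rewrite /cell_average mu_cell//= mulrA divff ?gt_eqF// mul1r.
have -> : h ^+ d * w = \int[mu]_(x in cell h j) w.
  transitivity (w * fine (mu (cell h j))); last exact/esym/Rintegral_cst.
  by rewrite mu_cell// mulrC.
rewrite -RintegralB// EFin_normr_Rintegral//; last first.
  rewrite (_ : _ \o _ = (fun x => (EFin \o u) x - (EFin \o cst w) x)%E)//.
  exact: integrableB.
have mabs : measurable_fun setT (fun x => `|u x - w|%:E).
  by apply/measurable_EFinP; apply: measurableT_comp => //; exact: measurable_funB.
(* Passing from the open cell to the half-open one only enlarges the integral. *)
apply: (@le_trans _ _ (\int[mu]_(x in cell h j) `|u x - w|%:E)%E).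
  apply: le_abse_integral => //.
  by apply/measurable_EFinP; apply: measurable_funTS; exact: measurable_funB.
apply: ge0_subset_integral => //.
- exact: measurable_hcell.
- exact: measurable_funTS.
- by move=> x xC k; have /andP[xC1 xC2] := xC k; rewrite /= in_itv /= xC2 ltW.
Qed.

Lemma integral_sub_node v Lam X h : 0 < h -> 0 <= Lam -> 0 <= X -> lipc v Lam X ->
  (\int[mu]_x `|v x - v (node h (cell_index h x))|%:E <=
   (Lam * (d%:R * h) * (2 * (X + h)) ^+ d)%:E)%E.
Proof.
move=> h0 L0 X0 vl.
have Xh : 0 <= X + h by rewrite addr_ge0// ltW.
rewrite -integral_inbox//; apply: ge0_le_integral => //.
- apply/measurable_EFinP; apply: measurableT_comp => //; apply: measurable_funB.
    exact: lipc_measurable vl.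
  exact: (measurable_cell_index (fun j => v (node _ j))).
- exact: measurable_inboxR.
- by move=> x _; rewrite lee_fin; exact: lipc_sub_node.
Qed.

(* The second term tends to 0 with h, so that cell averages and point values of a
   Lipschitz approximation of u are interchangeable in the limit. *)
Lemma lsum_average_node u v Lam X h : 0 < h -> 0 <= Lam -> 0 <= X -> lipc v Lam X ->
  mu.-integrable setT (EFin \o u) ->
  (lsum h (fun j => `|cell_average h u j - v (node h j)|%R) <=
   \int[mu]_x `|u x - v x|%:E + (Lam * (d%:R * h) * (2 * (X + h)) ^+ d)%:E)%E.
Proof.
move=> h0 L0 X0 vl iu.
have mv := lipc_measurable L0 vl.
have mu_ : measurable_fun setT u.
  by apply/measurable_EFinP; exact: measurable_int iu.
have mvn : measurable_fun setT (fun x => v (node h (cell_index h x))).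
  exact: (measurable_cell_index (fun j => v (node _ j))).
have mB (f g : 'rV[R]_d -> R) : measurable_fun setT f -> measurable_fun setT g ->
    measurable_fun setT (fun x => `|f x - g x|%:E).
  move=> mf mg; apply/measurable_EFinP; apply: measurableT_comp => //.
  exact: measurable_funB.
apply: (@le_trans _ _ (\int[mu]_x `|u x - v (node h (cell_index h x))|%:E)%E).
  apply: lsum_le_integral => //; first exact: mB.
  move=> j; apply: (le_trans (cell_average_sub j (v (node h j)) h0 iu)).
  rewrite le_eqVlt; apply/orP; left; apply/eqP; apply: eq_integral => x.
  by rewrite inE -cell_index_preimage// => /= ->.
apply: le_trans (leeD (lexx _) (integral_sub_node h0 L0 X0 vl)).
rewrite -ge0_integralD//; do ?exact: mB.
apply: ge0_le_integral => //; first exact: mB.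
  by apply: emeasurable_funD; exact: mB.
by move=> x _; rewrite -EFinD lee_fin; exact: ler_distD.
Qed.

End lipschitz_functions.

(** * Density of Lipschitz functions in L^1 *)

Section L1_tools.
Context d (T : measurableType d) (R : realType).
Variable mu : {measure set T -> \bar R}.

Lemma measurable_dist (f g : T -> R) : measurable_fun setT f -> measurable_fun setT g ->
  measurable_fun setT (fun x => `|f x - g x|%:E).
Proof.
move=> mf mg; apply/measurable_EFinP; apply: measurableT_comp => //.
exact: measurable_funB.
Qed.

Lemma integral_dist_triangle (g f h : T -> R) : measurable_fun setT f ->
  measurable_fun setT g -> measurable_fun setT h ->
  (\int[mu]_x `|f x - h x|%:E <=
   \int[mu]_x `|f x - g x|%:E + \int[mu]_x `|g x - h x|%:E)%E.
Proof.
move=> mf mg mh; rewrite -ge0_integralD//; do ?exact: measurable_dist.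
apply: ge0_le_integral => //; first exact: measurable_dist.
  by apply: emeasurable_funD; exact: measurable_dist.
by move=> x _; rewrite -EFinD lee_fin; exact: ler_distD.
Qed.

Lemma L1_dominated (f_ : nat -> T -> R) (f g : T -> R) :
  (forall n, measurable_fun setT (f_ n)) ->
  (forall x, f_ n x @[n --> \oo] --> f x) ->
  mu.-integrable setT (EFin \o g) -> (forall n x, `|f_ n x| <= g x) ->
  (\int[mu]_x `|f_ n x - f x|%:E)%E @[n --> \oo] --> 0%E.
Proof.
move=> mf_ ff ig fg.
have mf : measurable_fun setT f by apply: (measurable_fun_cvg mf_) => x _; exact: ff.
have [|||||_ + _] := @dominated_convergence _ T R mu setT measurableT
  (fun n => EFin \o f_ n) (EFin \o f) (EFin \o g) => //.
- by move=> n; apply/measurable_EFinP.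
- by apply/measurable_EFinP.
- apply: aeW => x _; apply: cvg_EFin; first exact: nearW.
  exact: ff.
- by apply: aeW => x n _; rewrite lee_fin.
Qed.

Lemma cvge0_small (u : nat -> \bar R) (e : R) : u @ \oo --> 0%E -> 0 < e ->
  \forall n \near \oo, (u n <= e%:E)%E.
Proof.
move=> u0 e0; have /fine_cvgP[uf /cvgrPdist_le/(_ _ e0) ue] := u0.
near=> n.
have un : u n \is a fin_num by near: n.
rewrite -(fineK un) lee_fin; apply: le_trans (ler_norm _) _.
by rewrite -normrN -sub0r; near: n.
Unshelve. all: by end_near. Qed.

End L1_tools.

Section density.
Context {R : realType} {d : nat}.
Local Notation mu := (lebesgue_rV R d).
Implicit Types (X Lam M : R) (x y : 'rV[R]_d) (v f g : 'rV[R]_d -> R).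

Definition lip Lam f := forall x y, `|f x - f y| <= Lam * \sum_k `|x ord0 k - y ord0 k|.

Lemma lip_cst Lam (c : R) : 0 <= Lam -> lip Lam (fun=> c).
Proof. by move=> L0 x y; rewrite subrr normr0 mulr_ge0// sumr_ge0. Qed.

Lemma lip_min Lam f g : lip Lam f -> lip Lam g -> lip Lam (fun x => Num.min (f x) (g x)).
Proof.
move=> lf lg x y; have := lf x y; have := lg x y.
move: (f x) (g x) (f y) (g y) (Lam * _) => a b a' b' C.
by case: (leP a b); case: (leP a' b'); rewrite !ler_norml; lra.
Qed.

Lemma lip_max Lam f g : lip Lam f -> lip Lam g -> lip Lam (fun x => Num.max (f x) (g x)).
Proof.
move=> lf lg x y; have := lf x y; have := lg x y.
move: (f x) (g x) (f y) (g y) (Lam * _) => a b a' b' C.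
by case: (leP a b); case: (leP a' b'); rewrite !ler_norml; lra.
Qed.

Definition box (a b : 'I_d -> R) := [set x : 'rV[R]_d | forall k, a k < x ord0 k < b k].

Lemma boxE a b : box a b = [set x | forall k, `]a k, b k[%classic (x ord0 k)].
Proof. by apply/seteqP; split => x H k; have := H k; rewrite /= in_itv. Qed.

Lemma measurable_box a b : measurable (box a b).
Proof.
by rewrite boxE; apply: (measurable_rV_box (A := fun k => `]a k, b k[%classic)) => k;
  exact: measurable_itv.
Qed.

(** In each coordinate, n times the signed distance to the nearer face, cut off at 0 and 1: a
    Lipschitz approximation from below of the indicator of the open box. *)
Definition tent (a b : 'I_d -> R) (n : nat) x : R :=
  Num.max 0 (\big[Num.min/1]_(k < d) (n%:R * Num.min (x ord0 k - a k) (b k - x ord0 k))).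

Lemma lip_bigmin Lam (I : Type) (s : seq I) (F : I -> 'rV[R]_d -> R) : 0 <= Lam ->
  (forall k, lip Lam (F k)) -> lip Lam (fun x => \big[Num.min/1]_(k <- s) F k x).
Proof.
move=> L0 lF; elim: s => [|k s IH].
  by move=> x y; rewrite !big_nil; exact: (lip_cst 1 L0).
by move=> x y; rewrite !big_cons; exact: (lip_min (lF k) IH).
Qed.

Lemma lip_tent a b n : lip n%:R (tent a b n).
Proof.
apply: lip_max; first exact: lip_cst.
apply: lip_bigmin => // k x y.
rewrite -mulrBr normrM (ger0_norm (ler0n _ _)) ler_wpM2l// (bigD1 k)//=.
have : 0 <= \sum_(i < d | i != k) `|x ord0 i - y ord0 i| by exact: sumr_ge0.
have : `|Num.min (x ord0 k - a k) (b k - x ord0 k) -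
   Num.min (y ord0 k - a k) (b k - y ord0 k)| <= `|x ord0 k - y ord0 k|.
  move: (x ord0 k) (y ord0 k) (a k) (b k) => u v p q.
  have := ler_norm (u - v); have := lerNnormlW (lexx `|u - v|).
  by case: (leP (u - p)); case: (leP (v - p)); rewrite ler_norml; lra.
by lra.
Qed.

Lemma tent_ge0 a b n x : 0 <= tent a b n x.
Proof. by rewrite le_max lexx. Qed.

Lemma tent_le1 a b n x : tent a b n x <= 1.
Proof. by rewrite ge_max ler01 /= bigmin_le_id. Qed.

Lemma tent_out a b n x : ~ box a b x -> tent a b n x = 0.
Proof.
move=> xab; apply/max_idPl.
have [k xk] : exists k, ~ (a k < x ord0 k < b k) by apply/existsNP.
rewrite (bigD1 k)//= ge_min; apply/orP; left; apply: mulr_ge0_le0 => //.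
by rewrite ge_min !subr_le0; case: (leP (x ord0 k) (a k)) xk => //= ak; case: (leP (b k)) => // xb [].
Qed.

Lemma tent_cvg a b x : tent a b n x @[n --> \oo] --> (\1_(box a b) x : R).
Proof.
have [xab|xab] := pselect (box a b x); last first.
  rewrite indicE memNset// (_ : (fun _ => _) = cst 0); first exact: cvg_cst.
  by apply/funext => n; exact: tent_out.
rewrite indicE mem_set//; apply: cvg_near_cst.
pose del k := Num.min (x ord0 k - a k) (b k - x ord0 k).
have del0 k : 0 < del k by have /andP[? ?] := xab k; rewrite lt_min !subr_gt0; apply/andP.
have : \forall n \near \oo, forall k, 1 <= n%:R * del k.
  apply: filter_forall => k; near=> n.
  by rewrite -ler_pdivrMr// mul1r; near: n; exact: nbhs_infty_ger.
apply: filterS => n Hn; apply/eqP; rewrite eq_le tent_le1 /= le_max; apply/orP; right.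
by elim/big_ind : _ => // [u v u1 v1|k _]; [rewrite le_min u1|exact: Hn].
Unshelve. all: by end_near. Qed.

Lemma box_inbox a b x : box a b x -> inbox (\sum_k (`|a k| + `|b k|)) x.
Proof.
move=> xab; apply/forallP => k; rewrite (bigD1 k)//=.
have : 0 <= \sum_(i < d | i != k) (`|a i| + `|b i|).
  by apply: sumr_ge0 => i _; rewrite addr_ge0.
have /andP[ax xb] := xab k.
have := lerNnormlW (lexx `|a k|); have := ler_norm (b k).
by have := normr_ge0 (a k); have := normr_ge0 (b k); rewrite ler_norml; lra.
Qed.

(** Membership in the L^1 closure of the compactly supported Lipschitz functions; measurability is
    bundled because the triangle inequality for integrals asks for it. *)
Definition lip_approx f := measurable_fun setT f /\ forall e, 0 < e ->
  exists v Lam X, [/\ 0 <= Lam, 0 <= X, lipc v Lam X &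
    (\int[mu]_x `|f x - v x|%:E <= e%:E)%E].

Lemma lip_approx_lipc v Lam X : 0 <= Lam -> 0 <= X -> lipc v Lam X -> lip_approx v.
Proof.
move=> L0 X0 vl; split; first exact: lipc_measurable vl.
move=> e e0; exists v, Lam, X; split => //.
by rewrite integral0_eq ?lee_fin ?ltW// => x _; rewrite subrr normr0.
Qed.

Lemma lip_approx_cvg (f_ : nat -> 'rV[R]_d -> R) f : measurable_fun setT f ->
  (forall n, lip_approx (f_ n)) ->
  (\int[mu]_x `|f_ n x - f x|%:E)%E @[n --> \oo] --> 0%E -> lip_approx f.
Proof.
move=> mf af ff; split => // e e0.
have e20 : 0 < e / 2 by rewrite divr_gt0.
have /filter_ex[n fn] := cvge0_small ff e20.
have [v [Lam [X [L0 X0 vl fnv]]]] := (af n).2 _ e20.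
exists v, Lam, X; split => //.
apply: le_trans (integral_dist_triangle _ mf (af n).1 (lipc_measurable L0 vl)) _.
rewrite [e]splitr EFinD; apply: leeD => //.
by apply: le_trans fn; under eq_integral do rewrite distrC.
Qed.

Lemma lip_approx0 : lip_approx (fun=> 0).
Proof.
apply: (@lip_approx_lipc _ 0 0) => //; split => // x y.
by rewrite subrr normr0 mul0r.
Qed.

Lemma lip_approxD f g : lip_approx f -> lip_approx g -> lip_approx (fun x => f x + g x).
Proof.
move=> [mf af] [mg ag]; split; first exact: measurable_funD.
move=> e e0; have e20 : 0 < e / 2 by rewrite divr_gt0.
have [v [Lam [X [L0 X0 [vl vX] fv]]]] := af _ e20.
have [w [Lam' [Y [L'0 Y0 [wl wY] gw]]]] := ag _ e20.
exists (fun x => v x + w x), (Lam + Lam'), (X + Y); split; rewrite ?addr_ge0//.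
  split => [x y|x xXY].
    rewrite opprD addrACA mulrDl; apply: le_trans (ler_normD _ _) _.
    exact: lerD.
  rewrite vX ?wY ?addr0//; apply: contra xXY; apply: inbox_le.
    by rewrite lerDr.
  by rewrite lerDl.
have mv := lipc_measurable L0 (conj vl vX); have mw := lipc_measurable L'0 (conj wl wY).
rewrite [e]splitr EFinD; apply: le_trans (leeD fv gw).
rewrite -ge0_integralD//; do ?exact: measurable_dist.
apply: ge0_le_integral => //; first by apply: measurable_dist; exact: measurable_funD.
  by apply: emeasurable_funD; exact: measurable_dist.
by move=> x _; rewrite -EFinD lee_fin opprD addrACA ler_normD.
Qed.

Lemma lip_approxZ c f : lip_approx f -> lip_approx (fun x => c * f x).
Proof.
move=> [mf af]; split; first exact: measurable_funM.
move=> e e0; have c1 : 0 < `|c| + 1 by rewrite ltr_wpDl.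
have ec0 : 0 < e / (`|c| + 1) by rewrite divr_gt0.
have [v [Lam [X [L0 X0 [vl vX] fv]]]] := af _ ec0.
exists (fun x => c * v x), (`|c| * Lam), X; split; rewrite ?mulr_ge0//.
  split => [x y|x xX]; last by rewrite vX ?mulr0.
  by rewrite -mulrBr normrM -mulrA ler_wpM2l.
have mv := lipc_measurable L0 (conj vl vX).
under eq_integral do rewrite -mulrBr normrM EFinM.
rewrite ge0_integralZl//; last exact: measurable_dist.
apply: (@le_trans _ _ (`|c|%:E * (e / (`|c| + 1))%:E)%E).
  by apply: lee_wpmul2l => //; rewrite lee_fin.
rewrite -EFinM lee_fin mulrCA ger_pMr// ler_pdivrMr// mul1r lerDl//.
Qed.

Lemma lip_approxB f g : lip_approx f -> lip_approx g -> lip_approx (fun x => f x - g x).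
Proof.
move=> af /(lip_approxZ (-1)) ag; have := lip_approxD af ag.
by congr lip_approx; apply/funext => x; rewrite mulN1r.
Qed.

Lemma lip_approx_sum (I : eqType) (s : seq I) (F : I -> 'rV[R]_d -> R) :
  (forall i, lip_approx (F i)) -> lip_approx (fun x => \sum_(i <- s) F i x).
Proof.
move=> aF; elim: s => [|i s IH].
  have := lip_approx0; congr lip_approx; apply/funext => x; exact/esym/big_nil.
have := lip_approxD (aF i) IH; congr lip_approx; apply/funext => x.
exact/esym/big_cons.
Qed.

Lemma integrable_inbox X : mu.-integrable setT (EFin \o \1_[set x | inbox X x]).
Proof.
apply/integrableP; split; first by
  apply/measurable_EFinP; exact: measurable_indic (measurable_inbox X).
rewrite (eq_integral (EFin \o \1_[set x | inbox X x])); last first.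
  by move=> x _; rewrite /= ger0_norm// indicE.
by rewrite integral_indic ?setIT; [exact: mu_inbox_fin|exact: measurableT|exact: measurable_inbox].
Qed.

Lemma indic_in (A : set 'rV[R]_d) x : A x -> \1_A x = 1 :> R.
Proof. by move=> xA; rewrite indicE mem_set. Qed.

Lemma indic_out (A : set 'rV[R]_d) x : ~ A x -> \1_A x = 0 :> R.
Proof. by move=> xA; rewrite indicE memNset. Qed.

Lemma indic_le_inbox X (A : set 'rV[R]_d) x : A `<=` [set x | inbox X x] ->
  `|\1_A x : R| <= \1_[set x | inbox X x] x.
Proof.
move=> AX; rewrite ger0_norm ?indicE// ler_nat.
by case: (boolP (x \in A)) => // /set_mem/AX xX; rewrite mem_set.
Qed.

Lemma lip_approx_box a b : lip_approx (\1_(box a b)).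
Proof.
pose X := \sum_k (`|a k| + `|b k|).
have X0 : 0 <= X by apply: sumr_ge0 => k _; rewrite addr_ge0.
have tl n : lipc (tent a b n) n%:R X.
  split; first exact: lip_tent.
  by move=> x xX; apply: tent_out => /box_inbox; exact/negP.
apply: (@lip_approx_cvg (tent a b)).
- exact: measurable_indic (measurable_box a b).
- move=> n; exact: lip_approx_lipc (tl n).
- apply: (L1_dominated (g := \1_[set x | inbox X x])).
  + move=> n; exact: lipc_measurable (tl n).
  + by move=> x; exact: tent_cvg.
  + exact: integrable_inbox.
  + move=> n x; rewrite ger0_norm ?tent_ge0// indicE.
    case: (boolP (inbox X x)) => xX; first by rewrite mem_set//= tent_le1.
    by rewrite memNset//=; [rewrite (tl n).2|exact/negP].
Qed.

Definition cube (M : R) := box (fun=> - M) (fun=> M).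

Lemma cube_inbox M : cube M `<=` [set x | inbox M x].
Proof.
move=> x xM; apply/forallP => k; have /andP[x1 x2] := xM k.
by rewrite ler_norml !ltW.
Qed.

Lemma setI_box a b a' b' : box a b `&` box a' b' =
  box (fun k => Num.max (a k) (a' k)) (fun k => Num.min (b k) (b' k)).
Proof.
apply/seteqP; split => x.
  by move=> [H H'] k; have /andP[? ?] := H k; have /andP[? ?] := H' k;
    rewrite gt_max lt_min; apply/andP; split; apply/andP.
move=> H; split => k; have := H k; rewrite gt_max lt_min => /andP[/andP[? ?] /andP[? ?]];
  exact/andP.
Qed.

Lemma measurable_boxes (A : set 'rV[R]_d) : measurable A ->
  <<s [set B | exists a b, B = box a b] >> A.
Proof.
move=> mA; pose G := [set B | exists a b, B = box a b].
suff H : measurable_fun setT (id : g_sigma_algebraType G -> 'rV[R]_d).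
  by have := H measurableT _ mA; rewrite setTI.
apply: measurable_fun_rV => i.
apply: (measurability _ (RGenOInfty.measurableE R)) => _ [_ [x ->] <-].
(* A half-space is the countable union of the boxes cut off at -n and n, whose lower bound in
   direction i is the given threshold. *)
rewrite setTI (_ : _ @^-1` _ = \bigcup_n
   box (fun k => if k == i then x else - n%:R) (fun=> n%:R)); last first.
  apply/seteqP; split => y /=.
    rewrite in_itv /= andbT => xy.
    have [n Hn] : exists n : nat, forall k, `|y ord0 k| < n%:R.
      have : \forall n \near \oo, forall k, `|y ord0 k| < n%:R.
        apply: filter_forall => k; near=> n; near: n; exact: nbhs_infty_gtr.
      by move=> /filter_ex[n Hn]; exists n.
    exists n => // k; have := Hn k; rewrite ltr_norml => /andP[y1 ->].
    by rewrite andbT; case: eqP => // ->.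
  move=> [n _ /(_ i)]; rewrite eqxx => /andP[xy _].
  by rewrite in_itv /= andbT.
apply: bigcupT_measurable => n; apply: sub_sigma_algebra.
by eexists; eexists; reflexivity.
Unshelve. all: by end_near. Qed.

(** A pi-lambda argument from the boxes, which are stable under intersection. The cube keeps all
    indicators below an integrable function, so that increasing unions pass to the L^1 limit by
    dominated convergence. *)
Lemma lip_approx_indic (A : set 'rV[R]_d) M : measurable A ->
  lip_approx (\1_(A `&` cube M)).
Proof.
move=> mA; move: M; pose H := [set A : set 'rV[R]_d | measurable A /\
  forall M, lip_approx (\1_(A `&` cube M))].
suff : H A by case.
have := measurable_boxes mA; move: A {mA}; apply: lambda_system_subset => //.
- move=> _ _ [a [b ->]] [a' [b' ->]]; rewrite setI_box.
  by eexists; eexists; reflexivity.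
- split => //.
  + split => // M; rewrite setTI; exact: lip_approx_box.
  + move=> A B BA [mA aA] [mB aB]; split; first exact: measurableD.
    move=> M; have := lip_approxB (aA M) (aB M); congr lip_approx.
    apply/funext => x; have [xM|xM] := pselect (cube M x); last first.
      by rewrite !indic_out ?subrr// => -[].
    have [xB|xB] := pselect (B x).
      rewrite (indic_in (A := B `&` _))// (indic_in (A := A `&` _)); last first.
        by split => //; exact: BA.
      by rewrite subrr indic_out// => -[[]].
    rewrite [X in _ - X]indic_out ?subr0; last by case.
    have [xA|xA] := pselect (A x); first by rewrite !indic_in.
    by rewrite !indic_out//; [move=> [[]]|case].
  + move=> F ndF HF; split; first by apply: bigcup_measurable => k _; case: (HF k).
    move=> M; apply: (@lip_approx_cvg (fun n => \1_(F n `&` cube M))).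
    * apply/measurable_indic/measurableI; last exact: measurable_box.
      by apply: bigcup_measurable => k _; case: (HF k).
    * by move=> n; case: (HF n).
    * apply: (L1_dominated (g := \1_[set x | inbox M x])).
      - move=> n; apply/measurable_indic/measurableI; last exact: measurable_box.
        by case: (HF n).
      - move=> x; have [[[m _ Fm] xM]|xF] := pselect (((\bigcup_i F i) `&` cube M) x).
          rewrite indicE mem_set; last by split => //; exists m.
          apply: cvg_near_cst; near=> n; rewrite indicE mem_set//; split => //.
          move: Fm; apply/subsetPset/ndF; near: n; exact: nbhs_infty_ge.
        rewrite indicE memNset// (_ : (fun _ => _) = cst 0); first exact: cvg_cst.
        apply/funext => n; rewrite indicE memNset// => -[Fn xM]; apply: xF.
        by split => //; exists n.
      - exact: integrable_inbox.
      - move=> n x; apply: indic_le_inbox; apply: subset_trans (@cube_inbox M).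
        by move=> y [].
- by move=> _ [a [b ->]]; split; [exact: measurable_box|move=> M; rewrite setI_box; exact: lip_approx_box].
Unshelve. all: by end_near. Qed.

Import HBNNSimple HBSimple.

(** The level sets may be unbounded, so g is first cut off by growing cubes; the cut-offs are
    dominated by |g| and converge to g. *)
Lemma lip_approx_sfun (g : {sfun 'rV[R]_d >-> R}) : mu.-integrable setT (EFin \o g) ->
  lip_approx g.
Proof.
move=> ig.
apply: (@lip_approx_cvg (fun n x => g x * \1_(cube n%:R) x)).
- exact: measurable_funPT.
- move=> n.
  have ay (y : R) : lip_approx (fun x => y * \1_(g @^-1` [set y] `&` cube n%:R) x).
    by apply/lip_approxZ/lip_approx_indic; exact: measurable_funPTI.
  have := lip_approx_sum (finmap.enum_fset (fset_set (range g))) ay.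
  congr lip_approx; apply/funext => x; rewrite fimfunE fsbig_finite//= mulr_suml.
  by apply: eq_bigr => y _; rewrite -mulrA; congr (_ * _); rewrite indicI.
- apply: (L1_dominated (g := fun x => `|g x|)).
  + by move=> n; apply: measurable_funM; [exact: measurable_funPT|exact: measurable_indic (measurable_box _ _)].
  + move=> x; apply: cvg_near_cst.
    have : \forall n \near \oo, forall k, `|x ord0 k| < n%:R.
      apply: filter_forall => k; near=> n; near: n; exact: nbhs_infty_gtr.
    apply: filterS => n Hn; rewrite indicE mem_set ?mulr1// => k.
    by have := Hn k; rewrite ltr_norml.
  + exact: integrable_norm.
  + by move=> n x; rewrite normrM ler_piMr// ger0_norm ?indicE// lern1 leq_b1.
Unshelve. all: by end_near. Qed.

Theorem lip_approx_integrable f : mu.-integrable setT (EFin \o f) -> lip_approx f.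
Proof.
move=> intf; have mf : measurable_fun setT f by apply/measurable_EFinP; exact: measurable_int intf.
have [g_ [ig _ gf]] := approximation_sfun_integrable measurableT intf.
apply: (@lip_approx_cvg g_) => //; first by move=> n; exact: lip_approx_sfun.
apply: cvg_trans gf; apply: near_eq_cvg; apply: nearW => n /=.
by apply: eq_integral => x _; rewrite distrC.
Qed.

(* Truncating the approximation at the level U of f can only improve it. *)
Theorem lip_approx_bounded f U e : 0 <= U -> mu.-integrable setT (EFin \o f) ->
  {ae mu, forall x, `|f x| <= U} -> 0 < e ->
  exists v Lam X, [/\ 0 <= Lam, 0 <= X, lipc v Lam X,
    (forall x, - U <= v x <= U) &
    (\int[mu]_x `|f x - v x|%:E <= e%:E)%E].
Proof.
move=> U0 intf fU e0.
have [mf /(_ e e0)[v [Lam [X [L0 X0 [vl vX] fv]]]]] := lip_approx_integrable intf.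
have NU : - U <= U by rewrite (le_trans _ U0)// oppr_le0.
have wl : lipc (fun x => Num.max (- U) (Num.min U (v x))) Lam X.
  split; last by move=> x xX; rewrite vX// (min_idPr U0); apply/max_idPr; rewrite oppr_le0.
  by apply: lip_max; [exact: lip_cst|apply: lip_min => //; exact: lip_cst].
exists (fun x => Num.max (- U) (Num.min U (v x))), Lam, X; split => //.
  by move=> x; rewrite le_max lexx /= ge_max NU ge_min lexx.
apply: le_trans fv; apply: ae_ge0_le_integral => //.
- by apply: measurable_dist => //; exact: lipc_measurable wl.
- by apply: measurable_dist => //; exact: lipc_measurable (conj vl vX).
- apply: filterS fU => x fU _; rewrite lee_fin.
  move: fU; rewrite ler_norml; move: (f x) (v x) => y z /andP[y1 y2].
  have z1 := ler_norm (y - z); have z2 := lerNnormlW (lexx `|y - z|).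
  move: z1 z2; rewrite ler_norml; set A := `|y - z| => z1 z2.
  case: (leP U z) => Uz; first by rewrite (max_idPr NU); lra.
  by case: (leP (- U) z) => NUz; lra.
Qed.

End density.

(** * Compactness of the scheme *)

Section extraction.

Let unbounded (A : nat -> Prop) := forall N, exists2 n, (N <= n)%N & A n.

Lemma pigeonhole_unbounded (K : finType) (col : nat -> K) (A : nat -> Prop) :
  unbounded A -> exists c, unbounded (fun n => A n /\ col n = c).
Proof.
move=> uA; apply: contrapT => /forallNP H.
have : forall c, exists N, forall n, (N <= n)%N -> ~ (A n /\ col n = c).
  move=> c; have /existsNP[N HN] := H c; exists N => n Nn An.
  by apply: HN; exists n.
move=> /choice[N HN].
have [n Nn An] := uA (\max_c N c)%N.
by apply: (HN (col n) n) => //; apply: leq_trans Nn; exact: leq_bigmax.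
Qed.

(** For each k some tail of the indices splits into finitely many classes on which [E k] holds
    pairwise. Infinite classes are chosen in a nested way, and [s r] lies in the first r + 1 of
    them, whence [E k] for all pairs of ranks from k on. *)
Lemma diagonal_extraction (E : nat -> nat -> nat -> Prop) :
  (forall k, exists (K : finType) (col : nat -> K) (P : nat), forall p p',
    (P <= p)%N -> (P <= p')%N -> col p = col p' -> E k p p') ->
  exists s : nat -> nat, {homo s : m n / (m < n)%N >-> (m < n)%N} /\
    forall k m n, (k <= m)%N -> (k <= n)%N -> E k (s m) (s n).
Proof.
move=> HE.
pose S := {A : nat -> Prop | unbounded A}.
have refine_ (kA : nat * S) : exists B : S, (forall n, sval B n -> sval kA.2 n) /\
    forall p p', sval B p -> sval B p' -> E kA.1 p p'.
  case: kA => k [A uA] /=.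
  have [K [col [P HP]]] := HE k.
  have uAP : unbounded (fun n => A n /\ (P <= n)%N).
    move=> N; have [n Nn An] := uA (maxn N P); exists n.
      by apply: leq_trans Nn; exact: leq_maxl.
    by split => //; apply: leq_trans Nn; exact: leq_maxr.
  have [c uc] := pigeonhole_unbounded col uAP.
  exists (exist _ _ uc) => /=; split => [n [[]]//|p p' [[_ Pp] cp] [[_ Pp'] cp']].
  by apply: HP => //; rewrite cp.
have [f Hf] := choice refine_.
have pick_ (AN : S * nat) : exists n, (AN.2 <= n)%N /\ sval AN.1 n.
  by case: AN => -[A uA] N; have [n Nn An] := uA N; exists n.
have [g Hg] := choice pick_.
have uT : unbounded (fun=> True) by move=> N; exists N.
pose As := fix As k : S := if k is k'.+1 then f (k', As k') else exist _ _ uT.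
have As_sub k i n : sval (As (i + k)%N) n -> sval (As k) n.
  elim: i => //= i IH H; apply: IH.
  exact: (Hf (_, _)).1 H.
pose s := fix s n := g (As n.+1, if n is n'.+1 then (s n').+1 else 0%N).
have sE n : s n = g (As n.+1, if n is n'.+1 then (s n').+1 else 0%N) by case: n.
have sA n : sval (As n.+1) (s n) by rewrite sE; exact: (Hg (_, _)).2.
have sS n : (s n < s n.+1)%N by rewrite [s n.+1]sE; exact: (Hg (_, _)).1.
exists s; split; first exact: (homo_ltn ltn_trans sS).
move=> k m n km kn.
have Ak r : (k <= r)%N -> sval (As k.+1) (s r).
  by move=> kr; apply: (As_sub _ (r - k)%N); rewrite addnS subnK.
exact: (Hf (k, As k)).2 (Ak m km) (Ak n kn).
Qed.

Lemma quantization (R : realType) (I : finType) (a : nat -> I -> R) (B eta : R) (P : nat) :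
  0 < eta -> (forall p i, (P <= p)%N -> `|a p i| <= B) ->
  exists (K : finType) (col : nat -> K), forall p p', (P <= p)%N -> (P <= p')%N ->
    col p = col p' -> forall i, `|a p i - a p' i| <= eta.
Proof.
move=> e0 aB.
(* Levels have height eta, and the shifted values a + B lie in [0, 2B], which meets at most Q + 1
   levels. *)
pose Q := Num.truncn (2 * B / eta).
exists {ffun I -> 'I_Q.+1}, (fun p => [ffun i => inord (Num.truncn ((a p i + B) / eta))]).
move=> p p' Pp Pp' /ffunP cE i; have := cE i; rewrite !ffunE => /(congr1 val) /=.
have bnd r : (P <= r)%N -> 0 <= (a r i + B) / eta /\ (Num.truncn ((a r i + B) / eta) < Q.+1)%N.
  move=> Pr; have := aB r i Pr; rewrite ler_norml => /andP[a1 a2].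
  have H0 : 0 <= (a r i + B) / eta by apply: divr_ge0; [lra|exact: ltW].
  split => //; rewrite ltnS /Q; apply: le_truncn; rewrite ler_pM2r ?invr_gt0//; lra.
have [p0 pQ] := bnd _ Pp; have [p'0 p'Q] := bnd _ Pp'.
rewrite !inordK// => E.
have /andP[p1 p2] := truncn_itv p0; have /andP[p'1 p'2] := truncn_itv p'0.
rewrite E in p1 p2; move: p1 p2 p'1 p'2; rewrite -natr1.
set z := _%:R.
rewrite !ler_pdivlMr// !ltr_pdivrMr// ler_norml => *.
by nra.
Qed.

End extraction.

(** * Coarse-graining of lattice functions *)

Section coarse_graining.
Context {R : realType} {d q : nat}.
Local Notation mu := (lebesgue_rV R d).
Local Notation Zd := 'rV[int]_d.
Implicit Types (h delta : R) (r J : Zd) (M : nat).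

(** Parametrizes the integer points of [-M, M]^d by a finite type, so that windows can be summed
    over, counted, and used to index quantized values. *)
Definition boxpt M (m : {ffun 'I_d -> 'I_(M.*2.+1)}) : Zd :=
  \row_k ((m k : nat)%:Z - M%:Z).

Lemma boxpt_inj M : injective (@boxpt M).
Proof.
move=> m m' /rowP E; apply/ffunP => k; apply/val_inj.
by have := E k; rewrite !mxE => /addIr [].
Qed.

Lemma boxpt_le M (m : {ffun 'I_d -> 'I_(M.*2.+1)}) k : `|boxpt m ord0 k| <= M%:Z.
Proof.
rewrite mxE; move: (nat_of_ord (m k)) (ltn_ord (m k)) => z.
by rewrite ltnS -addnn; lia.
Qed.

Lemma boxptP M J : (forall k, `|J ord0 k| <= M%:Z) -> exists m, J = @boxpt M m.
Proof.
move=> JM; exists [ffun k => inord (absz (J ord0 k + M%:Z))].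
apply/rowP => k; rewrite mxE ffunE; have := JM k => Jk.
rewrite inordK; last by move: Jk; rewrite -addnn; lia.
by rewrite [J 0 k](_ : _ = J ord0 k)//; move: Jk; lia.
Qed.

(** A window of radius M recentred by at most M stays inside the window of radius 2M, and the terms
    are nonnegative. *)
Lemma sum_boxpt_le (G : Zd -> R) M r : (forall j, 0 <= G j) ->
  (forall k, `|r ord0 k| <= M%:Z) ->
  \sum_(m : {ffun 'I_d -> 'I_(M.*2.+1)}) G (boxpt m - r) <=
  \sum_(m : {ffun 'I_d -> 'I_(M.*2.*2.+1)}) G (boxpt m).
Proof.
move=> G0 rM.
have /choice[iota iotaE] : forall m : {ffun 'I_d -> 'I_(M.*2.+1)},
    exists m', boxpt m - r = @boxpt M.*2 m'.
  move=> m; apply: boxptP => k; have := boxpt_le m k; have := rM k.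
  have -> : (boxpt m - r) ord0 k = boxpt m ord0 k - r ord0 k by rewrite [LHS]mxE [X in _ + X]mxE.
  by rewrite -addnn; lia.
have inj_iota : injective iota.
  by move=> m m' E; apply/boxpt_inj/(addIr (- r)); rewrite !iotaE E.
under eq_bigr do rewrite iotaE.
rewrite [leRHS](bigID (mem (iota @: [set: {ffun 'I_d -> 'I_(M.*2.+1)}]%SET))) /= big_imset/=; last by move=> x y _ _; exact: inj_iota.
rewrite [X in _ <= X + _](eq_bigl xpredT); last by move=> m; rewrite finset.in_setT.
by rewrite lerDl; apply: sumr_ge0.
Qed.

Lemma cell_index_coarse h delta M x k : 0 < h -> 0 < delta -> delta / h + 1 <= M%:R ->
  `|(cell_index h x - cell_index h (node delta (cell_index delta x)) : Zd) ord0 k| <= M%:Z.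
Proof.
move=> h0 d0 hM; have xy := node_cell_index x k d0; move: (node delta _) xy => y xy.
rewrite -(@ler_int R) intr_norm !mxE intrD mulrNz.
have /andP[x1 x2] := floor_itv (x ord0 k / h + 2^-1).
have /andP[y1 y2] := floor_itv (y ord0 k / h + 2^-1).
move: x2 y2; rewrite !intrD => x2 y2.
have : `|x ord0 k / h - y ord0 k / h| <= delta / h.
  by rewrite -mulrBl normrM (gtr0_norm (x := h^-1)) ?invr_gt0// ler_pM2r ?invr_gt0.
rewrite (_ : M%:Z%:~R = M%:R)// mulr1z in x2 y2 *; move: hM; rewrite !ler_norml; lra.
Qed.

(* Averaging g over a window of lattice points around each coarse node costs at most the
   translation modulus of g, and leaves only boundedly many values on a bounded region. *)
Lemma coarse_approximation (g : Zd -> 'I_q -> R) h delta (C B : R) :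
  0 < h -> h <= delta -> 0 <= C -> (forall j i, `|g j i| <= B) ->
  (forall m, (ldist h (translate m g) g <= (C * (h * \sum_k `|(m ord0 k)%:~R|))%:E)%E) ->
  exists a : Zd -> 'I_q -> R, (forall J i, `|a J i| <= B) /\
    (\int[mu]_x (\sum_(i < q) `|g (cell_index h x) i - a (cell_index delta x) i|)%:E <=
     (2 ^+ d * (C * (d%:R * (6 * delta))))%:E)%E.
Proof.
move=> h0 hd C0 gB gC.
have d0 : 0 < delta by exact: lt_le_trans hd.
(* Large enough to absorb the offset between a fine cell and its coarse node, at most delta / h + 1
   cells, while h M <= 3 delta still holds because h <= delta. *)
pose M := (Num.truncn (delta / h)).+2.
have dh0 : 0 <= delta / h by rewrite divr_ge0 ?ltW.
have M1 : delta / h + 1 <= M%:R.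
  have /andP[_ H] := truncn_itv dh0.
  by rewrite /M -natr1 lerD2r ltW.
have M2 : h * M%:R <= 3 * delta.
  have /andP[H _] := truncn_itv dh0.
  rewrite /M -[_.+2]addn2 natrD mulrDr; move: H; rewrite ler_pdivlMr//; lra.
pose c : R := (#|{ffun 'I_d -> 'I_(M.*2.+1)}|)%:R.
have cE : c = (M.*2.+1)%:R ^+ d by rewrite /c card_ffun !card_ord natrX.
have c0 : 0 < c by rewrite cE exprn_gt0.
pose a J i := c^-1 * \sum_(m : {ffun 'I_d -> 'I_(M.*2.+1)})
   g (cell_index h (node delta J) + boxpt m) i.
exists a; split.
  move=> J i; rewrite /a normrM gtr0_norm ?invr_gt0// ler_pdivrMl//.
  apply: (le_trans (ler_norm_sum _ _ _)); apply: (le_trans (ler_sum _ (fun m _ => gB _ _))).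
  by rewrite sumr_const mulr_natl /c.
pose D m := fun j => \sum_(i < q) `|g (j + m) i - g j i|.
have D0 m j : 0 <= D m j by apply: sumr_ge0.
pose S j := \sum_(m : {ffun 'I_d -> 'I_(M.*2.*2.+1)}) D (boxpt m) j.
have S0 j : 0 <= S j by apply: sumr_ge0.
apply: (@le_trans _ _ (lsum h (fun j => c^-1 * S j))).
  apply: ge0_le_integral => //.
  - by move=> x _; rewrite lee_fin sumr_ge0.
  - apply/measurable_EFinP; apply: measurable_sum => i.
    apply: measurableT_comp => //; apply: measurable_funB.
      exact: (measurable_cell_index (fun j => g j i)).
    exact: (measurable_cell_index (fun j => a j i)).
  - exact: (measurable_lattice (fun j => c^-1 * S j)).
  move=> x _; rewrite lee_fin.
  set j := cell_index h x; set J := cell_index delta x.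
  pose r := j - cell_index h (node delta J).
  have rM k : `|r ord0 k| <= M%:Z by exact: cell_index_coarse.
  (* Seen from j, the window centred at the coarse node is the window shifted by -r, hence contained
     in the doubled one. *)
  apply: (@le_trans _ _ (c^-1 * \sum_(m : {ffun 'I_d -> 'I_(M.*2.+1)}) D (boxpt m - r) j)); last first.
    by rewrite ler_pM2l ?invr_gt0//; apply: (sum_boxpt_le (G := fun m => D m j)).
  rewrite /D exchange_big /= mulr_sumr; apply: ler_sum => i _.
  have {1}-> : g j i = c^-1 * \sum_(m : {ffun 'I_d -> 'I_(M.*2.+1)}) g j i.
    by rewrite sumr_const -mulr_natl -/c mulrA mulVf ?mul1r// gt_eqF.
  rewrite /a -mulrBr normrM gtr0_norm ?invr_gt0// ler_pM2l ?invr_gt0// -sumrB.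
  apply: (le_trans (ler_norm_sum _ _ _)); apply: ler_sum => m _.
  have -> : j + (boxpt m - r) = cell_index h (node delta J) + boxpt m.
    by rewrite /r opprB [boxpt m + _]addrC addrA [j + _]addrC subrK.
  by rewrite distrC.
rewrite lsumZ//; last by rewrite invr_ge0 ltW.
rewrite lsum_sum//.
apply: (@le_trans _ _ (c^-1%:E * \sum_(m : {ffun 'I_d -> 'I_(M.*2.*2.+1)})
   (C * (h * (d%:R * (2 * M%:R))))%:E)%E).
  apply: lee_wpmul2l; first by rewrite lee_fin invr_ge0 ltW.
  apply: lee_sum => m _; apply: (le_trans (gC _)); rewrite lee_fin.
  apply: ler_wpM2l => //; apply: ler_wpM2l; first exact: ltW.
  apply: (@le_trans _ _ (\sum_(k < d) (2 * M%:R))).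
    apply: ler_sum => k _; have := boxpt_le m k.
    move: (boxpt m ord0 k) => z.
    by rewrite -(@ler_int R) intr_norm -pmulrn -mul2n natrM.
  by rewrite sumr_const card_ord [leRHS]mulr_natl.
rewrite sumEFin sumr_const card_ffun !card_ord -EFinM lee_fin.
rewrite -[X in _ * X <= _]mulr_natl natrX [leLHS]mulrA.
(* The cardinals give ((4M + 1) / (2M + 1))^d <= 2^d; a shift has l^1 length at most 2 d M, which
   times h is at most 6 d delta. *)
apply: ler_pM.
- by apply: mulr_ge0; [rewrite invr_ge0 ltW|rewrite exprn_ge0].
- by apply: mulr_ge0 => //; apply: mulr_ge0; [exact: ltW|rewrite !mulr_ge0].
- rewrite ler_pdivrMl// cE -exprMn; apply: lerXn2r; rewrite ?nnegrE ?mulr_ge0//.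
  by rewrite -natrM ler_nat muln2 doubleS -!addnn; lia.
- rewrite ler_wpM2l// [h * _]mulrCA ler_wpM2l// mulrCA; lra.
Qed.

End coarse_graining.

(** * The L^1 distance between families of functions *)

Section L1_families.
Context d (T : measurableType d) {R : realType} {q : nat}.
Variable mu : {measure set T -> \bar R}.
Implicit Types f g : T -> 'I_q -> R.

Definition L1dist f g : \bar R := (\int[mu]_x (\sum_(i < q) `|f x i - g x i|)%:E)%E.

Definition measurable_family f := forall i, measurable_fun setT (fun x => f x i).

Lemma measurable_L1dist f g : measurable_family f -> measurable_family g ->
  measurable_fun setT (fun x => (\sum_(i < q) `|f x i - g x i|)%:E).
Proof.
move=> mf mg; apply/measurable_EFinP; apply: measurable_sum => i.
by apply: measurableT_comp => //; exact: measurable_funB.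
Qed.

Lemma L1dist_ge0 f g : (0 <= L1dist f g)%E.
Proof. by apply: integral_ge0 => x _; rewrite lee_fin sumr_ge0. Qed.

Lemma L1distC f g : L1dist f g = L1dist g f.
Proof.
by apply: eq_integral => x _; congr EFin; apply: eq_bigr => i _; rewrite distrC.
Qed.

Lemma L1dist_triangle g f h : measurable_family f -> measurable_family g ->
  measurable_family h -> (L1dist f h <= L1dist f g + L1dist g h)%E.
Proof.
move=> mf mg mh; rewrite /L1dist -ge0_integralD//; do ?exact: measurable_L1dist;
  do ?by move=> x _; rewrite lee_fin sumr_ge0.
apply: ge0_le_integral => //; do ?by move=> x _; rewrite lee_fin sumr_ge0.
- exact: measurable_L1dist.
- by apply: emeasurable_funD; exact: measurable_L1dist.
move=> x _; rewrite -EFinD lee_fin -big_split; apply: ler_sum => i _; exact: ler_distD.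
Qed.

Lemma le_L1dist f g f' g' : measurable_family f -> measurable_family g ->
  measurable_family f' -> measurable_family g' ->
  (forall x, \sum_(i < q) `|f x i - g x i| <= \sum_(i < q) `|f' x i - g' x i|) ->
  (L1dist f g <= L1dist f' g')%E.
Proof.
move=> mf mg mf' mg' H; apply: ge0_le_integral => //.
- by move=> x _; rewrite lee_fin sumr_ge0.
- exact: measurable_L1dist.
- exact: measurable_L1dist.
- by move=> x _; rewrite lee_fin.
Qed.

Lemma L1dist_eq0 f g : measurable_family f -> measurable_family g ->
  L1dist f g = 0%E -> {ae mu, forall x, f x = g x}.
Proof.
move=> mf mg; rewrite /L1dist => fg.
have mfg := measurable_L1dist mf mg.
have : (\int[mu]_x `|(\sum_(i < q) `|f x i - g x i|)%:E|)%E = 0%E.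
  by rewrite -fg; apply: eq_integral => x _; rewrite gee0_abs// lee_fin sumr_ge0.
move=> /(ae_eq_integral_abs _ measurableT mfg); apply: filterS => x /(_ I) [E].
apply/funext => i; apply/eqP; rewrite -subr_eq0 -normr_le0 -E (bigD1 i)//= lerDl.
exact: sumr_ge0.
Qed.

End L1_families.

(** * Uniform estimates and total boundedness of the scheme *)

Section compactness.
Context {R : realType} {d q : nat}.
Local Notation mu := (lebesgue_rV R d).
Local Notation Zd := 'rV[int]_d.
Implicit Types (h delta : R) (j m : Zd).
Variables (Rx : ('I_q -> R) -> 'I_q -> R) (e : 'I_q -> Zd).
Variables (feq : R -> 'I_q -> R) (U : R) (K : set ('I_q -> R)).
Hypothesis U0 : 0 <= U.
Hypothesis K_step : forall g, (forall j, K (g j)) -> forall j, K (step Rx e g j).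
Hypothesis Rx_contraction : forall f f', K f -> K f' ->
  \sum_(i < q) `|Rx f i - Rx f' i| <= \sum_(i < q) `|f i - f' i|.
Hypothesis K_feq : forall w, - U <= w <= U -> K (feq w).
Hypothesis feq_dist : forall a b, - U <= a <= U -> - U <= b <= U ->
  \sum_(i < q) `|feq a i - feq b i| = `|a - b|.
Hypothesis feq0 : feq 0 = fun=> 0.
Hypothesis Rx_feq : forall w, Rx (feq w) = feq w.
Hypothesis K_bound : forall f i, K f -> `|f i| <= U.

Variable u0 : 'rV[R]_d -> R.
Hypothesis iu0 : mu.-integrable setT (EFin \o u0).
Hypothesis u0U : {ae mu, forall x, `|u0 x| <= U}.

Definition init h : Zd -> 'I_q -> R := fun j => feq (cell_average h u0 j).

Local Notation evolve := (evolve Rx e).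
Local Notation step := (step Rx e).
Let S : R := \sum_(i < q) \sum_k `|(e i ord0 k)%:~R|.

Let S0 : 0 <= S.
Proof. by apply: sumr_ge0 => i _; apply: sumr_ge0. Qed.

Let e_le_S i : \sum_k `|(e i ord0 k)%:~R : R| <= S.
Proof.
by rewrite /S [leRHS](bigD1 i)//= lerDl; apply: sumr_ge0 => l _; apply: sumr_ge0.
Qed.

Lemma cell_average_bound h j : 0 < h -> - U <= cell_average h u0 j <= U.
Proof.
move=> h0; rewrite -ler_norml.
have hd0 : 0 < h ^+ d by rewrite exprn_gt0.
rewrite -(ler_pM2l hd0) -lee_fin -[X in `|X|]subr0.
apply: (le_trans (cell_average_sub j 0 h0 iu0)).
have mu0 : measurable_fun setT u0 by apply/measurable_EFinP; exact: measurable_int iu0.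
have mH := measurable_hcell h j.
apply: (@le_trans _ _ (\int[mu]_(x in hcell h j) (cst U%:E) x)%E).
  apply: ae_ge0_le_integral => //.
  - by apply: measurable_funTS; apply: measurable_dist.
  - by apply: filterS u0U => x xU _; rewrite subr0 lee_fin.
apply: (@le_trans _ _ (U%:E * mu (hcell h j))%E); last by rewrite mu_hcell// -EFinM mulrC.
by rewrite le_eqVlt; apply/orP; left; apply/eqP; exact: integral_cst.
Qed.

Lemma K_init h j : 0 < h -> K (init h j).
Proof. by move=> h0; apply: K_feq; exact: cell_average_bound. Qed.

(** The source of all uniform estimates: C, X and h0 depend neither on h nor on n. The state g is
    the equilibrium at the nodal values of a Lipschitz approximation of [u0], so its initial moduli
    are O(h). *)
Lemma scheme_approximation eps : 0 < eps -> exists C X h0 : R,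
  [/\ 0 <= C, 0 <= X, 0 < h0 & forall h, 0 < h -> h <= h0 ->
  exists g : Zd -> 'I_q -> R, [/\ forall j, K (g j),
    forall n, (ldist h (evolve n (init h)) (evolve n g) <= eps%:E)%E,
    forall n m, (ldist h (translate m (evolve n g)) (evolve n g) <=
      (C * (h * \sum_k `|(m ord0 k)%:~R|))%:E)%E,
    forall n k, (ldist h (evolve (n + k) g) (evolve n g) <= (k%:R * (C * h))%:E)%E &
    forall n j k, X + n%:R * S * h < `|(j ord0 k)%:~R * h| -> evolve n g j = fun=> 0]].
Proof.
move=> eps0; have e20 : 0 < eps / 2 by rewrite divr_gt0.
have [v [Lam [X [L0 X0 vl vU uv]]]] := lip_approx_bounded U0 iu0 u0U e20.
pose V := (2 * (X + 1)) ^+ d.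
have V0 : 0 <= V by rewrite exprn_ge0// mulr_ge0// addr_ge0.
(* For h <= 1, h A bounds the error between cell averages and nodal values of v; the summand 1 makes
   A positive, so that h0 can be defined by division. *)
pose A := Lam * d%:R * V + 1.
have A0 : 0 < A by rewrite ltr_wpDl// mulr_ge0// mulr_ge0.
pose C1 := 2 * Lam * V.
have C10 : 0 <= C1 by rewrite mulr_ge0// mulr_ge0.
(* C1 controls the translations, and C1 S controls one time step, in which population i moves by
   [e i]. *)
exists (C1 * (1 + S)), X, (Num.min 1 (eps / 2 / A)); split => //.
- by rewrite mulr_ge0// addr_ge0.
- by rewrite lt_min ltr01 divr_gt0.
move=> h h0; rewrite le_min => /andP[h1 hA].
have VX : (2 * (X + h)) ^+ d <= V.
  by apply: lerXn2r; rewrite ?nnegrE ?mulr_ge0 ?addr_ge0 ?(ltW h0)// ler_pM2l// lerD2l.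
have K_g j : K (feq (v (node h j))) by exact: K_feq.
have vshift m : (lsum h (fun j => `|v (node h (j + m)%R) - v (node h j)|%R) <=
    (C1 * (h * \sum_k `|(m ord0 k)%:~R|))%:E)%E.
  apply: (le_trans (lipc_node_shift m h0 L0 X0 vl)); rewrite lee_fin.
  apply: ler_wpM2r; first by rewrite mulr_ge0 ?(ltW h0)// sumr_ge0.
  by apply: ler_wpM2l => //; rewrite mulr_ge0.
exists (fun j => feq (v (node h j))); split => //.
- move=> n; apply: (@le_trans _ _ (ldist h (init h) (fun j => feq (v (node h j))))).
    by apply: (ldist_evolve K_step Rx_contraction) => // j; exact: K_init.
  rewrite /ldist (_ : (fun j => _) = (fun j => `|cell_average h u0 j - v (node h j)|)); last first.
    by apply/funext => j; rewrite feq_dist//; exact: cell_average_bound.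
  apply: (le_trans (lsum_average_node h0 L0 X0 vl iu0)).
  rewrite [eps]splitr EFinD; apply: leeD => //; rewrite lee_fin.
  apply: (@le_trans _ _ (h * A)); last by rewrite -ler_pdivlMr.
  rewrite mulrA mulrC mulrA mulrC ler_wpM2l ?(ltW h0)// /A.
  apply: (@le_trans _ _ (Lam * d%:R * V)); last by rewrite lerDl.
  by rewrite mulrC; apply: ler_wpM2l => //; rewrite mulr_ge0.
- move=> n m.
  apply: (le_trans (ldist_evolve_shift K_step Rx_contraction n m h0 K_g)).
  rewrite /ldist /translate (_ : (fun j => _) = (fun j => `|v (node h (j + m)) - v (node h j)|)); last first.
    by apply/funext => j; rewrite feq_dist.
  apply: (le_trans (vshift m)); rewrite lee_fin ler_wpM2r//.
    by rewrite mulr_ge0 ?(ltW h0)// sumr_ge0.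
  by rewrite -[leLHS]mulr1 ler_wpM2l// lerDl.
- move=> n k.
  apply: (le_trans (ldist_evolve_time K_step Rx_contraction n k h0 K_g)).
  rewrite EFinM; apply: lee_wpmul2l => //.
  rewrite /ldist lsum_sum//.
  apply: (@le_trans _ _ (\sum_(i < q) (C1 * (h * \sum_k `|(e i ord0 k)%:~R|))%:E)%E).
    apply: lee_sum => i _.
    have := vshift (- e i); under eq_bigr do rewrite mxE mulrNz normrN.
    apply: le_trans; apply: le_lsum => // j.
    (* The data are at equilibrium, so relaxation leaves them unchanged and the first step is pure
       transport. *)
    rewrite /step Rx_feq -(feq_dist (vU _) (vU _)) [leRHS](bigD1 i)//= lerDl.
    exact: sumr_ge0.
  rewrite sumEFin lee_fin -!mulr_sumr -/S -mulrA ler_wpM2l// mulrC ler_wpM2r ?(ltW h0)//.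
  by rewrite lerDr.
- move=> n j k jX; apply: (evolve_support h0 _ _ _ jX).
  + by rewrite -feq0 Rx_feq.
  + move=> i {jX}k; apply: le_trans (e_le_S i); rewrite (bigD1 k)//= lerDl.
    exact: sumr_ge0.
  + move=> {jX}j {}k jk; rewrite vl.2 ?feq0//.
    by apply/negP => /forallP/(_ k); rewrite mxE leNgt jk.
Qed.

Lemma relaxed_defect eps : 0 < eps -> exists2 h0 : R, 0 < h0 &
  forall h n, 0 < h -> h <= h0 ->
  (ldist h (fun j => Rx (evolve n (init h) j)) (evolve n (init h)) <= eps%:E)%E.
Proof.
move=> eps0.
(* Each of the q translations and the single time step costs 4 e1: 2 e1 for replacing the data by g
   and coming back, 2 e1 for the moduli of g. *)
pose e1 := eps / (q%:R + 1) / 4.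
have q1 : 0 < q%:R + 1 :> R by rewrite ltr_wpDl.
have e10 : 0 < e1 by rewrite !divr_gt0.
have [C [X [h0 [C0 X0 h00 H]]]] := scheme_approximation e10.
pose A := C * (S + 1) + 1.
have A0 : 0 < A by rewrite ltr_wpDl// mulr_ge0// addr_ge0.
exists (Num.min h0 (2 * e1 / A)); first by rewrite lt_min h00 divr_gt0// mulr_gt0.
move=> h n hp; rewrite le_min => /andP[hh0 hA].
have [g [Kg Fg gshift gtime _]] := H h hp hh0.
have Ki j : K (init h j) by exact: K_init.
have Ch : C * h * (S + 1) <= 2 * e1.
  apply: (@le_trans _ _ (h * A)); last by rewrite -ler_pdivlMr.
  by rewrite -mulrA mulrCA ler_wpM2l ?(ltW hp)// /A lerDl.
have D1 m : \sum_k `|(m ord0 k)%:~R : R| <= S -> (ldist h (translate m (init h)) (init h) <= (4 * e1)%:E)%E.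
  move=> mS.
  apply: (le_trans (ldist_triangle (translate m g) _ _ hp)).
  rewrite ldist_shift//; apply: (le_trans (leeD (Fg 0%N) (ldist_triangle g _ _ hp))).
  rewrite [ldist h g (init h)]ldistC.
  apply: (le_trans (leeD (lexx _) (leeD (gshift 0%N m) (Fg 0%N)))).
  rewrite -!EFinD lee_fin.
  have : C * (h * \sum_k `|(m ord0 k)%:~R|) <= C * h * (S + 1).
    rewrite mulrA ler_wpM2l ?mulr_ge0 ?(ltW hp)//.
    by apply: (le_trans mS); rewrite lerDl.
  by lra.
apply: (le_trans (ldist_relaxed K_step Rx_contraction n hp Ki)).
have D2 : (ldist h (step (init h)) (init h) <= (4 * e1)%:E)%E.
  apply: (le_trans (ldist_triangle (step g) _ _ hp)).
  apply: (le_trans (leeD (ldist_step e Rx_contraction hp Ki Kg) (ldist_triangle g (step g) (init h) hp))).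
  rewrite [ldist h g (init h)]ldistC.
  have g1 := gtime 0%N 1%N.
  apply: (le_trans (leeD (Fg 0%N) (leeD g1 (Fg 0%N)))).
  rewrite -!EFinD lee_fin mul1r.
  have : C * h <= C * h * (S + 1) by rewrite ler_peMr ?mulr_ge0 ?(ltW hp)// lerDr.
  by lra.
apply: (@le_trans _ _ (\sum_(i < q) (4 * e1)%:E + (4 * e1)%:E)%E).
  apply: leeD => //; apply: lee_sum => i _; apply: D1.
  by under eq_bigr do rewrite mxE mulrNz normrN; exact: e_le_S.
rewrite sumEFin sumr_const card_ord -EFinD lee_fin.
rewrite (_ : _ + _ = (q%:R + 1) * (4 * e1)); last by rewrite -mulr_natl; ring.
by rewrite /e1 [4 * _]mulrC divfK// mulrC divfK// gt_eqF.
Qed.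

Variables (lam : R) (dx : nat -> R).
Hypothesis lam0 : 0 < lam.
Hypothesis dx0 : forall p, 0 < dx p.
Hypothesis dx_cvg : dx @ \oo --> 0.

Definition scheme h (t : R) (x : 'rV[R]_d) : 'I_q -> R :=
  evolve (time_index (h / lam) t) (init h) (cell_index h x).

Lemma measurable_lattice_family h (g : Zd -> 'I_q -> R) : 0 < h ->
  measurable_family (fun x : 'rV[R]_d => g (cell_index h x)).
Proof. by move=> h0 i; exact: (measurable_cell_index (fun j => g j i)). Qed.

Lemma dx_small h0 : 0 < h0 -> exists P, forall p, (P <= p)%N -> dx p <= h0.
Proof.
move=> h00; have /cvgrPdist_le/(_ _ h00)[P _ HP] := dx_cvg.
exists P => p Pp; have := HP p Pp; rewrite /= sub0r normrN; apply: le_trans.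
exact: ler_norm.
Qed.

Lemma time_index_le h t : 0 < h -> 0 <= t -> (time_index (h / lam) t)%:R * h <= lam * t.
Proof.
move=> h0 t0; have : 0 <= t / (h / lam) by rewrite divr_ge0// divr_ge0// ltW.
move=> /truncn_itv/andP[+ _]; rewrite -/(time_index _ _) invf_div mulrA.
by rewrite ler_pdivlMr// [t * lam]mulrC.
Qed.

Lemma time_index_gap h t t' : 0 < h -> 0 <= t -> t <= t' ->
  exists k, time_index (h / lam) t' = (time_index (h / lam) t + k)%N /\
    k%:R * h <= lam * (t' - t) + h.
Proof.
move=> h0 t0 tt'; have t'0 : 0 <= t' by exact: le_trans tt'.
have hl0 : 0 < h / lam by rewrite divr_gt0.
have le_n : (time_index (h / lam) t <= time_index (h / lam) t')%N.
  by apply: le_truncn; rewrite ler_pM2r ?invr_gt0.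
exists (time_index (h / lam) t' - time_index (h / lam) t)%N; rewrite subnKC//; split => //.
rewrite natrB// mulrBl; have := time_index_le h0 t'0.
have : 0 <= t / (h / lam) by rewrite divr_ge0// ltW.
move=> /truncn_itv/andP[_]; rewrite -/(time_index _ _) invf_div mulrA.
rewrite ltr_pdivrMr// -natr1 mulrDl mul1r [t * lam]mulrC; lra.
Qed.

(* The colour of p records the quantized values, at finitely many coarse nodes and times,
   of a coarse approximation of the scheme: there are finitely many colours, and equal
   colours force the L^1 distance to be small uniformly in time. *)
Lemma total_boundedness T eps : 0 < T -> 0 < eps ->
  exists (Col : finType) (col : nat -> Col) (P : nat), forall p p',
    (P <= p)%N -> (P <= p')%N -> col p = col p' -> forall t, 0 <= t <= T ->
    (L1dist mu (scheme (dx p) t) (scheme (dx p') t) <= eps%:E)%E.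
Proof.
move=> T0 eps0.
(* Nine sixteenths of eps are spent: three for each of the two passages to the approximate solution
   at the recorded time below t, and three for comparing the two approximate solutions there. *)
have e80 : 0 < eps / 16 by rewrite divr_gt0.
have [C [X [h0 [C0 X0 h00 H]]]] := scheme_approximation e80.
(* Radius that contains the supports up to time T: the initial radius, propagation at speed lam S,
   and 1 for the width of a cell. *)
pose Y := X + lam * T * S + 1.
have Y0 : 0 <= Y by rewrite !addr_ge0// !mulr_ge0// ltW.
pose tau := eps / 16 / (C * lam + 1).
have Cl0 : 0 < C * lam + 1 by rewrite ltr_wpDl// mulr_ge0// ltW.
have tau0 : 0 < tau by rewrite divr_gt0.
pose B := 2 ^+ d * (C * (d%:R * 6)) + 1 : R.
have B0 : 0 < B by rewrite ltr_wpDl// !mulr_ge0// exprn_ge0.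
pose delta := eps / 16 / B.
have d0 : 0 < delta by rewrite divr_gt0.
pose V := q%:R * (2 * Y) ^+ d + 1.
have V0 : 0 < V by rewrite ltr_wpDl// mulr_ge0// exprn_ge0// mulr_ge0.
pose eta := eps / 16 / V.
have eta0 : 0 < eta by rewrite divr_gt0.
pose hmax := Num.min (Num.min h0 1) (Num.min delta (eps / 16 / (C + 1))).
have C10 : 0 < C + 1 by rewrite ltr_wpDl.
have hmax0 : 0 < hmax by rewrite !lt_min h00 ltr01 d0 divr_gt0.
have [P HP] := dx_small hmax0.
have small p : (P <= p)%N -> [/\ dx p <= h0, dx p <= 1, dx p <= delta & C * dx p <= eps / 16].
  move=> /HP; rewrite /hmax !le_min => /andP[/andP[-> ->] /andP[-> H4]]; split => //.
  apply: (@le_trans _ _ (dx p * (C + 1))); last by rewrite -ler_pdivlMr.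
  by rewrite mulrC ler_wpM2l ?(ltW (dx0 _))// lerDl.
pose A := Num.truncn (T / tau).
pose n p (a : nat) := time_index (dx p / lam) (a%:R * tau).
(* Below P the implication is void and zero functions serve as default values, so that [choice]
   yields functions of all p. *)
have coarse p : exists ga : (Zd -> 'I_q -> R) * (nat -> Zd -> 'I_q -> R), (P <= p)%N ->
  [/\ forall n, (ldist (dx p) (evolve n (init (dx p))) (evolve n ga.1) <= (eps / 16)%:E)%E,
    forall n k, (ldist (dx p) (evolve (n + k) ga.1) (evolve n ga.1) <= (k%:R * (C * dx p))%:E)%E,
    forall n j k, X + n%:R * S * dx p < `|(j ord0 k)%:~R * dx p| -> evolve n ga.1 j = fun=> 0,
    forall a J i, `|ga.2 a J i| <= U &
    forall a, (L1dist mu (fun x => evolve (n p a) ga.1 (cell_index (dx p) x))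
                (fun x => ga.2 a (cell_index delta x)) <= (eps / 16)%:E)%E].
  have [Pp|nPp] := boolP (P <= p)%N; last by exists ((fun _ _ => 0), (fun _ _ _ => 0)).
  have [p1 p2 p3 p4] := small p Pp.
  have [g [Kg g1 g2 g3 g4]] := H _ (dx0 p) p1.
  have /choice[al Hal] : forall a, exists al : Zd -> 'I_q -> R, (forall J i, `|al J i| <= U) /\
    (L1dist mu (fun x => evolve (n p a) g (cell_index (dx p) x))
                (fun x => al (cell_index delta x)) <= (eps / 16)%:E)%E.
    move=> a; have [||al [al1 al2]] := @coarse_approximation R d q (evolve (n p a) g) (dx p) delta C U (dx0 p) p3 C0.
    - by move=> j i; apply: K_bound; apply: (evolve_box K_step).
    - by move=> m; exact: g2.
    exists al; split => //; apply: (le_trans al2); rewrite lee_fin.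
    apply: (@le_trans _ _ (B * delta)); last by rewrite /delta mulrC divfK// gt_eqF.
    by rewrite /B; have : 0 <= delta by [exact: ltW]; lra.
  by exists (g, al) => _; split => // a; case: (Hal a).
have {coarse}[ga Hga] := choice coarse.
(* If a coarse cell meets the box of radius Y, its index has entries at most Y / delta + 1, hence at
   most Bn. *)
pose Bn := (Num.truncn (Y / delta)).+2.
pose I : finType := ('I_A.+1 * {ffun 'I_d -> 'I_(Bn.*2.+1)} * 'I_q)%type.
have [Col [col Hcol]] := @quantization R I
  (fun p i => (ga p).2 (i.1.1 : nat) (boxpt i.1.2) i.2) U eta P eta0
  (fun p i Pp => (let: And5 _ _ _ H _ := Hga p Pp in H) _ _ _).
exists Col, col, P => p p' Pp Pp' cpp' t /andP[t0 tT].
have mlat r (g : Zd -> 'I_q -> R) : measurable_family (fun x : 'rV[R]_d => g (cell_index (dx r) x)).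
  exact: measurable_lattice_family.
have ttau0 : 0 <= t / tau by rewrite divr_ge0// ltW.
pose a := Num.truncn (t / tau).
have /andP[a1 a2] := truncn_itv ttau0; rewrite -/a in a1 a2.
have aA : (a < A.+1)%N by rewrite ltnS /a /A; apply: le_truncn; rewrite ler_pM2r ?invr_gt0.
have at0 : 0 <= a%:R * tau by rewrite mulr_ge0// ltW.
have at1 : a%:R * tau <= t by rewrite -ler_pdivlMr.
have at2 : t - a%:R * tau <= tau.
  by move: a2; rewrite ltr_pdivrMr// -natr1 mulrDl mul1r; lra.
have close r : (P <= r)%N ->
    (L1dist mu (scheme (dx r) t) (fun x => (evolve (n r a) (ga r).1) (cell_index (dx r) x)) <= (3 * (eps / 16))%:E)%E.
  move=> Pr; have [r1 r2 r3 r4] := small r Pr.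
  have [g1 g2 _ _ _] := Hga r Pr.
  apply: (le_trans (ldist_triangle (evolve (time_index (dx r / lam) t) (ga r).1) _ _ (dx0 r))).
  have [k [kE kh]] := time_index_gap (dx0 r) at0 at1.
  have G2 := g2 (n r a) k.
  rewrite [(3 * _)%:E](_ : _ = (eps / 16)%:E + (2 * (eps / 16))%:E)%E; last by rewrite -EFinD; congr EFin; lra.
  apply: leeD => //; rewrite kE; apply: (le_trans G2); rewrite lee_fin.
  rewrite mulrCA.
  apply: (@le_trans _ _ (C * (lam * tau + dx r))).
    apply: ler_wpM2l => //; apply: (le_trans kh); rewrite lerD2r.
    by apply: ler_wpM2l => //; exact: ltW.
  rewrite mulrDr.
  have : (C * lam + 1) * tau = eps / 16 by rewrite /tau mulrC divfK// gt_eqF.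
  lra.
have supp r x i : (P <= r)%N -> ~~ inbox Y x -> (evolve (n r a) (ga r).1) (cell_index (dx r) x) i = 0.
  move=> Pr xY; have [r1 r2 r3 r4] := small r Pr; have [_ _ g3 _ _] := Hga r Pr.
  have /forallPn[k] : ~~ inbox (Y - 1) (node (dx r) (cell_index (dx r) x)).
    apply: contra xY => /(inbox_node (dx0 r)); apply: inbox_le; lra.
  rewrite -ltNge mxE => xk; rewrite (g3 _ _ k)//; apply: le_lt_trans xk.
  rewrite /Y addrK lerD2l -mulrA [S * _]mulrC mulrA ler_wpM2r//.
  apply: (le_trans (time_index_le (dx0 r) at0)); apply: ler_wpM2l; first exact: ltW.
  exact: le_trans tT.
pose E r := fun x : 'rV[R]_d => \sum_(i < q)
  `|evolve (n r a) (ga r).1 (cell_index (dx r) x) i - (ga r).2 a (cell_index delta x) i|.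
have E0 r x : 0 <= E r x by exact: sumr_ge0.
have mE r : measurable_fun setT (fun x => (E r x)%:E).
  by apply: measurable_L1dist; [exact: mlat|exact: measurable_lattice_family].
have mid : (L1dist mu (fun x => (evolve (n p a) (ga p).1) (cell_index (dx p) x))
    (fun x => (evolve (n p' a) (ga p').1) (cell_index (dx p') x)) <= (3 * (eps / 16))%:E)%E.
  apply: (@le_trans _ _ (\int[mu]_x ((E p x)%:E + (E p' x)%:E + (q%:R * eta * (inbox Y x)%:R)%:E))%E).
    apply: ge0_le_integral => //.
    - by move=> x _; rewrite lee_fin sumr_ge0.
    - exact: measurable_L1dist.
    - by apply: emeasurable_funD; [exact: emeasurable_funD|exact: measurable_inboxR].
    move=> x _; rewrite -!EFinD lee_fin.
    have [xY|xY] := boolP (inbox Y x); last first.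
      rewrite big1 ?mulr0 ?addr0 ?addr_ge0// => i _.
      by rewrite !supp// subrr normr0.
    have [m mE'] : exists m : {ffun 'I_d -> 'I_(Bn.*2.+1)}, cell_index delta x = boxpt m.
      apply: boxptP => k; have /forallP/(_ k) := inbox_node' d0 xY.
      rewrite mxE normrM (gtr0_norm d0) -ler_pdivlMr// mulrDl divff ?gt_eqF//.
      move=> xk; rewrite -(@ler_int R) intr_norm; apply: (le_trans xk).
      have Yd : 0 <= Y / delta by rewrite divr_ge0// ltW.
      have /andP[_] := truncn_itv Yd; rewrite (_ : Bn%:Z%:~R = Bn%:R)// /Bn -[_.+2%:R]natr1; lra.
    rewrite mulr1 mulr_natl -[X in _ *+ X](card_ord q) -sumr_const -!big_split /=.
    apply: ler_sum => i _.
    have := Hcol p p' Pp Pp' cpp' (Ordinal aA, m, i); rewrite /= -mE'.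
    set u := evolve _ _ _ i; set v := evolve _ _ _ i; set y := (ga p).2 _ _ _; set z := (ga p').2 _ _ _.
    rewrite [`|v - z|]distrC => yz.
    have -> : u - v = (u - y) + (z - v) + (y - z) by ring.
    apply: (le_trans (ler_normD _ _)); apply: lerD => //; exact: ler_normD.
  rewrite ge0_integralD//; last 4 first.
  - by move=> x _; rewrite -EFinD lee_fin addr_ge0.
  - exact: emeasurable_funD.
  - move=> x _; rewrite lee_fin; apply: mulr_ge0 => //; apply: mulr_ge0 => //.
    exact: ltW.
  - exact: measurable_inboxR.
  rewrite ge0_integralD//; do ?by move=> x _; rewrite lee_fin.
  rewrite integral_inbox//.
  have [_ _ _ _ G] := Hga p Pp; have [_ _ _ _ G'] := Hga p' Pp'.
  apply: (@le_trans _ _ ((eps / 16)%:E + (eps / 16)%:E + (eps / 16)%:E)%E).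
    apply: leeD; first by apply: leeD; [exact: G|exact: G'].
    rewrite lee_fin; have : V * eta = eps / 16 by rewrite /eta mulrC divfK// gt_eqF.
    by rewrite /V; lra.
  by rewrite -!EFinD lee_fin; lra.
have ms r : measurable_family (scheme (dx r) t) by exact: measurable_lattice_family.
pose G r := evolve (n r a) (ga r).1.
apply: (le_trans (L1dist_triangle mu (ms p) (mlat p (G p)) (ms p'))).
apply: (le_trans (leeD (close p Pp)
  (L1dist_triangle mu (mlat p (G p)) (mlat p' (G p')) (ms p')))).
rewrite [X in (_ + (_ + X) <= _)%E]L1distC.
apply: (le_trans (leeD (lexx _) (leeD mid (close p' Pp')))).
by rewrite -!EFinD lee_fin; lra.
Qed.

End compactness.

(** * Upper limits of real sequences and telescoping bounds *)

Section upper_limits.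
Context {R : realType}.

Lemma limn_sup_bounds (u : nat -> R) (a b A B : R) (k : nat) :
  (forall n, A <= u n <= B) -> (forall n, (k <= n)%N -> a <= u n <= b) ->
  a <= limn_sup u <= b.
Proof.
move=> uAB uab.
have ub : has_ubound (range u) by exists B => _ [n _ <-]; case/andP: (uAB n).
have lb : has_lbound (range u) by exists A => _ [n _ <-]; case/andP: (uAB n).
have cu : cvgn (sups u) by apply/cvg_ex; eexists; exact: cvg_sups_inf.
have ubn n : has_ubound (sdrop u n) by exact: has_ubound_sdrop.
apply/andP; split.
  apply: limr_ge => //; near=> n.
  have kn : (k <= n)%N by near: n; exact: nbhs_infty_ge.
  apply: (@le_trans _ _ (u n)); first by case/andP: (uab n kn).
  by apply: ub_le_sup => //; exists n => /=.
apply: limr_le => //; near=> n.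
have kn : (k <= n)%N by near: n; exact: nbhs_infty_ge.
apply: ge_sup; first by exists (u n), n => /=.
by move=> _ [m /= nm <-]; case/andP: (uab m (leq_trans kn nm)).
Unshelve. all: by end_near. Qed.

(** Telescoping confines the terms from rank k on to a ball around [u k] whose radius is the series,
    and the upper limit stays in it; if the series is infinite there is nothing to prove. *)
Lemma dist_limn_sup_le (u : nat -> R) (A B : R) (k : nat) : (forall n, A <= u n <= B) ->
  (`|u k - limn_sup u|%:E <= \sum_(r <oo) `|u (k + r).+1 - u (k + r)%N|%:E)%E.
Proof.
move=> uAB.
have s_ge0 r : (0 <= `|u (k + r).+1 - u (k + r)%N|%:E)%E by rewrite lee_fin.
set S := (\sum_(_ <oo) _)%E.
have S0 : (0 <= S)%E by exact: nneseries_ge0.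
case SE : S S0 => [s| |]// _; last by rewrite leey.
have us n : `|u (k + n)%N - u k| <= s.
  rewrite -lee_fin -SE.
  apply: (@le_trans _ _ (\sum_(0 <= r < n) `|u (k + r).+1 - u (k + r)%N|%:E)%E).
    rewrite sumEFin lee_fin.
    elim: n => [|n IH]; first by rewrite addn0 subrr normr0 big_geq.
    rewrite big_nat_recr//= addnS.
    by apply: (le_trans (ler_distD (u (k + n)%N) _ _)); rewrite addrC lerD.
  by apply: nneseries_lim_ge => r _ _.
have : u k - s <= limn_sup u <= u k + s.
  apply: (limn_sup_bounds (k := k) uAB) => n kn.
  have := us (n - k)%N; rewrite subnKC// ler_norml; lra.
by rewrite lee_fin ler_norml; lra.
Qed.

Lemma nneseries_geometric_le (k : nat) :
  (\sum_(r <oo) ((2^-1 : R) ^+ (k + r))%:E <= (2 * 2^-1 ^+ k)%:E)%E.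
Proof.
apply: lime_le; first by apply: is_cvg_nneseries => r _ _; rewrite lee_fin exprn_ge0.
apply: nearW => n; rewrite sumEFin lee_fin.
have -> : \sum_(0 <= i < n) 2^-1 ^+ (k + i) = 2 * 2^-1 ^+ k - 2 * 2^-1 ^+ (k + n) :> R.
  elim: n => [|n IH]; first by rewrite big_geq// addn0 subrr.
  rewrite big_nat_recr//= IH addnS exprS; lra.
by rewrite gerBl mulr_ge0// exprn_ge0.
Qed.

End upper_limits.

(** * The limit of a sequence that is Cauchy in L^1 with geometric rate *)

Section L1_limit.
Context {R : realType} {d q : nat}.
Local Notation mu := (lebesgue_rV R d).
Variable F : nat -> R -> 'rV[R]_d -> 'I_q -> R.
Variables lo hi : 'I_q -> R.
Hypothesis F_box : forall p t x i, lo i <= F p t x i <= hi i.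
Hypothesis mF : forall p i,
  measurable_fun setT (fun z : measurableTypeR R * 'rV[R]_d => F p z.1 z.2 i).
Hypothesis F_cauchy : forall k m n, (k <= m)%N -> (k <= n)%N -> forall t, 0 <= t <= k.+1%:R ->
  (L1dist mu (F m t) (F n t) <= (2^-1 ^+ k)%:E)%E.

(* The pointwise upper limit, rather than a limit in each L^1 space, makes the limit jointly
   measurable in (t, x) without choosing representatives. *)
Definition upper_limit t x i := limn_sup (fun p => F p t x i).

Lemma upper_limit_box t x i : lo i <= upper_limit t x i <= hi i.
Proof. by apply: (limn_sup_bounds (k := 0)) => n; [exact: F_box|move=> _; exact: F_box]. Qed.

Lemma measurable_upper_limit i :
  measurable_fun setT (fun z : measurableTypeR R * 'rV[R]_d => upper_limit z.1 z.2 i).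
Proof.
apply: (measurable_fun_limn_sup (h := fun p z => F p z.1 z.2 i)) => //.
- by move=> z _; exists (hi i) => _ [n _ <-]; case/andP: (F_box n z.1 z.2 i).
- by move=> z _; exists (lo i) => _ [n _ <-]; case/andP: (F_box n z.1 z.2 i).
- by move=> n; exact: mF.
Qed.

Lemma measurable_slice (G : R -> 'rV[R]_d -> R) t :
  measurable_fun setT (fun z : measurableTypeR R * 'rV[R]_d => G z.1 z.2) ->
  measurable_fun setT (G t).
Proof.
move=> mG; apply: (measurableT_comp mG (g := fun x => (t, x))).
exact: measurable_pair1.
Qed.

(** The pointwise telescoping bound is integrated term by term and leaves the geometric series from
    rank k, with sum 2 * 2^-k. Each component is bounded separately, whence the factor q. *)
Lemma L1dist_upper_limit k t : 0 <= t <= k.+1%:R ->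
  (L1dist mu (F k t) (upper_limit t) <= (q%:R * (2 * 2^-1 ^+ k))%:E)%E.
Proof.
move=> tk.
have mFt p : measurable_family (F p t) by move=> i; exact: (measurable_slice (G := fun t x => F p t x i) t (mF p i)).
have ml : measurable_family (upper_limit t).
  by move=> i; exact: (measurable_slice (G := fun t x => upper_limit t x i) t (measurable_upper_limit i)).
rewrite /L1dist; under eq_integral do rewrite -sumEFin.
rewrite ge0_integral_sum//; last by move=> i; exact: (measurable_dist (mFt k i) (ml i)).
apply: (@le_trans _ _ (\sum_(i < q) (2 * 2^-1 ^+ k)%:E)%E); last first.
  by rewrite sumEFin lee_fin sumr_const card_ord [leRHS]mulr_natl.
apply: lee_sum => i _; apply: le_trans (nneseries_geometric_le k).
apply: (@le_trans _ _ (\int[mu]_x (\sum_(r <oo) `|F (k + r).+1 t x i - F (k + r)%N t x i|%:E))%E).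
  apply: ge0_le_integral => //.
  - exact: (measurable_dist (mFt k i) (ml i)).
  - by apply: ge0_emeasurable_sum => // r *; exact: (measurable_dist (mFt _ i) (mFt _ i)).
  - by move=> x _; apply: (dist_limn_sup_le k (A := lo i) (B := hi i)) => n.
rewrite integral_nneseries//; last by move=> r; exact: (measurable_dist (mFt _ i) (mFt _ i)).
apply: lee_nneseries => [r _ _|r _]; first exact: integral_ge0.
apply: le_trans (F_cauchy (k := k + r) (m := (k + r).+1) (n := k + r) _ _ _) => //.
  apply: ge0_le_integral => //.
  - exact: (measurable_dist (mFt _ i) (mFt _ i)).
  - exact: (measurable_L1dist (mFt _) (mFt _)).
  - by move=> x _; rewrite lee_fin (bigD1 i)//= lerDl sumr_ge0.
move: tk => /andP[-> tk]; apply: (le_trans tk).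
by rewrite ler_nat ltnS leq_addr.
Qed.

End L1_limit.

(** * Consistency with the weak formulation *)

Section test_functions.
Context {R : realType} {V : normedModType R}.
Implicit Types (psi : V -> R) (v w z : V).

Lemma is_derive_line psi z v (s : R) : (forall x, differentiable psi x) ->
  is_derive s 1 (fun s => psi (z + s *: v)) ('D_v psi (z + s *: v)).
Proof.
move=> dpsi.
have E : (fun h : R => h^-1 *: (((fun s => psi (z + s *: v)) \o shift s) (h *: (1 : R)) - psi (z + s *: v)))
       = (fun h : R => h^-1 *: ((psi \o shift (z + s *: v)) (h *: v) - psi (z + s *: v))).
  apply/funext => h /=; congr (_ *: (psi _ - _)).
  by rewrite [h *: 1]mulr1 scalerDl addrCA.
have D : derivable psi (z + s *: v) v by exact: diff_derivable.
by apply: DeriveDef; rewrite /derivable /derive E.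
Qed.

Lemma mean_value_line psi z v : (forall x, differentiable psi x) ->
  exists2 s : R, 0 <= s <= 1 & psi (z + v) - psi z = 'D_v psi (z + s *: v).
Proof.
move=> dpsi.
have D s := is_derive_line z v s dpsi.
have c : {within `[0, 1], continuous (fun s : R => psi (z + s *: v))}.
  by apply: derivable_within_continuous => x _; exact: ex_derive.
have [c0] := MVT_segment ler01 (fun x _ => D x) c.
rewrite in_itv /= => c01; rewrite scale1r scale0r addr0 subr0 mulr1 => E.
by exists c0.
Qed.

Lemma deriveZ_dir psi z (a : R) v : differentiable psi z -> 'D_(a *: v) psi z = a * 'D_v psi z.
Proof. by move=> dpsi; rewrite !deriveE// linearZ. Qed.

Lemma C1c_support psi : C1c psi -> exists2 M : R, 0 < M & forall z, M < `|z| ->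
  psi z = 0 /\ forall v, 'D_v psi z = 0.
Proof.
move=> [_ cpsi].
have [M [Mr HM]] := compact_bounded cpsi.
have psi0 z : `|M| + 1 < `|z| -> psi z = 0.
  move=> zM; apply/eqP/negPn/negP => psiz.
  have M1 : M < `|M| + 1 by apply: (le_lt_trans (ler_norm M)); rewrite ltrDl.
  have : `|z| <= `|M| + 1 by apply: (HM _ M1); exact: subset_closure.
  by rewrite leNgt zM.
exists (`|M| + 1); first by rewrite ltr_wpDl.
move=> z zM; split; first exact: psi0.
move=> v; rewrite (@near_eq_derive _ _ _ psi (cst 0)) ?derive_cst//.
have : \forall z' \near z, `|M| + 1 < `|z'|.
  have cn : {for z, continuous (fun z : V => `|z|)} by exact: norm_continuous.
  by apply: (cn [set y | `|M| + 1 < y]); exact: lt_nbhsr.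
by apply: filterS => z' /psi0.
Qed.

(** The alternative covers psi itself and its directional derivatives: both vanish off the compact
    support, on which continuity gives the bound. *)
Lemma C1c_bounded psi (g : V -> R) : C1c psi -> continuous g ->
  (forall z, psi z = 0 -> g z = 0) \/ (exists v, g = fun z => 'D_v psi z) ->
  exists2 C : R, 0 <= C & forall z, `|g z| <= C.
Proof.
move=> cpsi cg gpsi.
have [_ comp] := cpsi.
have : compact (g @` closure [set x | psi x != 0]).
  by apply: continuous_compact => //; exact: continuous_subspaceT.
move=> /compact_bounded[M [Mr HM]].
exists (`|M| + 1); first by rewrite addr_ge0.
move=> z; have [zS|zS] := pselect (closure [set x | psi x != 0] z).
  apply: (HM (`|M| + 1)); last by exists z.
  by apply: (le_lt_trans (ler_norm M)); rewrite ltrDl.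
have psi0 : \forall z' \near z, psi z' = 0.
  have oC : open (~` closure [set x | psi x != 0]) by apply/closed_openC/closed_closure.
  have : nbhs z (~` closure [set x | psi x != 0]) by exact: open_nbhs_nbhs.
  apply: filterS => z' z'S; apply/eqP/negPn/negP => pz'.
  by apply: z'S; exact: subset_closure.
suff -> : g z = 0 by rewrite normr0 addr_ge0.
case: gpsi => [->//|[v ->]]; first exact: nbhs_singleton psi0.
by rewrite (@near_eq_derive _ _ _ psi (cst 0)) ?derive_cst.
Qed.

End test_functions.

(** * Grid points in space-time and measurability of continuous functions *)

Section grid_points.
Context {R : realType} {d : nat}.
Local Notation Zd := 'rV[int]_d.
Implicit Types (h dt t : R) (x : 'rV[R]_d).

Definition gridpt dt h (n : nat) (j : Zd) : R * 'rV[R]_d := (n%:R * dt, node h j).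

Lemma rV_norm_le x (B : R) : 0 <= B -> (forall k, `|x ord0 k| <= B) -> `|x| <= B.
Proof.
move=> B0 xB; rewrite [`|x|]mx_normrE; apply/bigmax_leP; split => //= -[i k] _ /=.
by rewrite ord1.
Qed.

Lemma rV_coord_le_norm x k : `|x ord0 k| <= `|x|.
Proof.
rewrite [`|x|]mx_normrE; exact: (le_bigmax _ (fun i : 'I_1 * 'I_d => `|x i.1 i.2|) (ord0, k)).
Qed.

Lemma time_index_dist dt t : 0 < dt -> 0 <= t -> `|t - (time_index dt t)%:R * dt| <= dt.
Proof.
move=> dt0 t0; have /truncn_itv : 0 <= t / dt by rewrite divr_ge0// ltW.
rewrite -/(time_index dt t) ler_pdivlMr// ltr_pdivrMr// -natr1 mulrDl mul1r => /andP[t1 t2].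
by rewrite ler_norml; lra.
Qed.

Lemma gridpt_dist dt h t x : 0 < dt -> 0 < h -> 0 <= t ->
  `|(t, x) - gridpt dt h (time_index dt t) (cell_index h x)| <= dt + h.
Proof.
move=> dt0 h0 t0; rewrite prod_normE /= ge_max; apply/andP; split.
  by apply: (le_trans (time_index_dist dt0 t0)); rewrite lerDl ltW.
apply: (@le_trans _ _ h); last by rewrite lerDr ltW.
apply: rV_norm_le; first exact: ltW.
move=> k; rewrite mxE [X in _ + X]mxE; exact: node_cell_index.
Qed.

Lemma gridpt_cvg (dt h : nat -> R) t x : (forall p, 0 < dt p) -> (forall p, 0 < h p) ->
  dt @ \oo --> 0 -> h @ \oo --> 0 -> 0 <= t ->
  gridpt (dt p) (h p) (time_index (dt p) t) (cell_index (h p) x) @[p --> \oo] --> (t, x).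
Proof.
move=> dt0 h0 cdt ch t0; apply/cvgrPdist_le => e e0.
have c : (fun p => dt p + h p) @ \oo --> (0 : R) by rewrite -[X in _ --> X](addr0 0); exact: cvgD.
move/cvgrPdist_le : c => /(_ _ e0); apply: filterS => p.
rewrite sub0r normrN; apply: le_trans; apply: le_trans (ler_norm _).
exact: gridpt_dist.
Qed.

(** A continuous function is the pointwise limit of its values at grid points. Times are restricted
    to be nonnegative because [time_index] truncates at 0. *)
Lemma measurable_continuous_grid (g : R * 'rV[R]_d -> R) : continuous g ->
  measurable_fun (`[(0 : R), +oo[%classic `*` [set: 'rV[R]_d] :
      set (measurableTypeR R * 'rV[R]_d)) g.
Proof.
move=> cg.
pose hn n : R := n.+1%:R^-1.
have hn0 n : 0 < hn n by rewrite invr_gt0.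
apply: (@measurable_fun_cvg _ _ _ _ (fun n z => g (gridpt (hn n) (hn n) (time_index (hn n) z.1) (cell_index (hn n) z.2)))).
  move=> n; apply: measurable_funTS.
  exact: (measurable_grid (fun k j => g (gridpt (hn n) (hn n) k j))).
move=> [t x] [/= t0 _]; apply: cvg_comp; last exact: cg.
apply: gridpt_cvg => //; do ?exact: cvg_harmonic.
by move: t0; rewrite /= in_itv /= andbT.
Qed.

Lemma measurable_continuous_slice (g : R * 'rV[R]_d -> R) t : continuous g -> 0 <= t ->
  measurable_fun setT (fun x : 'rV[R]_d => g (t, x)).
Proof.
move=> cg t0.
pose hn n : R := n.+1%:R^-1.
have hn0 n : 0 < hn n by rewrite invr_gt0.
apply: (@measurable_fun_cvg _ _ _ _ (fun n x => g (gridpt (hn n) (hn n) (time_index (hn n) t) (cell_index (hn n) x)))).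
  by move=> n; exact: (measurable_cell_index (fun j => g (gridpt (hn n) (hn n) _ j))).
move=> x _; apply: cvg_comp; last exact: cg.
by apply: gridpt_cvg => //; exact: cvg_harmonic.
Qed.

End grid_points.

(** * Integrals of signed lattice functions with bounded support *)

Section lattice_integrals.
Context {R : realType} {d : nat}.
Local Notation mu := (lebesgue_rV R d).
Local Notation Zd := 'rV[int]_d.
Variable h : R.
Hypothesis h0 : 0 < h.
Implicit Types (G : Zd -> R) (m : Zd).

Definition bounded_support G := exists c B : R, [/\ 0 <= c, 0 <= B &
  forall j, `|G j| <= c * (inbox B (node h j))%:R].

Definition lint G : R := \int[mu]_x G (cell_index h x).

Lemma integrable_bounded_inbox (f : 'rV[R]_d -> R) (c B : R) : measurable_fun setT f ->
  (forall x, `|f x| <= c * (inbox B x)%:R) -> mu.-integrable setT (EFin \o f).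
Proof.
move=> mf fB.
apply: (@le_integrable _ _ _ mu setT measurableT (EFin \o f)
  (fun x => (c%:E * (EFin \o \1_[set x | inbox B x]) x)%E)).
- exact/measurable_EFinP.
- move=> x _; rewrite /= lee_fin indicE; apply: (le_trans (fB x)).
  apply: le_trans (ler_norm _); rewrite le_eqVlt; apply/orP; left; apply/eqP; congr (_ * _%:R).
  by congr nat_of_bool; apply/idP/idP; rewrite inE.
- apply: integrableZl => //; exact: integrable_inbox.
Qed.

Lemma bounded_support_integrable G : bounded_support G ->
  mu.-integrable setT (EFin \o (fun x => G (cell_index h x))).
Proof.
move=> [c [B [c0 B0 GB]]]; apply: (integrable_bounded_inbox (c := c) (B := B + h)).
  exact: (measurable_cell_index (U := measurableTypeR R) G h0).
move=> x; apply: (le_trans (GB _)); apply: ler_wpM2l => //.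
by case: (boolP (inbox B _)) => // /(inbox_node h0) ->.
Qed.

Lemma bounded_support_translate G m : bounded_support G -> bounded_support (fun j => G (j + m)).
Proof.
move=> [c [B [c0 B0 GB]]].
exists c, (B + \sum_k `|(m ord0 k)%:~R * h|); split => //.
  by rewrite addr_ge0// sumr_ge0.
move=> j; apply: (le_trans (GB _)); apply: ler_wpM2l => //.
case: (boolP (inbox B _)) => // /forallP jB; rewrite (_ : inbox _ _ = true)//.
apply/forallP => k; have := jB k; rewrite !mxE intrD mulrDl (bigD1 k)//=.
have : 0 <= \sum_(i < d | i != k) `|(m ord0 i)%:~R * h| by exact: sumr_ge0.
rewrite !ler_norml; have := ler_norm ((m ord0 k)%:~R * h).
have := lerNnormlW (lexx `|(m ord0 k)%:~R * h|); lra.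
Qed.

Lemma bounded_supportD G G' : bounded_support G -> bounded_support G' ->
  bounded_support (fun j => G j + G' j).
Proof.
move=> [c [B [c0 B0 GB]]] [c' [B' [c'0 B'0 GB']]].
exists (c + c'), (B + B'); rewrite !addr_ge0//; split => // j.
apply: (le_trans (ler_normD _ _)); rewrite mulrDl; apply: lerD.
  apply: (le_trans (GB _)); apply: ler_wpM2l => //.
  by case: (boolP (inbox B _)) => // /(@inbox_le _ _ _ (B + B')) -> //; rewrite lerDl.
apply: (le_trans (GB' _)); apply: ler_wpM2l => //.
by case: (boolP (inbox B' _)) => // /(@inbox_le _ _ _ (B + B')) -> //; rewrite lerDr.
Qed.

Lemma bounded_supportM G G' (C : R) : (forall j, `|G j| <= C) -> bounded_support G' ->
  bounded_support (fun j => G j * G' j).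
Proof.
move=> GC [c [B [c0 B0 GB]]].
have C0 : 0 <= C by exact: le_trans (GC 0).
exists (C * c), B; rewrite mulr_ge0//; split => // j.
by rewrite normrM -mulrA; apply: ler_pM.
Qed.

Lemma lintD G G' : bounded_support G -> bounded_support G' ->
  lint (fun j => G j + G' j) = lint G + lint G'.
Proof. by move=> bG bG'; apply: RintegralD => //; exact: bounded_support_integrable. Qed.

Lemma lintZ (a : R) G : bounded_support G -> lint (fun j => a * G j) = a * lint G.
Proof. by move=> bG; apply: RintegralZl => //; exact: bounded_support_integrable. Qed.

Lemma lint_sum (I : finType) (G : I -> Zd -> R) :
  (forall i, bounded_support (G i)) -> lint (fun j => \sum_i G i j) = \sum_i lint (G i).
Proof.
move=> bG.
have H (s : seq I) : bounded_support (fun j => \sum_(i <- s) G i j) /\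
    lint (fun j => \sum_(i <- s) G i j) = \sum_(i <- s) lint (G i).
  elim: s => [|i s [IH1 IH2]].
    rewrite big_nil; split; first by exists 0, 0; split => // j; rewrite big_nil normr0 mul0r.
    rewrite /lint; under eq_Rintegral do rewrite big_nil.
    by rewrite /Rintegral integral0.
  rewrite big_cons -IH2 -lintD//; split.
    by under eq_fun do rewrite big_cons; exact: bounded_supportD.
  by congr lint; apply/funext => j; rewrite big_cons.
by case: (H (index_enum I)).
Qed.

Lemma lint_translate G m : lint (fun j => G (j + m)) = lint G.
Proof. by congr fine; exact: (integral_shift (EFin \o G) m h0). Qed.

End lattice_integrals.

Section time_integral.
Context {R : realType}.

Lemma Rintegral_time_index (dt : R) (H : nat -> R) (N : nat) : 0 < dt ->
  (forall n, (N <= n)%N -> H n = 0) ->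
  \int[lebesgue_measure]_(t in `[0, +oo[%classic) H (time_index dt t) =
  dt * \sum_(n < N) H n.
Proof.
move=> dt0 HN.
pose I n : set R := `[n%:R * dt, n.+1%:R * dt[%classic.
have mI n : measurable (I n) by exact: measurable_itv.
have muI n : lebesgue_measure (I n) = dt%:E.
  rewrite lebesgue_measure_itv /= lte_fin ltr_pM2r// ltr_nat ltnSn.
  by rewrite -EFinB -mulrBl -natrB// subSnn mul1r.
have IP n t : 0 <= t -> (t \in I n) = (n == time_index dt t).
  move=> t0; apply/idP/eqP => [/set_mem|->].
    by rewrite /I /= in_itv /= => /(time_indexE dt0) ->.
  apply/mem_set; rewrite /I /= in_itv /=.
  have /truncn_itv : 0 <= t / dt by rewrite divr_ge0// ltW.
  by rewrite -/(time_index dt t) ler_pdivlMr// ltr_pdivrMr.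
rewrite Rintegral_mkcond.
have iI n : (@lebesgue_measure R).-integrable setT (EFin \o (fun t => H n * \1_(I n) t)).
  rewrite (_ : _ \o _ = fun t => ((H n)%:E * (EFin \o \1_(I n)) t)%E)//.
  apply: integrableZl => //; exact: integrable_indic_itv.
transitivity (\int[lebesgue_measure]_t (\sum_(n < N) H n * \1_(I n) t)).
  apply: eq_Rintegral => t _; rewrite /patch; case: ifPn.
    rewrite inE /= in_itv /= andbT => t0.
    have [tN|tN] := ltnP (time_index dt t) N.
      rewrite (bigD1 (Ordinal tN))//= indicE IP// eqxx mulr1 big1 ?addr0// => i iN.
      rewrite indicE IP//; suff -> : (i == time_index dt t :> nat) = false by rewrite mulr0.
      by apply: contraNF iN => /eqP E; apply/eqP/val_inj.
    rewrite HN// big1// => i _; rewrite indicE IP//.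
    by rewrite (ltn_eqF (leq_trans (ltn_ord i) tN)) mulr0.
  rewrite notin_setE /= in_itv /= andbT => /negP; rewrite -ltNge => t0.
  rewrite big1// => i _; rewrite indicE memNset ?mulr0// /I /= in_itv /= => /andP[H1 _].
  have : 0 <= i%:R * dt by rewrite mulr_ge0// ltW.
  by move=> /le_trans/(_ H1); rewrite leNgt t0.
rewrite /Rintegral.
under eq_integral do rewrite -sumEFin.
rewrite integral_sum//; last by move=> i; exact: iI.
rewrite (eq_bigr (fun n : 'I_N => (dt * H n)%:E)).
  by rewrite sumEFin/= mulr_sumr.
move=> n _; under eq_integral do rewrite EFinM.
rewrite integralZl//; last exact: integrable_indic_itv.
have -> : (\int[lebesgue_measure]_t (\1_(I n) t)%:E = lebesgue_measure (I n `&` setT))%E.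
  by apply: integral_indic => //; exact: mI.
by rewrite setIT muI -EFinM mulrC.
Qed.

End time_integral.

Section convergence_of_integrals.
Context d (T : measurableType d) (R : realType).
Variable mu : {measure set T -> \bar R}.

Lemma Rintegral_dominated (D : set T) (f_ : nat -> T -> R) (f g : T -> R) :
  measurable D -> (forall n, measurable_fun D (f_ n)) ->
  (forall x, D x -> f_ n x @[n --> \oo] --> f x) ->
  mu.-integrable D (EFin \o g) -> (forall n x, D x -> `|f_ n x| <= g x) ->
  \int[mu]_(x in D) f_ n x @[n --> \oo] --> \int[mu]_(x in D) f x.
Proof.
move=> mD mf_ ff ig fg.
have mf : measurable_fun D f by apply: (measurable_fun_cvg mf_) => x Dx; exact: ff.
have [|||||i _ +] := @dominated_convergence _ T R mu D mD
  (fun n => EFin \o f_ n) (EFin \o f) (EFin \o g) => //.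
- by move=> n; apply/measurable_EFinP.
- by apply/measurable_EFinP.
- apply: aeW => x Dx; apply: cvg_EFin; first exact: nearW.
  exact: ff.
- by apply: aeW => x n Dx; rewrite lee_fin; exact: fg.
rewrite -[X in _ --> X]fineK; last exact: integrable_fin_num.
exact: fine_cvg.
Qed.

Lemma Rintegral_cvg_L1 (f_ : nat -> T -> R) (f : T -> R) :
  (forall n, mu.-integrable setT (EFin \o f_ n)) -> mu.-integrable setT (EFin \o f) ->
  (\int[mu]_x `|f_ n x - f x|%:E)%E @[n --> \oo] --> 0%E ->
  \int[mu]_x f_ n x @[n --> \oo] --> \int[mu]_x f x.
Proof.
move=> if_ intf ff; apply/cvgrPdist_le => e e0.
apply: filterS (cvge0_small ff e0) => n fn.
rewrite distrC -RintegralB// -lee_fin EFin_normr_Rintegral//; last first.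
  exact: (integrableB measurableT (if_ n) intf).
apply: le_trans fn; apply: le_abse_integral => //.
apply/measurable_EFinP; apply: measurable_funB; apply/measurable_EFinP.
  exact: measurable_int (if_ n).
exact: measurable_int intf.
Qed.

End convergence_of_integrals.

Lemma ge0_cvge0 (R : realType) (u : nat -> \bar R) : (forall n, 0 <= u n)%E ->
  (forall e : R, 0 < e -> \forall n \near \oo, (u n <= e%:E)%E) -> u @ \oo --> 0%E.
Proof.
move=> u0 ue; apply/fine_cvgP; split.
  have := ue 1 ltr01; apply: filterS => n un.
  by rewrite ge0_fin_numE//; apply: le_lt_trans un _; rewrite ltry.
apply/cvgrPdist_le => e e0; have := ue e e0; apply: filterS => n un.
rewrite /= sub0r normrN ger0_norm ?fine_ge0// -lee_fin fineK//.
by rewrite ge0_fin_numE//; apply: le_lt_trans un _; rewrite ltry.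
Qed.

(** * Summation by parts and the discrete weak form *)

Section summation_by_parts.
Context {R : realType} {d q : nat}.
Local Notation mu := (lebesgue_rV R d).
Local Notation Zd := 'rV[int]_d.
Variables (Rx : ('I_q -> R) -> 'I_q -> R) (e : 'I_q -> Zd).
Variables (lam : R) (c : 'I_q -> 'rV[R]_d).
Hypothesis lam0 : 0 < lam.
Hypothesis cE : forall i, c i = lam *: map_mx intr (e i).
Variable psi : R * 'rV[R]_d -> R.
Hypothesis psi_C1c : C1c psi.

Definition dir (i : 'I_q) : R * 'rV[R]_d := (1, c i).

(** In one time-step h / lam population i travels from node j to node [j + e i], that is by (h /
    lam) c_i; this is the difference quotient of psi in the direction (1, c_i). *)
Definition quot h i n (j : Zd) : R :=
  (psi (gridpt (h / lam) h n.+1 (j + e i)) - psi (gridpt (h / lam) h n j)) / (h / lam).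

Let dpsi z : differentiable psi z.
Proof. by case: psi_C1c => -[]. Qed.

Let cD v : continuous (fun z => 'D_v psi z).
Proof. by case: psi_C1c => -[_ +] _; exact. Qed.

Lemma gridpt_step h i n j :
  gridpt (h / lam) h n.+1 (j + e i) = gridpt (h / lam) h n j + (h / lam) *: dir i.
Proof.
rewrite /gridpt /dir; congr pair.
  by rewrite -natr1 mulrDl [X in _ = _ + X]mulr1 mul1r.
apply/rowP => k; rewrite cE !mxE intrD mulrDl; congr (_ + _).
by rewrite mulrA divfK ?gt_eqF// mulrC.
Qed.

Lemma quot_mean h i n j : 0 < h -> exists2 s : R, 0 <= s <= 1 &
  quot h i n j = 'D_(dir i) psi (gridpt (h / lam) h n j + (s * (h / lam)) *: dir i).
Proof.
move=> h0; have hl : 0 < h / lam by rewrite divr_gt0.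
rewrite /quot gridpt_step.
have [s s01 ->] := mean_value_line (gridpt (h / lam) h n j) ((h / lam) *: dir i) dpsi.
exists s => //; rewrite deriveZ_dir// scalerA mulrAC divff ?gt_eqF// mul1r.
by [].
Qed.

Lemma derive_dir_bound : exists2 C : R, 0 <= C & forall i z, `|'D_(dir i) psi z| <= C.
Proof.
have /choice[C HC] : forall i, exists C : R, 0 <= C /\ forall z, `|'D_(dir i) psi z| <= C.
  move=> i; have [|C C0 HC] := @C1c_bounded R _ psi (fun z => 'D_(dir i) psi z) psi_C1c (@cD (dir i)).
    by right; exists (dir i).
  by exists C.
exists (\sum_i C i); first by apply: sumr_ge0 => i _; case: (HC i).
move=> i z; apply: (le_trans ((HC i).2 z)); rewrite (bigD1 i)//= lerDl.
by apply: sumr_ge0 => k _; case: (HC k).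
Qed.

Lemma psi_bound : exists2 C : R, 0 <= C & forall z, `|psi z| <= C.
Proof.
apply: (@C1c_bounded R _ psi psi psi_C1c); last by left.
by move=> z; exact: differentiable_continuous.
Qed.

(** The mean value point lies within (H / lam) W of the grid point, so enlarging the support radius
    of psi by this amount serves all h <= H. *)
Lemma quot_support (H : R) : 0 < H -> exists2 M : R, 0 < M & forall (h : R) n j, 0 < h -> h <= H ->
  M < `|gridpt (h / lam) h n j| -> (forall i, quot h i n j = 0) /\ psi (gridpt (h / lam) h n j) = 0.
Proof.
move=> H0; have [M M0 HM] := C1c_support psi_C1c.
pose W := \sum_i `|dir i|.
have W0 : 0 <= W by apply: sumr_ge0.
exists (M + H / lam * W).
  by rewrite ltr_wpDr// mulr_ge0// divr_ge0// ltW.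
move=> h n j h0 hH z; split; last first.
  have zM : M < `|gridpt (h / lam) h n j|.
    by apply: le_lt_trans z; rewrite lerDl mulr_ge0// divr_ge0// ltW.
  exact: (HM _ zM).1.
move=> i; have [s /andP[s0 s1] ->] := quot_mean i n j h0.
have [//|_] := HM (gridpt (h / lam) h n j + (s * (h / lam)) *: dir i); last by apply.
apply: lt_le_trans (lerB_normD _ _).
rewrite ltrBrDr; apply: le_lt_trans z; rewrite lerD2l normrZ.
have dW : `|dir i| <= W by rewrite /W (bigD1 i)//= lerDl sumr_ge0.
have hl : 0 <= h / lam by rewrite divr_ge0// ltW.
have sH : `|s * (h / lam)| <= H / lam.
  rewrite ger0_norm; last exact: mulr_ge0.
  apply: (@le_trans _ _ (h / lam)).
    by have := ler_wpM2r hl s1; rewrite mul1r.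
  by apply: ler_wpM2r => //; rewrite invr_ge0 ltW.
exact: ler_pM.
Qed.

Lemma quot_cvg (h : nat -> R) i t x : (forall p, 0 < h p) -> h @ \oo --> 0 -> 0 <= t ->
  quot (h p) i (time_index (h p / lam) t) (cell_index (h p) x) @[p --> \oo] -->
  'D_(dir i) psi (t, x).
Proof.
move=> h0 ch t0.
have hl p : 0 < h p / lam by rewrite divr_gt0.
have chl : (fun p => h p / lam) @ \oo --> (0 : R).
  by rewrite -[X in _ --> X](mul0r lam^-1); apply: cvgMr_tmp.
have /choice[s Hs] : forall p, exists s : R, 0 <= s <= 1 /\
    quot (h p) i (time_index (h p / lam) t) (cell_index (h p) x) =
    'D_(dir i) psi (gridpt (h p / lam) (h p) (time_index (h p / lam) t) (cell_index (h p) x)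
      + (s * (h p / lam)) *: dir i).
  by move=> p; have [s s01 E] := quot_mean i (time_index (h p / lam) t) (cell_index (h p) x) (h0 p); exists s.
rewrite (_ : (fun p => _) = (fun p => 'D_(dir i) psi (gridpt (h p / lam) (h p)
   (time_index (h p / lam) t) (cell_index (h p) x) + (s p * (h p / lam)) *: dir i))); last first.
  by apply/funext => p; case: (Hs p).
suff zc : gridpt (h p / lam) (h p) (time_index (h p / lam) t) (cell_index (h p) x)
    + (s p * (h p / lam)) *: dir i @[p --> \oo] --> (t, x).
  exact: (cvg_comp _ _ zc (@cD (dir i) (t, x))).
rewrite -[X in _ --> X]addr0; apply: cvgD; first exact: gridpt_cvg.
rewrite -[X in _ --> X](scale0r (dir i)); apply: cvgZr_tmp.
apply: (@squeeze_cvgr _ _ _ _ (cst 0) (fun p => h p / lam)) => //; last exact: cvg_cst.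
apply: nearW => p; have [/andP[s0 s1] _] := Hs p.
by rewrite mulr_ge0 ?(ltW (hl p))//= -[leRHS]mul1r ler_wpM2r ?(ltW (hl p)).
Qed.

Section discrete_identity.
Variables (h U : R) (g : Zd -> 'I_q -> R).
Hypothesis h0 : 0 < h.
Hypothesis Rx_sum : forall f, \sum_i Rx f i = \sum_i f i.
Hypothesis g_bound : forall n j i, `|Rx (evolve Rx e n g j) i| <= U.
Local Notation f := (fun n => evolve Rx e n g).
Local Notation dt := (h / lam).

Let dt0 : 0 < dt. Proof. by rewrite divr_gt0. Qed.

Lemma node_notin M (z : 'rV[R]_d) : ~~ inbox M z -> M < `|z|.
Proof.
move=> zM; rewrite ltNge; apply: contra zM => zM; apply/forallP => k.
exact: le_trans (rV_coord_le_norm z k) zM.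
Qed.

Lemma psi_bounded_support n : bounded_support h (fun j => psi (gridpt dt h n j)).
Proof.
have [C C0 HC] := psi_bound; have [M M0 HM] := C1c_support psi_C1c.
exists C, M; split => //; first exact: ltW.
move=> j; case: (boolP (inbox M (node h j))) => jM; first by rewrite mulr1.
have zM : M < `|gridpt dt h n j|.
  by apply: (lt_le_trans (node_notin jM)); rewrite prod_normE le_max lexx orbT.
by rewrite (HM _ zM).1 normr0 mulr0.
Qed.

Lemma psi_bounded_support_translate n i :
  bounded_support h (fun j => psi (gridpt dt h n (j + e i))).
Proof. exact: (bounded_support_translate (e i) (psi_bounded_support n)). Qed.

Definition mass n : R := lint h (fun j => (\sum_i f n j i) * psi (gridpt dt h n j)).

Lemma quot_bounded_support n i : bounded_support h (quot h i n).
Proof.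
have [//|M M0 HM] := quot_support (H := h); have [C C0 HC] := derive_dir_bound.
exists C, M; split => //; first exact: ltW.
move=> j; case: (boolP (inbox M (node h j))) => jM.
  by rewrite mulr1; have [s _ ->] := quot_mean i n j h0.
have zM : M < `|gridpt dt h n j|.
  by apply: (lt_le_trans (node_notin jM)); rewrite prod_normE le_max lexx orbT.
by rewrite (HM h n j h0 (lexx h) zM).1 normr0 mulr0.
Qed.

(** By conservation the mass at time n can be computed from the relaxed populations. Transport moves
    population i from j to [j + e i], and the shift invariance of the lattice integral puts this
    displacement on psi. *)
Lemma mass_step n : mass n.+1 - mass n =
  dt * lint h (fun j => \sum_i Rx (f n j) i * quot h i n j).
Proof.
have bR i j : `|Rx (f n j) i| <= U by exact: g_bound.
have b1 i : bounded_support h (fun j => Rx (f n j) i * psi (gridpt dt h n.+1 (j + e i))).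
  exact: (bounded_supportM (bR i)) (psi_bounded_support_translate _ _).
have b0 i : bounded_support h (fun j => Rx (f n j) i * psi (gridpt dt h n j)).
  exact: (bounded_supportM (bR i)) (psi_bounded_support _).
have bq i : bounded_support h (fun j => Rx (f n j) i * quot h i n j).
  exact: (bounded_supportM (bR i)) (quot_bounded_support _ _).
have -> : mass n = \sum_i lint h (fun j => Rx (f n j) i * psi (gridpt dt h n j)).
  rewrite -lint_sum//; congr lint; apply/funext => j.
  by rewrite -Rx_sum mulr_suml.
have -> : mass n.+1 = \sum_i lint h (fun j => Rx (f n j) i * psi (gridpt dt h n.+1 (j + e i))).
  transitivity (\sum_i lint h (fun j => Rx (f n (j - e i)) i * psi (gridpt dt h n.+1 j))).
    rewrite -lint_sum//; first by congr lint; apply/funext => j; rewrite mulr_suml.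
    move=> i; have := bounded_support_translate (- e i) (b1 i).
    by congr bounded_support; apply/funext => j; rewrite subrK.
  apply: eq_bigr => i _; rewrite -[RHS](lint_translate h0 _ (- e i)).
  by congr lint; apply/funext => j; rewrite subrK.
rewrite lint_sum// mulr_sumr -sumrB; apply: eq_bigr => i _.
rewrite -lintZ//; apply/eqP; rewrite subr_eq; apply/eqP; rewrite -lintD//.
  congr lint; apply/funext => j.
  by rewrite /quot mulrCA -mulrDr [dt * _]mulrC divfK ?gt_eqF// subrK.
apply: (@bounded_supportM _ _ _ (fun=> dt) _ dt) (bq i) => j.
by rewrite ger0_norm// ltW.
Qed.

Lemma discrete_weak_form :
  \int[lebesgue_measure]_(t in `[0, +oo[%classic)
    lint h (fun j => \sum_i Rx (f (time_index dt t) j) i * quot h i (time_index dt t) j)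
  + lint h (fun j => (\sum_i g j i) * psi (0, node h j)) = 0.
Proof.
have [//|M M0 HM] := quot_support (H := h).
(* From step N on, the grid time exceeds the radius M outside which psi and its quotients vanish, so
   the telescoping sum ends with zero mass. *)
pose N := (Num.truncn (M / dt)).+1.
have far n (j : Zd) : (N <= n)%N -> M < `|gridpt dt h n j|.
  move=> Nn; have Mn : M < `|n%:R * dt|.
    have Mdt : M / dt < n%:R by apply: lt_le_trans (truncnS_gt _) _; rewrite ler_nat.
    by apply: lt_le_trans (ler_norm _); move: Mdt; rewrite ltr_pdivrMr.
  by apply: lt_le_trans Mn _; rewrite prod_normE le_max lexx.
have lint0 G : (forall j, G j = 0) -> lint h G = 0.
  move=> G0; rewrite /lint; under eq_Rintegral do rewrite G0.
  by rewrite /Rintegral integral0.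
rewrite (Rintegral_time_index (N := N) (H := fun n =>
  lint h (fun j => \sum_i Rx (f n j) i * quot h i n j)))//; last first.
  move=> n Nn; apply: lint0 => j; apply: big1 => i _.
  by rewrite (HM h n j h0 (lexx h) (far n j Nn)).1 mulr0.
have mN : mass N = 0.
  apply: lint0 => j.
  by rewrite (HM h N j h0 (lexx h) (far N j (leqnn N))).2 mulr0.
have m0 : mass 0 = lint h (fun j => (\sum_i g j i) * psi (0, node h j)).
  by congr lint; apply/funext => j; rewrite /gridpt mul0r.
rewrite -m0 mulr_sumr; under eq_bigr do rewrite -mass_step.
by rewrite -(big_mkord xpredT (fun n => mass n.+1 - mass n)) telescope_sumr// mN sub0r addNr.
Qed.

End discrete_identity.
End summation_by_parts.

(** * Passage to the limit in the weak formulation *)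

Section weak_limit.
Context {R : realType} {d q : nat}.
Local Notation mu := (lebesgue_rV R d).
Local Notation Zd := 'rV[int]_d.
Variables (Rx : ('I_q -> R) -> 'I_q -> R) (e : 'I_q -> Zd).
Variables (lam : R) (c : 'I_q -> 'rV[R]_d).
Hypothesis lam0 : 0 < lam.
Hypothesis cE : forall i, c i = lam *: map_mx intr (e i).
Variable psi : R * 'rV[R]_d -> R.
Hypothesis psi_C1c : C1c psi.
Variable h : nat -> R.
Hypothesis h0 : forall p, 0 < h p.
Hypothesis h_cvg : h @ \oo --> 0.
Local Notation D i t x := ('D_(dir c i) psi (t, x)).

Definition grid_quot p (t : R) (x : 'rV[R]_d) (i : 'I_q) : R :=
  quot e lam psi (h p) i (time_index (h p / lam) t) (cell_index (h p) x).

Let cpsi : continuous psi.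
Proof. by case: psi_C1c => -[dpsi _] _ z; exact: differentiable_continuous. Qed.

Let cD v : continuous (fun z => 'D_v psi z).
Proof. by case: psi_C1c => -[_ +] _; exact. Qed.

Let dt0 p : 0 < h p / lam. Proof. by rewrite divr_gt0. Qed.

(** One bound for all p that carries the indicators of a box in x and of t <= B, so that it
    dominates in the space integrals and in the time integral alike. *)
Lemma grid_bounds : exists C B : R, [/\ 0 <= C, 0 <= B,
  forall p t x i, 0 <= t -> `|grid_quot p t x i| <= C * (inbox B x)%:R * (t <= B)%R%:R &
  forall t x i, 0 <= t -> `|D i t x| <= C * (inbox B x)%:R * (t <= B)%R%:R].
Proof.
have [H H0 hH] : exists2 H, 0 < H & forall p, h p <= H.
  have [H [_ HH]] : bounded_fun h by apply: cvg_seq_bounded; apply/cvg_ex; exists 0.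
  exists (`|H| + 1) => [|p]; first by rewrite ltr_pwDr.
  apply: le_trans (ler_norm _) _; apply: HH => //.
  by apply: le_lt_trans (ler_norm H) _; rewrite ltrDl.
have [C C0 HC] := derive_dir_bound c psi_C1c.
have [M M0 HM] := quot_support lam0 cE psi_C1c H0.
have [M' M'0 HM'] := C1c_support psi_C1c.
have Hl : 0 <= H / lam by rewrite divr_ge0 ?(ltW H0) ?(ltW lam0).
(* The support radii M and M', increased by H + H / lam, the largest distance between (t, x) and its
   grid point. *)
pose B := M + H + H / lam + M'.
have B0 : 0 <= B by rewrite /B; lra.
exists C, B; split => // [p t x i t0|t x i t0].
- have QC : `|grid_quot p t x i| <= C.
    rewrite /grid_quot.
    by have [s _ ->] := quot_mean lam0 cE psi_C1c i (time_index (h p / lam) t) (cell_index (h p) x) (h0 p).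
  have far : M < `|gridpt (h p / lam) (h p) (time_index (h p / lam) t) (cell_index (h p) x)| ->
      grid_quot p t x i = 0.
    by move=> /(HM _ _ _ (h0 p) (hH p))[+ _]; exact.
  case: (boolP (inbox B x)) => xB; last first.
    rewrite far ?normr0 ?mulr0 ?mul0r//.
    rewrite prod_normE lt_max; apply/orP; right; apply: node_notin.
    apply: contra xB => /(inbox_node (h0 p)); apply: inbox_le.
    by have := hH p; rewrite /B; lra.
  case: (leP t B) => tB; first by rewrite !mulr1.
  rewrite far ?normr0 ?mulr0//.
  rewrite prod_normE lt_max; apply/orP; left => /=.
  apply: lt_le_trans (ler_norm _).
  have /(_ _ t0) := time_index_dist (dt0 p); rewrite ler_norml => /andP[_].
  have : h p / lam <= H / lam by rewrite ler_pM2r ?invr_gt0.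
  by move: tB; rewrite /B; lra.
- have far : M' < `|(t, x)| -> D i t x = 0 by move=> /HM'[_ ->].
  case: (boolP (inbox B x)) => xB; last first.
    rewrite far ?normr0 ?mulr0 ?mul0r//.
    rewrite prod_normE lt_max; apply/orP; right; apply: node_notin.
    by apply: contra xB; apply: inbox_le; rewrite /B; lra.
  case: (leP t B) => tB; first by rewrite !mulr1.
  rewrite far ?normr0 ?mulr0//.
  rewrite prod_normE lt_max; apply/orP; left => /=.
  apply: lt_le_trans (ler_norm _).
  by move: tB; rewrite /B; lra.
Qed.

Lemma measurable_grid_quot p t i : measurable_fun setT (fun x => grid_quot p t x i).
Proof. exact: (measurable_cell_index (fun j => quot e lam psi (h p) i (time_index (h p / lam) t) j)). Qed.

Lemma grid_quot_cvg t i : 0 <= t ->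
  (\int[mu]_x `|grid_quot p t x i - D i t x|%:E)%E @[p --> \oo] --> 0%E.
Proof.
move=> t0; have [C [B [C0 B0 QC DC]]] := grid_bounds.
apply: (@L1_dominated _ _ _ _ _ _ (fun x => C * (inbox B x)%:R)).
- by move=> p; exact: measurable_grid_quot.
- by move=> x; exact: quot_cvg.
- apply: (@integrable_bounded_inbox _ _ _ C B).
    by apply/measurable_EFinP; exact: measurable_inboxR.
  by move=> x; rewrite ger0_norm// mulr_ge0.
- move=> p x; apply: le_trans (QC _ _ _ _ t0) _.
  by rewrite ler_piMr ?mulr_ge0// lern1 leq_b1.
Qed.

Variables (U : R) (g : nat -> Zd -> 'I_q -> R).
Hypothesis U0 : 0 <= U.
Hypothesis Rx_sum : forall f, \sum_i Rx f i = \sum_i f i.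
Hypothesis g_bound : forall p n j i, `|Rx (evolve Rx e n (g p) j) i| <= U.
Hypothesis mass_bound : forall p j, `|\sum_i g p j i| <= U.
Variable u0 : 'rV[R]_d -> R.
Hypothesis iu0 : mu.-integrable setT (EFin \o u0).
Hypothesis u0_cvg : (\int[mu]_x `|\sum_i g p (cell_index (h p) x) i - u0 x|%:E)%E
  @[p --> \oo] --> 0%E.
Variable G : R -> 'rV[R]_d -> 'I_q -> R.
Hypothesis mG : forall i,
  measurable_fun setT (fun z : measurableTypeR R * 'rV[R]_d => G z.1 z.2 i).
Hypothesis G_bound : forall t x i, `|G t x i| <= U.

(** The state after relaxation and before transport, which is what the discrete identity pairs with
    the quotients of psi. *)
Definition relaxed p (t : R) (x : 'rV[R]_d) (i : 'I_q) : R :=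
  Rx (evolve Rx e (time_index (h p / lam) t) (g p) (cell_index (h p) x)) i.

Hypothesis relaxed_cvg : forall t, 0 <= t -> L1dist mu (relaxed p t) (G t) @[p --> \oo] --> 0%E.

Lemma measurable_relaxed p t i : measurable_fun setT (fun x => relaxed p t x i).
Proof. exact: (measurable_cell_index (fun j => Rx (evolve Rx e (time_index (h p / lam) t) (g p) j) i)). Qed.

Lemma bound_sum_mul (F E : 'I_q -> R) (C b : R) : (forall i, `|F i| <= U) ->
  (forall i, `|E i| <= C * b) -> `|\sum_i F i * E i| <= q%:R * (U * C) * b.
Proof.
move=> FU EC; apply: le_trans (ler_norm_sum _ _ _) _.
apply: (@le_trans _ _ (\sum_(i < q) U * (C * b))).
  by apply: ler_sum => i _; rewrite normrM ler_pM.
by rewrite sumr_const card_ord -[leLHS]mulr_natl !mulrA.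
Qed.

Let mGs t i : measurable_fun setT (fun x => G t x i).
Proof. exact: (@measurable_slice _ _ (fun t x => G t x i)). Qed.

Let mDs t i : 0 <= t -> measurable_fun setT (fun x => D i t x).
Proof. by move=> t0; exact: (measurable_continuous_slice (@cD (dir c i)) t0). Qed.

Lemma inner_cvg t : 0 <= t ->
  \int[mu]_x (\sum_i relaxed p t x i * grid_quot p t x i) @[p --> \oo] -->
  \int[mu]_x (\sum_i G t x i * D i t x).
Proof.
move=> t0; have [C [B [C0 B0 QC DC]]] := grid_bounds.
have drop1 (a b : R) (P : bool) : 0 <= b -> a <= b * P%:R -> a <= b.
  by move=> b0 /le_trans; apply; rewrite ler_piMr// lern1 leq_b1.
have QC' p x i : `|grid_quot p t x i| <= C * (inbox B x)%:R.
  by apply: drop1 (QC _ _ _ _ t0); rewrite mulr_ge0.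
have DC' x i : `|D i t x| <= C * (inbox B x)%:R.
  by apply: drop1 (DC _ _ _ t0); rewrite mulr_ge0.
have mRQ p : measurable_fun setT (fun x => \sum_i relaxed p t x i * grid_quot p t x i).
  apply: measurable_sum => i; apply: measurable_funM; first exact: measurable_relaxed.
  exact: measurable_grid_quot.
have mGD : measurable_fun setT (fun x => \sum_i G t x i * D i t x).
  by apply: measurable_sum => i; apply: measurable_funM => //; exact: mDs.
apply: Rintegral_cvg_L1.
- move=> p; apply: (@integrable_bounded_inbox _ _ _ (q%:R * (U * C)) B) => // x.
  by apply: bound_sum_mul => // i; exact: g_bound.
- apply: (@integrable_bounded_inbox _ _ _ (q%:R * (U * C)) B) => // x.
  exact: bound_sum_mul.
(* From the splitting (a - a') b + a' (b - b'), with the quotients b bounded by C and the limit a'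
   by U. *)
pose bd p : \bar R := (C%:E * L1dist mu (relaxed p t) (G t)
  + U%:E * \sum_i (\int[mu]_x `|grid_quot p t x i - D i t x|%:E))%E.
have bd0 : bd @ \oo --> 0%E.
  rewrite -[X in _ --> X]adde0 -[X in _ --> (X + _)%E](mule0 C%:E) -[X in _ --> (_ + X)%E](mule0 U%:E).
  apply: cvgeD => //.
    by apply: cvgeZl => //; exact: relaxed_cvg.
  apply: cvgeZl => //.
  rewrite [X in _ --> X](_ : _ = \sum_(i < q) (0%E : \bar R))%E; last by rewrite big1.
  apply: cvg_nnesum => i _; last exact: grid_quot_cvg.
  by apply: nearW => p; apply: integral_ge0 => x _; rewrite lee_fin.
apply: (@squeeze_cvge _ _ _ _ (cst 0%E) _ bd) => //; last exact: cvg_cst.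
apply: nearW => p; apply/andP; split; first by apply: integral_ge0 => x _; rewrite lee_fin.
have md i := measurable_dist (@measurable_grid_quot p t i) (@mDs t i t0).
have mR : measurable_family (relaxed p t) by move=> i; exact: measurable_relaxed.
have mGf : measurable_family (G t) by move=> i; exact: mGs.
rewrite /bd /L1dist -ge0_integralZl//; last 2 first.
- exact: measurable_L1dist.
- by move=> x _; rewrite lee_fin sumr_ge0.
rewrite -ge0_integral_sum//.
have mS : measurable_fun setT (fun x => (\sum_i `|grid_quot p t x i - D i t x|%:E)%E).
  exact: emeasurable_sum.
rewrite -ge0_integralZl//; last by move=> x _; apply: sume_ge0 => i _; rewrite lee_fin.
rewrite -ge0_integralD//; last 4 first.
- by move=> x _; rewrite mule_ge0 ?lee_fin// sumr_ge0.
- by apply: measurable_funeM; exact: measurable_L1dist.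
- by move=> x _; rewrite mule_ge0// sume_ge0// => i _; rewrite lee_fin.
- exact: measurable_funeM.
apply: ge0_le_integral => //.
- exact: measurable_dist.
- by apply: emeasurable_funD; apply: measurable_funeM => //; exact: measurable_L1dist.
move=> x _; rewrite sumEFin -!EFinM -EFinD lee_fin -sumrB !mulr_sumr -big_split/=.
apply: le_trans (ler_norm_sum _ _ _) _; apply: ler_sum => i _.
rewrite (_ : _ - _ = (relaxed p t x i - G t x i) * grid_quot p t x i
  + G t x i * (grid_quot p t x i - D i t x)); last by ring.
apply: le_trans (ler_normD _ _) _; rewrite [X in X + _]normrM [X in _ + X]normrM.
apply: lerD; last exact: ler_wpM2r.
rewrite mulrC; apply: ler_wpM2r => //; exact: drop1 (QC' _ _ _).
Qed.

Lemma integrable_initial_term : mu.-integrable setT (EFin \o (fun x => u0 x * psi (0, x))).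
Proof.
have [C C0 HC] := psi_bound psi_C1c.
have mu0 : measurable_fun setT u0 by apply/measurable_EFinP; exact: measurable_int iu0.
have mpsi : measurable_fun setT (fun x : 'rV[R]_d => psi (0, x)).
  exact: (measurable_continuous_slice cpsi (lexx 0)).
apply: (@le_integrable _ _ _ _ _ _ _ (fun x => (C * u0 x)%:E)) => //.
- by apply/measurable_EFinP; exact: measurable_funM.
- move=> x _; rewrite lee_fin !normrM mulrC (ger0_norm C0); exact: ler_wpM2r.
- rewrite (_ : (fun x => _) = (fun x => C%:E * (EFin \o u0) x)%E)//.
  exact: integrableZl.
Qed.

Lemma initial_cvg :
  lint (h p) (fun j => (\sum_i g p j i) * psi (0, node (h p) j)) @[p --> \oo] -->
  \int[mu]_x (u0 x * psi (0, x)).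
Proof.
have [C C0 HC] := psi_bound psi_C1c.
have mu0 : measurable_fun setT u0 by apply/measurable_EFinP; exact: measurable_int iu0.
have mpsi : measurable_fun setT (fun x : 'rV[R]_d => psi (0, x)).
  exact: (measurable_continuous_slice cpsi (lexx 0)).
have ipsi := integrable_initial_term.
pose P p x := psi (0, node (h p) (cell_index (h p) x)).
have mP p : measurable_fun setT (P p).
  exact: (measurable_cell_index (fun j => psi (0, node (h p) j))).
pose S p x := \sum_i g p (cell_index (h p) x) i.
have mS p : measurable_fun setT (S p).
  exact: (measurable_cell_index (fun j => \sum_i g p j i)).
apply: (@Rintegral_cvg_L1 _ _ _ mu (fun p x => S p x * P p x)) => //.
- move=> p.
  have [c' [B [c'0 B0 HB]]] := psi_bounded_support lam psi_C1c (h p) 0.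
  have : bounded_support (h p) (fun j => (\sum_i g p j i) * psi (gridpt (h p / lam) (h p) 0 j)).
    by apply: (bounded_supportM (mass_bound p)); exists c', B.
  move=> /(bounded_support_integrable (h0 p)); congr (_.-integrable _ _).
  by apply/funext => x /=; rewrite /gridpt mul0r.
pose bd p : \bar R := (C%:E * (\int[mu]_x `|S p x - u0 x|%:E)
  + \int[mu]_x `|u0 x * P p x - u0 x * psi (0, x)|%:E)%E.
have bd0 : bd @ \oo --> 0%E.
  rewrite -[X in _ --> X]adde0 -[X in _ --> (X + _)%E](mule0 C%:E).
  apply: cvgeD => //; first exact: cvgeZl.
  apply: (@L1_dominated _ _ _ _ _ _ (fun x => C * `|u0 x|)).
  - by move=> p; exact: measurable_funM.
  - move=> x; apply: cvgMl_tmp.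
    have chl : (fun p => h p / lam) @ \oo --> (0 : R).
      by rewrite -[X in _ --> X](mul0r lam^-1); apply: cvgMr_tmp.
    have zc := gridpt_cvg (x := x) dt0 h0 chl h_cvg (lexx 0).
    have := cvg_comp _ _ zc (@cpsi (0, x)).
    apply: cvg_trans; apply: near_eq_cvg; apply: nearW => p /=.
    by rewrite /P /gridpt /time_index mul0r truncn0 mul0r.
  - rewrite (_ : _ \o _ = (fun x => C%:E * `|(EFin \o u0) x|)%E)//.
    by apply: integrableZl => //; exact: integrable_abse.
  - by move=> p x; rewrite normrM mulrC; apply: ler_wpM2r => //; exact: HC.
apply: (@squeeze_cvge _ _ _ _ (cst 0%E) _ bd) => //; last exact: cvg_cst.
apply: nearW => p; apply/andP; split; first by apply: integral_ge0 => x _; rewrite lee_fin.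
have mSu : measurable_fun setT (fun x => `|S p x - u0 x|%:E) by exact: measurable_dist.
have m2 : measurable_fun setT (fun x => `|u0 x * P p x - u0 x * psi (0, x)|%:E).
  by apply: measurable_dist; exact: measurable_funM.
rewrite /bd -ge0_integralZl//.
rewrite -ge0_integralD//; last 2 first.
- by move=> x _; rewrite mule_ge0 ?lee_fin.
- exact: measurable_funeM.
apply: ge0_le_integral => //.
- by apply: measurable_dist; exact: measurable_funM.
- by apply: emeasurable_funD => //; apply: measurable_funeM.
move=> x _; rewrite -EFinM -EFinD lee_fin.
rewrite (_ : S p x * _ - _ = (S p x - u0 x) * P p x + (u0 x * P p x - u0 x * psi (0, x))); last by ring.
apply: le_trans (ler_normD _ _) _; rewrite lerD2r normrM mulrC.
by apply: ler_wpM2r => //; exact: HC.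
Qed.

(** The space integrals converge for each fixed t; dominated convergence in time uses the bound V on
    [0, B] and 0 beyond. *)
Theorem weak_limit :
  \int[lebesgue_measure]_(t in `[0, +oo[%classic) (\int[mu]_x (\sum_i G t x i * D i t x))
  + \int[mu]_x (u0 x * psi (0, x)) = 0.
Proof.
have [C [B [C0 B0 QC DC]]] := grid_bounds.
pose J p (t : R) := \int[mu]_x (\sum_i relaxed p t x i * grid_quot p t x i).
pose V : R := q%:R * (U * C) * (2 * B) ^+ d.
have V0 : 0 <= V by rewrite !mulr_ge0 ?exprn_ge0 ?mulr_ge0.
have JV p (t : R) : 0 <= t -> `|J p t| <= V * \1_(`[0, B]%classic) t.
  move=> t0.
  case: (leP t B) => tB; last first.
    rewrite indicE memNset ?mulr0; last by rewrite /= in_itv/= [t <= B]leNgt tB andbF.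
    rewrite /J /Rintegral (_ : (\int[mu]_x _)%E = 0%E) ?normr0//.
    apply: integral0_eq => x _; congr EFin; apply: big1 => i _.
    have := QC p t x i t0; rewrite [t <= B]leNgt tB /= mulr0 normr_le0 => /eqP ->.
    by rewrite mulr0.
  rewrite indicE mem_set ?mulr1; last by rewrite /= in_itv/= t0.
  have JB x : `|\sum_i relaxed p t x i * grid_quot p t x i| <= q%:R * (U * C) * (inbox B x)%:R.
    apply: bound_sum_mul => i; first exact: g_bound.
    by have := QC p t x i t0; rewrite tB mulr1.
  have mJ : measurable_fun setT (fun x => \sum_i relaxed p t x i * grid_quot p t x i).
    apply: measurable_sum => i; apply: measurable_funM; first exact: measurable_relaxed.
    exact: measurable_grid_quot.
  have iJ := integrable_bounded_inbox mJ JB.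
  rewrite -lee_fin /J EFin_normr_Rintegral//.
  apply: le_trans (le_abse_integral _ _ _) _ => //; first exact/measurable_EFinP.
  rewrite /V -integral_inbox//; apply: ge0_le_integral => //.
  + by apply: measurableT_comp => //; exact/measurable_EFinP.
  + exact: measurable_inboxR.
  + by move=> x _; rewrite lee_fin.
have Jc : \int[lebesgue_measure]_(t in `[0, +oo[%classic) J p t @[p --> \oo] -->
    \int[lebesgue_measure]_(t in `[0, +oo[%classic) (\int[mu]_x (\sum_i G t x i * D i t x)).
  apply: (@Rintegral_dominated _ (measurableTypeR R) _ lebesgue_measure _ J _ (fun t => V * \1_(`[0, B]%classic) t)).
  - exact: measurable_itv.
  - move=> p; apply: measurable_funS (measurableT) (@subsetT _ _) _.
    apply: (@measurable_countable_comp _ _ _ _ _ (time_index (h p / lam)) (fun n => lint (h p) (fun j =>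
      \sum_i Rx (evolve Rx e n (g p) j) i * quot e lam psi (h p) i n j))).
    by move=> n; exact: measurable_time_index.
  - by move=> t /=; rewrite in_itv/= andbT => t0; exact: inner_cvg.
  - rewrite (_ : _ \o _ = (fun t => V%:E * (\1_(`[0, B]%classic) t)%:E)%E)//.
    apply: integrableZl => //.
    apply: integrableS (measurableT) _ (@subsetT _ _) _; first exact: measurable_itv.
    by apply: integrable_indic_itv.
  - by move=> p t /=; rewrite in_itv/= andbT; exact: JV.
have lim0 := cvgD Jc initial_cvg; move: lim0.
rewrite (_ : _ + _ = cst 0); last first.
  apply/funext => p; rewrite -[RHS](discrete_weak_form lam0 cE psi_C1c (h0 p) Rx_sum (g_bound p)).
  by [].
move=> /(_ _) /cvg_lim <-; last exact: norm_hausdorff.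
exact: (lim_cst (@norm_hausdorff _ R^o)).
Qed.

End weak_limit.

(** Continuity of [df] on the compact interval makes the supremum finite, so that it does bound the
    derivative; the mean value theorem concludes. *)
Lemma sup_derive_lipschitz (R : realType) (f df : R -> R) (U : R) : 0 <= U ->
  (forall u : R, is_derive u 1 f (df u)) -> continuous df ->
  let M := sup [set `|df u| | u in `[- U, U]%classic] in
  0 <= M /\ forall u v, - U <= u <= U -> - U <= v <= U -> `|f u - f v| <= M * `|u - v|.
Proof.
move=> U0 fdf cdf M.
have cn : continuous (fun u => `|df u|).
  by move=> u; apply: (@continuous_comp _ _ _ df (fun y : R => `|y|)); [exact: cdf|exact: norm_continuous].
have NU : - U <= U by rewrite (le_trans _ U0)// oppr_le0.
have [w _ maxw] := EVT_max NU (continuous_subspaceT cn).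
have dM u : - U <= u <= U -> `|df u| <= M.
  move=> uU; apply: ub_le_sup; last by exists u.
  by exists `|df w| => _ [y yU <-]; exact: maxw.
split; first by apply: le_trans (dM 0 _); rewrite ?oppr_le0 ?U0.
suff H u v : - U <= u <= U -> - U <= v <= U -> u <= v -> `|f u - f v| <= M * `|u - v|.
  move=> u v uU vU; case: (leP u v) => [|/ltW] uv; first exact: H.
  by rewrite distrC [`|u - v|]distrC; exact: H.
move=> /andP[u1 u2] /andP[v1 v2] uv.
have cf : continuous f.
  by move=> x; apply: differentiable_continuous; apply/derivable1_diffP; have [] := fdf x.
have [x xuv E] := MVT_segment uv (fun x _ => fdf x) (continuous_subspaceT cf).
rewrite distrC [`|u - v|]distrC E normrM ler_wpM2r// dM//.
by move: xuv; rewrite in_itv/= => /andP[ux xv]; rewrite (le_trans u1 ux) (le_trans xv v2).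
Qed.

(** Splitting (1, c_i) into (1, 0) and its components along the space axes, the zeroth moment of w
    multiplies the time derivative and the first moments F multiply the space derivatives. *)
Lemma sum_directional (R : realType) (d q : nat) (psi : R * 'rV[R]_d -> R) z
    (c : 'I_q -> 'rV[R]_d) (w : 'I_q -> R) (F : 'I_d -> R) : differentiable psi z ->
  (forall k, \sum_i c i ord0 k * w i = F k) ->
  \sum_i w i * 'D_(dir c i) psi z =
  (\sum_i w i) * 'D_(1, 0) psi z + \sum_k F k * 'D_(0, delta_mx ord0 k) psi z.
Proof.
move=> dpsi cw.
have E i : 'D_(dir c i) psi z =
    'D_(1, 0) psi z + \sum_k c i ord0 k * 'D_(0, delta_mx ord0 k) psi z.
  rewrite !deriveE//.
  have -> : dir c i = (1, 0) + \sum_k c i ord0 k *: ((0, delta_mx ord0 k) : R * 'rV[R]_d).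
    rewrite /dir [in LHS](row_sum_delta (c i)).
    have -> : \sum_k c i ord0 k *: ((0, delta_mx ord0 k) : R * 'rV[R]_d) =
        (0, \sum_k c i ord0 k *: delta_mx ord0 k).
      elim: (index_enum _) => [|k s IH]; first by rewrite !big_nil.
      by rewrite !big_cons IH; congr pair; rewrite /= ?scaler0 ?addr0.
    by congr pair; rewrite /= ?addr0 ?add0r.
  rewrite linearD linear_sum; congr (_ + _); apply: eq_bigr => k _.
  by rewrite linearZ deriveE.
under eq_bigr do rewrite E mulrDr.
rewrite big_split/= -mulr_suml; congr (_ + _).
under eq_bigr do rewrite mulr_sumr.
rewrite exchange_big/=; apply: eq_bigr => k _; rewrite -cw mulr_suml.
by apply: eq_bigr => i _; rewrite mulrA [w i * _]mulrC.
Qed.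

(** * Convergence of cell averages and the essential bound *)

Section averages.
Context {R : realType} {d : nat}.
Local Notation mu := (lebesgue_rV R d).

Lemma average_cvg (u0 : 'rV[R]_d -> R) (h : nat -> R) : mu.-integrable setT (EFin \o u0) ->
  (forall p, 0 < h p) -> h @ \oo --> 0 ->
  (\int[mu]_x `|cell_average (h p) u0 (cell_index (h p) x) - u0 x|%:E)%E @[p --> \oo] --> 0%E.
Proof.
move=> iu0 h0 hc; apply: ge0_cvge0 => [p|e e0].
  by apply: integral_ge0 => x _; rewrite lee_fin.
have e4 : 0 < e / 4 by rewrite divr_gt0.
have [mu0 /(_ _ e4)[v [Lam [X [L0 X0 vl uv]]]]] := lip_approx_integrable iu0.
have mv := lipc_measurable L0 vl.
pose A : R := Lam * d%:R * (2 * (X + 1)) ^+ d.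
have A0 : 0 <= A by rewrite !mulr_ge0 ?exprn_ge0 ?mulr_ge0 ?addr_ge0.
have s0 : 0 < Num.min 1 (e / 4 / (A + 1)).
  by rewrite lt_min ltr01 divr_gt0// ltr_wpDl.
have /cvgrPdist_le /(_ _ s0) := hc; apply: filterS => p.
rewrite sub0r normrN ger0_norm ?(ltW (h0 p))//.
rewrite le_min => /andP[h1 hA].
have Ah : Lam * (d%:R * h p) * (2 * (X + h p)) ^+ d <= e / 4.
  apply: (@le_trans _ _ (A * h p)).
    rewrite /A -!mulrA ler_wpM2l// ler_wpM2l// [leRHS]mulrC ler_wpM2l ?(ltW (h0 p))//.
    by apply: lerXn2r; rewrite ?nnegrE ?mulr_ge0 ?addr_ge0 ?(ltW (h0 p))// ler_wpM2l// lerD2l.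
  move: hA; rewrite ler_pdivlMr ?ltr_wpDl// => hA; apply: le_trans hA.
  by rewrite mulrC ler_wpM2l ?(ltW (h0 p))// lerDl.
have mav : measurable_fun setT (fun x => cell_average (h p) u0 (cell_index (h p) x)).
  exact: (measurable_cell_index (cell_average (h p) u0)).
have mvn : measurable_fun setT (fun x => v (node (h p) (cell_index (h p) x))).
  exact: (measurable_cell_index (fun j => v (node (h p) j))).
apply: le_trans (integral_dist_triangle mu mav mvn mu0) _.
have I1 := lsum_average_node (h0 p) L0 X0 vl iu0.
have I2 := integral_dist_triangle mu mvn mv mu0.
have I3 := integral_sub_node (h0 p) L0 X0 vl.
(* Two quarters replace the averages by nodal values of v, one returns from the nodes to x, and one
   from v to [u0]. *)
have -> : e%:E = ((e / 4)%:E + (e / 4)%:E + ((e / 4)%:E + (e / 4)%:E))%E.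
  by rewrite -!EFinD; congr EFin; field.
apply: leeD.
  by apply: le_trans I1 _; apply: leeD => //; rewrite lee_fin.
apply: le_trans I2 _; apply: leeD.
  under eq_integral do rewrite distrC.
  by apply: le_trans I3 _; rewrite lee_fin.
by under eq_integral do rewrite distrC.
Qed.

Lemma lebesgue_rV_setT_gt0 : (0 < mu [set: 'rV[R]_d])%E.
Proof.
have := @mu_hcell R d 1 0 ltr01; rewrite expr1n => E.
apply: (@lt_le_trans _ _ 1%E); first exact: lte01.
by rewrite -E; apply: le_measure; rewrite ?inE//; exact: measurable_hcell.
Qed.

Lemma Linfty_norm_ge0 (u : 'rV[R]_d -> R) : 0 <= Linfty_norm u.
Proof. by rewrite fine_ge0// Lnorm_ge0. Qed.

Lemma Linfty_norm_ae (u : 'rV[R]_d -> R) : u \in Lfun mu +oo%E ->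
  {ae mu, forall x, `|u x| <= Linfty_norm u}.
Proof.
move=> /andP[_]; rewrite inE => uoo.
have uoo' : ('N[mu]_+oo[EFin \o u] < +oo)%E by exact: uoo.
have : \forall x \ae mu, ((abse \o (EFin \o u)) x <= 'N[mu]_+oo[EFin \o u])%E.
  (* The L^oo norm unfolds to the essential supremum only on a space of positive measure. *)
  by rewrite unlock lebesgue_rV_setT_gt0; exact: ess_sup_ge.
apply: filterS => x /=; rewrite /Linfty_norm -lee_fin fineK//.
by rewrite ge0_fin_numE// Lnorm_ge0.
Qed.

End averages.

(** * Convergence *)

Section convergence.
Context {R : realType} {d W : nat}.
Local Notation q := (W.*2.+1).
Local Notation mu := (lebesgue_rV R d).
Local Notation Zd := 'rV[int]_d.
Variables (Rx : ('I_q -> R) -> 'I_q -> R) (e : 'I_q -> Zd).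
Variables (feq : R -> 'I_q -> R) (U : R).
Local Notation K := (compact_box feq U).
Hypothesis U0 : 0 <= U.
Hypothesis Rx_box : forall f, K f -> K (Rx f).
Hypothesis Rx_contraction : forall f f', K f -> K f' ->
  \sum_(i < q) `|Rx f i - Rx f' i| <= \sum_(i < q) `|f i - f' i|.
Hypothesis Rx_sum : forall f, \sum_i Rx f i = \sum_i f i.
Hypothesis Rx_measurable : forall f : 'rV[R]_d -> 'I_q -> R,
  measurable_family f -> measurable_family (fun x => Rx (f x)).
Hypothesis Rx_fixpoint : forall f, Rx f = f -> f = feq (\sum_i f i).
Hypothesis K_feq : forall w, - U <= w <= U -> K (feq w).
Hypothesis K_sum : forall f, K f -> - U <= \sum_i f i <= U.
Hypothesis feq_dist : forall a b, - U <= a <= U -> - U <= b <= U ->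
  \sum_(i < q) `|feq a i - feq b i| = `|a - b|.
Hypothesis feq0 : feq 0 = fun=> 0.
Hypothesis sum_feq : forall w, \sum_i feq w i = w.
Hypothesis Rx_feq : forall w, Rx (feq w) = feq w.
Hypothesis feq_measurable : forall i, measurable_fun setT (fun w => feq w i).
Variable u0 : 'rV[R]_d -> R.
Hypothesis iu0 : mu.-integrable setT (EFin \o u0).
Hypothesis u0U : {ae mu, forall x, `|u0 x| <= U}.
Variables (lam : R) (h : nat -> R).
Hypothesis lam0 : 0 < lam.
Hypothesis h0 : forall p, 0 < h p.
Hypothesis h_cvg : h @ \oo --> 0.

Let zero_in : - U <= (0 : R) <= U.
Proof. by rewrite oppr_le0 U0. Qed.

(** One component of an equilibrium moves by at most the l^1 distance, and [feq 0] vanishes, so |feq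
    a i| <= |a|; K lies between the equilibria at -U and U. *)
Lemma box_bound f i : K f -> `|f i| <= U.
Proof.
move=> /(_ i)/andP[fl fu].
have H a : - U <= a <= U -> `|feq a i| <= U.
  move=> aU; rewrite -[feq a i]subr0 -[X in _ - X](congr1 (fun f => f i) feq0).
  apply: (@le_trans _ _ `|a - 0|); last by rewrite subr0 ler_norml.
  by rewrite -feq_dist// (bigD1 i)//= lerDl sumr_ge0.
have NU : - U <= U by rewrite (le_trans _ U0)// oppr_le0.
have := H (- U); rewrite lexx NU => /(_ isT); have := H U; rewrite lexx NU => /(_ isT).
rewrite !ler_norml => /andP[_ a] /andP[b _].
by rewrite (le_trans b fl) (le_trans fu a).
Qed.

Let K_step g : (forall j, K (g j)) -> forall j, K (step Rx e g j).
Proof. by move=> gK j i; exact: (Rx_box (gK (j - e i))). Qed.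

Lemma extraction : exists s : nat -> nat, {homo s : m n / (m < n)%N >-> (m < n)%N} /\
  forall k m n, (k <= m)%N -> (k <= n)%N -> forall t, 0 <= t <= k.+1%:R ->
  (L1dist mu (scheme Rx e feq u0 lam (h (s m)) t) (scheme Rx e feq u0 lam (h (s n)) t)
     <= (2^-1 ^+ k)%:E)%E.
Proof.
apply: (@diagonal_extraction (fun k m n => forall t, 0 <= t <= k.+1%:R ->
  (L1dist mu (scheme Rx e feq u0 lam (h m) t) (scheme Rx e feq u0 lam (h n) t)
     <= (2^-1 ^+ k)%:E)%E)) => k.
apply: (total_boundedness U0 K_step Rx_contraction K_feq feq_dist feq0 Rx_feq
  (fun f i => @box_bound f i) iu0 u0U lam0 h0 h_cvg (T := k.+1%:R)) => //.
Qed.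

Local Notation F := (fun p => scheme Rx e feq u0 lam (h p)).

(** From here on h plays the role of the extracted subsequence of space-steps. *)
Hypothesis F_cauchy : forall k m n, (k <= m)%N -> (k <= n)%N -> forall t, 0 <= t <= k.+1%:R ->
  (L1dist mu (F m t) (F n t) <= (2^-1 ^+ k)%:E)%E.

Let dt0 p : 0 < h p / lam. Proof. by rewrite divr_gt0. Qed.

Lemma scheme_box p t x : K (F p t x).
Proof. by apply: (evolve_box K_step) => j; exact: (K_init U0 K_feq iu0 u0U). Qed.

Lemma measurable_scheme p i :
  measurable_fun setT (fun z : measurableTypeR R * 'rV[R]_d => F p z.1 z.2 i).
Proof.
exact: (measurable_grid (fun n j => evolve Rx e n (init feq u0 (h p)) j i) (dt0 p) (h0 p)).
Qed.

Definition limit_state : R -> 'rV[R]_d -> 'I_q -> R := upper_limit F.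
Local Notation fbar := limit_state.
Local Notation ubar := (fun t x => \sum_i fbar t x i).

Lemma limit_state_box t x : K (fbar t x).
Proof. by move=> i; apply: upper_limit_box => p {}t {}x {}i; exact: scheme_box. Qed.

Lemma measurable_limit_state i :
  measurable_fun setT (fun z : measurableTypeR R * 'rV[R]_d => fbar z.1 z.2 i).
Proof.
apply: (measurable_upper_limit (lo := feq (- U)) (hi := feq U)) => [p t x {}i|p {}i].
  exact: scheme_box.
exact: measurable_scheme.
Qed.

Lemma limit_state_bounds t x : - U <= ubar t x <= U.
Proof. by apply: K_sum; exact: limit_state_box. Qed.

Lemma measurable_limit_equilibrium i :
  measurable_fun setT (fun z : measurableTypeR R * 'rV[R]_d => feq (ubar z.1 z.2) i).
Proof.
apply: (measurableT_comp (feq_measurable i)); apply: measurable_sum => k.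
exact: measurable_limit_state.
Qed.

Lemma scheme_limit_dist k t : 0 <= t <= k.+1%:R ->
  (L1dist mu (F k t) (fbar t) <= (q%:R * (2 * 2^-1 ^+ k))%:E)%E.
Proof.
apply: (L1dist_upper_limit (lo := feq (- U)) (hi := feq U)) => [p {}t x i|p i|] //.
  exact: scheme_box.
exact: measurable_scheme.
Qed.

Lemma rate_cvg : (q%:R * (2 * 2^-1 ^+ k) : R)%:E @[k --> \oo] --> 0%E.
Proof.
apply: cvg_EFin; first exact: nearW.
rewrite -[X in _ --> X](mulr0 q%:R); apply: cvgMl_tmp.
rewrite -[X in _ --> X](mulr0 2); apply: cvgMl_tmp.
by apply: cvg_expr; rewrite ger0_norm ?invr_ge0// invf_lt1// ltr1n.
Qed.

Lemma time_le_near t : \forall k \near \oo, t <= k.+1%:R :> R.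
Proof.
exists (Num.truncn t) => // k /= tk; apply: ltW; apply: lt_le_trans (truncnS_gt t) _.
by rewrite ler_nat ltnS.
Qed.

Lemma L1dist_scheme_cvg t : 0 <= t -> L1dist mu (F k t) (fbar t) @[k --> \oo] --> 0%E.
Proof.
move=> t0; apply: (@squeeze_cvge _ _ _ _ (cst 0%E) _ (fun k => (q%:R * (2 * 2^-1 ^+ k))%:E));
  [|exact: cvg_cst|exact: rate_cvg].
apply: filterS (time_le_near t) => k tk.
by rewrite L1dist_ge0/= scheme_limit_dist ?t0.
Qed.

Lemma relaxation_defect_cvg t : L1dist mu (fun x => Rx (F p t x)) (F p t) @[p --> \oo] --> 0%E.
Proof.
apply: ge0_cvge0 => [p|eps eps0]; first exact: L1dist_ge0.
have [eta eta0 H] := relaxed_defect (e := e) U0 K_step Rx_contraction K_feq feq_dist feq0 Rx_feq iu0 u0U eps0.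
have [P hP] := dx_small h_cvg eta0.
by exists P => // p /= Pp; exact: H (h0 p) (hP p Pp).
Qed.

Let mF p t : measurable_family (F p t).
Proof. by move=> i; exact: (measurable_slice (G := fun t x => F p t x i) t (measurable_scheme p i)). Qed.

Let mfbar t : measurable_family (fbar t).
Proof. by move=> i; exact: (measurable_slice (G := fun t x => fbar t x i) t (measurable_limit_state i)). Qed.

Let mRF p t : measurable_family (fun x => Rx (F p t x)).
Proof. exact: Rx_measurable. Qed.

Let mRfbar t : measurable_family (fun x => Rx (fbar t x)).
Proof. exact: Rx_measurable. Qed.

Lemma limit_state_equilibrium t : 0 <= t -> {ae mu, forall x, fbar t x = feq (ubar t x)}.
Proof.
move=> t0; suff : {ae mu, forall x, Rx (fbar t x) = fbar t x}.
  by apply: filterS => x /Rx_fixpoint.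
apply: (L1dist_eq0 (mu := mu)) => //; apply/eqP; rewrite eq_le L1dist_ge0 andbT.
(* Three comparisons: the relaxed limit with the relaxed scheme by contraction, the relaxed scheme
   with the scheme by the defect estimate, the scheme with its limit. *)
pose bd p := (L1dist mu (F p t) (fbar t) + (L1dist mu (fun x => Rx (F p t x)) (F p t)
  + L1dist mu (F p t) (fbar t)))%E.
have bd0 : bd @ \oo --> 0%E.
  rewrite -[X in _ --> X]adde0 -[X in _ --> (_ + X)%E]adde0.
  apply: cvgeD; [by rewrite adde0| exact: L1dist_scheme_cvg|].
  by apply: cvgeD => //; [exact: relaxation_defect_cvg|exact: L1dist_scheme_cvg].
rewrite -(cvg_lim _ bd0)//; apply: lime_ge; first by apply/cvg_ex; exists 0%E.
apply: nearW => p.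
apply: (le_trans (L1dist_triangle mu (g := fun x => Rx (F p t x)) _ _ _)) => //.
apply: leeD.
  rewrite L1distC; apply: le_L1dist => // x.
  by apply: Rx_contraction; [exact: scheme_box|exact: limit_state_box].
exact: L1dist_triangle.
Qed.

Lemma relaxed_limit_cvg t : 0 <= t ->
  L1dist mu (fun x => Rx (F p t x)) (fun x => feq (ubar t x)) @[p --> \oo] --> 0%E.
Proof.
move=> t0.
pose bd p := (L1dist mu (fun x => Rx (F p t x)) (F p t) + L1dist mu (F p t) (fbar t))%E.
have bd0 : bd @ \oo --> 0%E.
  rewrite -[X in _ --> X]adde0.
  by apply: cvgeD => //; [exact: relaxation_defect_cvg|exact: L1dist_scheme_cvg].
apply: (@squeeze_cvge _ _ _ _ (cst 0%E) _ bd) => //; last exact: cvg_cst.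
apply: nearW => p; rewrite L1dist_ge0 /=.
have mfu : measurable_family (fun x => feq (ubar t x)).
  by move=> i; exact: (measurable_slice (G := fun t x => feq (ubar t x) i) t (measurable_limit_equilibrium i)).
have -> : L1dist mu (fun x => Rx (F p t x)) (fun x => feq (ubar t x)) =
    L1dist mu (fun x => Rx (F p t x)) (fbar t).
  apply: ae_eq_integral => //; [exact: measurable_L1dist|exact: measurable_L1dist|].
  by apply: filterS (limit_state_equilibrium t0) => x <-.
exact: L1dist_triangle.
Qed.

(** Zero is a stationary state, so contraction against it bounds the L^1 norm at every time by that
    of the initial populations, and hence by that of [u0]. *)
Lemma scheme_L1 p t : (L1dist mu (F p t) (fun=> fun=> 0)%R < +oo)%E.
Proof.
have ev0 n : evolve Rx e n (fun=> fun=> 0) = fun=> fun=> 0.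
  elim: n => // n IH; rewrite /evolve iterS -/(evolve Rx e n _) IH.
  by apply/funext => j; apply/funext => i; rewrite /step -feq0 Rx_feq feq0.
have K0 : K (fun=> 0) by rewrite -feq0; exact: K_feq.
have -> : L1dist mu (F p t) (fun=> fun=> 0) =
    ldist (h p) (evolve Rx e (time_index (h p / lam) t) (init feq u0 (h p)))
      (evolve Rx e (time_index (h p / lam) t) (fun=> fun=> 0)).
  by rewrite ev0.
apply: le_lt_trans (ldist_evolve K_step Rx_contraction _ (h0 p) _ _) _ => //.
  by move=> j; exact: (K_init U0 K_feq iu0 u0U).
have [_ iu] := integrableP _ _ _ iu0; apply: le_lt_trans iu.
apply: lsum_le_integral => //.
- by move=> j; exact: sumr_ge0.
- by apply: measurableT_comp => //; exact: measurable_int iu0.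
- move=> j; have -> : \sum_(i < q) `|init feq u0 (h p) j i - 0| = `|cell_average (h p) u0 j - 0|.
    rewrite -feq_dist//; last exact: (cell_average_bound U0 iu0 u0U).
    by apply: eq_bigr => i _; rewrite feq0.
  apply: le_trans (cell_average_sub j 0 (h0 p) iu0) _.
  by under eq_integral do rewrite subr0.
Qed.

Lemma limit_state_integrable t i : 0 <= t -> mu.-integrable setT (EFin \o (fun x => fbar t x i)).
Proof.
move=> t0; apply/integrableP; split.
  by apply/measurable_EFinP; exact: mfbar.
have [k _ /(_ k (leqnn k)) tk] := time_le_near t.
have m0 : measurable_family ((fun=> fun=> 0) : 'rV[R]_d -> 'I_q -> R) by move=> ?; exact: measurable_cst.
apply: (@le_lt_trans _ _ (L1dist mu (fbar t) (fun=> fun=> 0))).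
  apply: ge0_le_integral => //.
  - by apply: measurableT_comp => //; apply/measurable_EFinP; exact: mfbar.
  - exact: measurable_L1dist.
  - move=> x _; rewrite lee_fin (bigD1 i)//= subr0 lerDl; exact: sumr_ge0.
apply: le_lt_trans (L1dist_triangle mu (mfbar t) (mF k t) m0) _.
rewrite lte_add_pinfty ?scheme_L1// L1distC.
by apply: le_lt_trans (scheme_limit_dist _) _; rewrite ?t0 ?ltry.
Qed.

Lemma scheme_limit_dist_sum k t : 0 <= t <= k.+1%:R ->
  (\int[mu]_x `|\sum_i F k t x i - ubar t x|%:E <= (q%:R * (2 * 2^-1 ^+ k))%:E)%E.
Proof.
move=> tk; apply: le_trans (scheme_limit_dist tk); apply: ge0_le_integral => //.
- by apply: measurable_dist; apply: measurable_sum => i; [exact: mF|exact: mfbar].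
- exact: measurable_L1dist.
- by move=> x _; rewrite lee_fin -sumrB ler_norm_sum.
Qed.

Variable c : 'I_q -> 'rV[R]_d.
Hypothesis cE : forall i, c i = lam *: map_mx intr (e i).
Variable phi : 'I_d -> R -> R.
Hypothesis momentum : forall u k, \sum_i c i ord0 k * feq u i = phi k u.

Lemma limit_state_weak_solution : weak_solution phi u0 ubar.
Proof.
move=> psi psiC /=.
have dpsi z : differentiable psi z by case: psiC => -[].
have cD v : continuous (fun z => 'D_v psi z) by case: psiC => -[_ +] _; exact.
have E t x : ubar t x * 'D_(1, 0) psi (t, x)
    + \sum_(k < d) phi k (ubar t x) * 'D_(0, delta_mx ord0 k) psi (t, x) =
    \sum_i feq (ubar t x) i * 'D_(dir c i) psi (t, x).
  by rewrite (sum_directional (F := fun k => phi k (ubar t x))) ?sum_feq.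
have feqU t x i : `|feq (ubar t x) i| <= U.
  by apply: box_bound; apply: K_feq; exact: limit_state_bounds.
have RxU p n j i : `|Rx (evolve Rx e n (init feq u0 (h p)) j) i| <= U.
  apply: box_bound; apply: Rx_box; apply: (evolve_box K_step) => {}j.
  exact: (K_init U0 K_feq iu0 u0U).
have mass p j : `|\sum_i init feq u0 (h p) j i| <= U.
  by rewrite /init sum_feq ler_norml (cell_average_bound U0 iu0 u0U).
have u0c : (\int[mu]_x `|\sum_i init feq u0 (h p) (cell_index (h p) x) i - u0 x|%:E)%E
    @[p --> \oo] --> 0%E.
  apply: cvg_trans (average_cvg iu0 h0 h_cvg); apply: near_eq_cvg; apply: nearW => p /=.
  by apply: eq_integral => x _; rewrite /init sum_feq.
have [C [B [C0 B0 _ DC]]] := grid_bounds lam0 cE psiC h0 h_cvg.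
split.
- rewrite (_ : (fun p => _) = (EFin \o (fun z : measurableTypeR R * 'rV[R]_d =>
      \sum_i feq (ubar z.1 z.2) i * 'D_(dir c i) psi (z.1, z.2)))); last first.
    by apply/funext => z; rewrite /= E.
  pose D : set (measurableTypeR R * 'rV[R]_d) := `[(0 : R), +oo[%classic `*` [set: 'rV[R]_d].
  have mD : measurable D by apply: measurableX => //; exact: measurable_itv.
  have mS : measurable_fun D (fun z : measurableTypeR R * 'rV[R]_d =>
      \sum_i feq (ubar z.1 z.2) i * 'D_(dir c i) psi (z.1, z.2)).
    apply: measurable_sum => i; apply: measurable_funM.
      by apply: measurable_funS (measurableT) (@subsetT _ _) _; exact: measurable_limit_equilibrium.
    rewrite (_ : (fun z => _) = (fun z => 'D_(dir c i) psi z)); last by apply/funext => -[].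
    exact: (measurable_continuous_grid (@cD (dir c i))).
  apply/integrableP; split; first exact/measurable_EFinP.
  (* At nonnegative times the integrand is bounded, and it vanishes outside this set of finite
     measure. *)
  pose A : set (measurableTypeR R * 'rV[R]_d) := `[0, B]%classic `*` [set x | inbox B x].
  have mA : measurable A by apply: measurableX; [exact: measurable_itv|exact: measurable_inbox].
  apply: (@le_lt_trans _ _ (\int[(lebesgue_measure \x mu)%E]_(z in D)
      ((q%:R * (U * C))%:E * (\1_A z)%:E))%E).
    apply: ge0_le_integral => //.
    + by apply: measurableT_comp => //; exact/measurable_EFinP.
    + by apply: measurable_funeM; apply/measurable_EFinP; exact: measurable_indic.
    move=> [t x] [/= + _]; rewrite in_itv/= andbT => t0; rewrite lee_fin.
    apply: bound_sum_mul => // i; apply: le_trans (DC t x i t0) _; rewrite -mulrA ler_wpM2l//.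
    rewrite indicE; case: (boolP (inbox B x)) => xB; last by rewrite mul0r.
    case: (leP t B) => tB; last by rewrite mulr0.
    by rewrite mulr1 mem_set// /A; split => //=; rewrite in_itv/= t0.
  rewrite ge0_integralZl//; last 2 first.
  + by apply/measurable_EFinP; exact: measurable_indic.
  + by rewrite lee_fin !mulr_ge0.
  rewrite integral_indic//; apply: lte_mul_pinfty => //; first by rewrite lee_fin !mulr_ge0.
  apply: (@le_lt_trans _ _ ((lebesgue_measure \x mu) A)%E).
    by apply: le_measure; rewrite ?inE//; exact: measurableI.
  rewrite /A product_measure1E//; last exact: measurable_inbox.
  have lB : (@lebesgue_measure R `[0%R, B]%classic < +oo)%E.
    by rewrite lebesgue_measure_itv/=; case: ifP => _; rewrite ?ltry.
  by apply: lte_mul_pinfty; [exact: measure_ge0|rewrite ge0_fin_numE|exact: mu_inbox_fin].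
- exact: (integrable_initial_term psiC iu0).
under eq_Rintegral do under eq_Rintegral do rewrite E.
exact: (weak_limit lam0 cE psiC h0 h_cvg U0 Rx_sum RxU mass iu0 u0c
  (G := fun t x => feq (ubar t x)) measurable_limit_equilibrium feqU relaxed_limit_cvg).
Qed.

End convergence.

Lemma flux_lipschitz (R : realType) (d : nat) (phi : 'I_d -> R -> R) (a : 'I_d -> R) (U : R) :
  (forall k, (forall u, derivable (phi k) u 1) /\ continuous (derive1 (phi k))) -> 0 <= U ->
  let M := sup [set `|\sum_(k < d) a k * derive1 (phi k) u| | u in `[- U, U]%classic] in
  0 <= M /\ forall u v, - U <= u <= U -> - U <= v <= U ->
    `|\sum_(k < d) a k * phi k u - \sum_(k < d) a k * phi k v| <= M * `|u - v|.
Proof.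
move=> phiC U0.
apply: (@sup_derive_lipschitz R (fun u => \sum_(k < d) a k * phi k u)
  (fun u => \sum_(k < d) a k * derive1 (phi k) u)) => // u.
  have -> : (fun u => \sum_(k < d) a k * phi k u) = \sum_(k < d) (fun u => a k * phi k u).
    by apply/funext => w; rewrite fct_sumE.
  apply: is_derive_sum => k; apply: is_deriveZ; rewrite derive1E.
  by apply: DeriveDef; first exact: (phiC k).1.
elim: (index_enum _) => [|k r IH].
  by under eq_fun do rewrite big_nil; exact: cvg_cst.
under eq_fun do rewrite big_cons.
by apply: continuousD IH; apply: continuousM; [exact: cvg_cst|exact: (phiC k).2].
Qed.

Lemma populationsE (R : realType) (d W : nat) (ws wa : R) (feq : R -> 'I_(W.*2.+1) -> R)
    (e : 'I_(W.*2.+1) -> 'rV[int]_d) (u0 : 'rV[R]_d -> R) (h : R) n :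
  populations ws wa feq e u0 h n = evolve (relaxation ws wa feq) e n (init feq u0 h).
Proof.
by elim: n => // n IH; apply/funext => j; apply/funext => i; rewrite /= IH.
Qed.

(** The bound on [G k] holds on [0, k + 1] only; for large k this interval contains [0, T]. *)
Lemma LinftyL1_norm_cvg0 (R : realType) (d : nat) (G : nat -> R -> 'rV[R]_d -> R) (b : nat -> R) (T : R) :
  0 < T -> (forall k t, 0 <= t <= k.+1%:R -> (\int[lebesgue_rV R d]_x `|G k t x|%:E <= (b k)%:E)%E) ->
  (b k)%:E @[k --> \oo] --> 0%E -> LinftyL1_norm T (G k) @[k --> \oo] --> 0%E.
Proof.
move=> T0 Gb b0; apply: (@squeeze_cvge _ _ _ _ (cst 0%E) _ (fun k => (b k)%:E)) => //; last exact: cvg_cst.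
apply: filterS (time_le_near T) => k Tk; apply/andP; split.
  apply: (le_trans (Lnorm_ge0 (lebesgue_rV R d) 1%E (EFin \o G k 0))).
  by apply: ereal_sup_ubound; exists 0 => //=; rewrite in_itv/= lexx ltW.
apply: ge_ereal_sup => _ [t /= + <-]; rewrite in_itv/= => /andP[t0 tT].
by rewrite Lnorm1; apply: Gb; rewrite t0 (le_trans tT Tk).
Qed.

Theorem theorem4p10 (R : realType) (d W : nat) (d_ge1 : (1 <= d)%N)
  (W_ge1 : (1 <= W)%N) (lam : R) (lam_gt0 : 0 < lam)
  (* velocities c_i = lam * e_i with e_i an integer vector *)
  (c : 'I_(W.*2.+1) -> 'rV[R]_d) (e : 'I_(W.*2.+1) -> 'rV[int]_d)
  (cE : forall i, c i = lam *: map_mx intr (e i))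
  (c1 : c ord0 = 0)
  (c_opp : forall l : 'I_W, c (even_idx l) = - c (odd_idx l))
  (* fluxes *)
  (phi : 'I_d -> R -> R)
  (phi_C1 : forall k, (forall u, derivable (phi k) u 1) /\
                      continuous (derive1 (phi k)))
  (phi_nonconstant : forall k, exists u v, phi k u <> phi k v)
  (phi0 : forall k, phi k 0 = 0)
  (* initial datum *)
  (u0 : 'rV[R]_d -> R)
  (u0_L1 : u0 \in Lfun (lebesgue_rV R d) 1%E)
  (u0_Linfty : u0 \in Lfun (lebesgue_rV R d) +oo%E)
  (u0_BV : BV_rV u0)
  (* equilibria *)
  (L : 'I_(W.*2.+1) -> R) (N : 'I_(W.*2.+1) -> 'I_d -> R)
  (L_sym : forall l : 'I_W, L (even_idx l) = L (odd_idx l))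
  (N_antisym : forall (l : 'I_W) k, N (even_idx l) k = - N (odd_idx l) k)
  (N_ge0 : forall (l : 'I_W) k, 0 <= N (even_idx l) k)
  (L_sum : L ord0 + 2 * \sum_(l < W) L (even_idx l) = 1)
  (N1 : forall k, N ord0 k = 0)
  (cN : forall k p : 'I_d,
    2 * \sum_(l < W) c (even_idx l) ord0 k * N (even_idx l) p = (k == p)%:R)
  (* relaxation parameters *)
  (ws wa : R) (ws_bounds : 0 < ws <= 2) (wa_bounds : 0 < wa <= 2)
  (ws_L1 : Num.max 0 (ws - 1) <= ws * L ord0)
  (wa_bound : forall l : 'I_W,
    wa * sup [set `|\sum_(k < d) N (even_idx l) k * derive1 (phi k) u| |
                u in `[- Linfty_norm u0, Linfty_norm u0]%classic]
    <= ws * L (even_idx l)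
       + 2^-1 * Num.min (Num.min (2 - ws - wa) 0) (wa - ws))
  (* space-steps *)
  (dx : nat -> R) (dx_gt0 : forall p, 0 < dx p) (dx_cvg : dx @ \oo --> 0) :
  let mu := lebesgue_rV R d in
  let feq := equilibrium L N phi in
  let uinf := Linfty_norm u0 in
  let fD := fun p => f_Delta lam ws wa feq e u0 (dx p) in
  let uD := fun p => u_Delta lam ws wa feq e u0 (dx p) in
  exists (s : nat -> nat) (fbar : R -> 'rV[R]_d -> 'I_(W.*2.+1) -> R),
    let ubar := fun t x => \sum_(i < W.*2.+1) fbar t x i in
    {homo s : m n / (m < n)%N >-> (m < n)%N}
    /\ (forall t, 0 <= t ->
          (forall i, (fun x => fbar t x i) \in Lfun mu 1%E)
          /\ {ae mu, forall x, compact_box feq uinf (fbar t x)})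
    /\ (forall T, 0 < T ->
          LinftyL1_norm T
            (fun t x => l1_norm (fun i => fD (s p) t x i - fbar t x i))
          @[p --> \oo] --> 0%E)
    /\ (forall t, 0 <= t ->
          {ae mu, forall x, - uinf <= ubar t x <= uinf})
    /\ (forall T, 0 < T ->
          LinftyL1_norm T (fun t x => uD (s p) t x - ubar t x)
          @[p --> \oo] --> 0%E)
    /\ (forall t, 0 <= t ->
          {ae mu, forall x, forall i, fbar t x i = feq (ubar t x) i})
    /\ weak_solution phi u0 ubar.
Proof.
move=> mu feq uinf fD uD.
pose U := Linfty_norm u0; pose Rx := relaxation ws wa feq.
have U0 : 0 <= U by exact: Linfty_norm_ge0.
have iu0 : mu.-integrable setT (EFin \o u0) by exact/Lfun1_integrable.
have u0U : {ae mu, forall x, `|u0 x| <= U} by exact: Linfty_norm_ae.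
have M0 l := (flux_lipschitz (N (even_idx l)) phi_C1 U0).1.
have G_lip l := (flux_lipschitz (N (even_idx l)) phi_C1 U0).2.
have Rx_box := relaxation_box L_sym N_antisym L_sum N1 ws_bounds wa_bounds ws_L1 U0 M0 G_lip wa_bound.
have Rx_contr := relaxation_contraction L_sym N_antisym L_sum N1 ws_bounds wa_bounds ws_L1 G_lip wa_bound.
have Rx_sum := sum_relaxation phi L_sym N_antisym L_sum N1 ws wa.
have mphi k : measurable_fun setT (phi k).
  apply: continuous_measurable_fun => u; apply: differentiable_continuous.
  by apply/derivable1_diffP; exact: (phi_C1 k).1.
have mfeq i : measurable_fun setT (fun w => feq w i).
  apply: measurable_funD; first exact: measurable_funM.
  by apply: measurable_sum => k; exact: measurable_funM.
have mRx (f : 'rV[R]_d -> 'I_(W.*2.+1) -> R) : measurable_family f -> measurable_family (fun x => Rx (f x)).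
  move=> mf i; have mu' : measurable_fun setT (fun x => \sum_(m < W.*2.+1) f x m).
    by apply: measurable_sum => m; exact: mf.
  have mfu m : measurable_fun setT (fun x => feq (\sum_(m < W.*2.+1) f x m) m).
    exact: measurableT_comp (mfeq m) mu'.
  rewrite /Rx /relaxation; case: (i == ord0).
    by apply: measurable_funD; apply: measurable_funM => //; exact: mf.
  apply: measurable_funB; last by apply: measurable_funM => //; apply: measurable_funB => //; exact: mf.
  by apply: measurable_funD; apply: measurable_funM => //; exact: mf.
have Rx_fix f : Rx f = f -> f = feq (\sum_i f i).
  move=> Rf; apply/funext => i; apply: (relaxation_fixpoint ws_bounds wa_bounds) => {}i.
  by rewrite -[RHS](congr1 (fun g => g i) Rf).
have K_feq := feq_box L_sym N_antisym L_sum N1 ws_bounds wa_bounds ws_L1 M0 G_lip wa_bound.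
have K_sum := @box_sum _ _ _ L N phi L_sym N_antisym L_sum N1 U.
have feq_dist := sum_dist_feq L_sym N_antisym L_sum N1 ws_bounds wa_bounds ws_L1 M0 G_lip wa_bound.
have feq00 : feq 0 = fun=> 0 by apply/funext => i; exact: feq0.
have sumf := sum_feq phi L_sym N_antisym L_sum N1.
have Rx_feq w : Rx (feq w) = feq w by apply/funext => i; exact: relaxation_feq.
have [s [s_homo s_cauchy]] := @extraction R d W Rx e feq U U0 Rx_box Rx_contr K_feq feq_dist feq00 Rx_feq
  u0 iu0 u0U lam dx lam_gt0 dx_gt0 dx_cvg.
pose h p := dx (s p).
have h0 p : 0 < h p by exact: dx_gt0.
have h_cvg : h @ \oo --> 0.
  have ns n : (n <= s n)%N.
    by elim: n => // n IH; apply: leq_ltn_trans IH _; exact: s_homo.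
  apply/cvgrPdist_le => eps eps0; move/cvgrPdist_le : dx_cvg => /(_ _ eps0)[P _ HP].
  by exists P => // n /= Pn; apply: HP => /=; exact: leq_trans Pn (ns n).
pose fbar := limit_state Rx e feq u0 lam h.
have fDE p t x : fD p t x = scheme Rx e feq u0 lam (dx p) t x.
  by rewrite /fD /f_Delta populationsE.
exists s, fbar => ubar; split => //.
have box t x : compact_box feq U (fbar t x).
  exact: (@limit_state_box R d W Rx e feq U U0 Rx_box K_feq u0 iu0 u0U lam h h0).
have F_cauchy : forall k m n, (k <= m)%N -> (k <= n)%N -> forall t, 0 <= t <= k.+1%:R ->
    (L1dist mu (scheme Rx e feq u0 lam (h m) t) (scheme Rx e feq u0 lam (h n) t) <= (2^-1 ^+ k)%:E)%E.
  exact: s_cauchy.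
split.
  move=> t t0; split; last exact: aeW.
  move=> i; apply/Lfun1_integrable.
  exact: (limit_state_integrable U0 Rx_box Rx_contr K_feq feq_dist feq00 Rx_feq iu0 u0U lam_gt0 h0 F_cauchy).
split.
  move=> T T0; apply: (LinftyL1_norm_cvg0 T0 _ (@rate_cvg R W)) => k t tk.
  apply: le_trans (scheme_limit_dist U0 Rx_box K_feq iu0 u0U lam_gt0 h0 F_cauchy tk).
  rewrite /L1dist le_eqVlt; apply/orP; left; apply/eqP; apply: eq_integral => x _.
  congr EFin; rewrite /l1_norm ger0_norm ?sumr_ge0//.
  by apply: eq_bigr => i _; rewrite fDE.
split; first by move=> t t0; apply: aeW => x; exact: K_sum.
split.
  move=> T T0; apply: (LinftyL1_norm_cvg0 T0 _ (@rate_cvg R W)) => k t tk.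
  apply: le_trans (scheme_limit_dist_sum U0 Rx_box K_feq iu0 u0U lam_gt0 h0 F_cauchy tk).
  rewrite le_eqVlt; apply/orP; left; apply/eqP; apply: eq_integral => x _.
  by rewrite /uD /u_Delta; under eq_bigr do rewrite -/(fD _ _ _ _) fDE.
split.
  move=> t t0.
  have := limit_state_equilibrium U0 Rx_box Rx_contr mRx Rx_fix K_feq feq_dist feq00 Rx_feq
    iu0 u0U lam_gt0 h0 h_cvg F_cauchy t0.
  by apply: filterS => x E i; exact: (congr1 (fun f => f i) E).
apply: (limit_state_weak_solution U0 Rx_box Rx_contr Rx_sum mRx Rx_fix K_feq K_sum feq_dist feq00 sumf
  Rx_feq mfeq iu0 u0U lam_gt0 h0 h_cvg F_cauchy cE) => u k.
exact: momentum_feq.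
Qed.
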